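(* Let $E$ be a smooth vector bundle over a smooth manifold $M$ and let $A$ be a Lie algebroid over $M$. If there exists a Lie subalgebroid $B$ of $A$ (over $M$) of codimension $q$ with a linear representation $\nabla\colon\Gamma(B)\times\Gamma(E)\to\Gamma(E)$ with vanishing Atiyah class $\alpha_\nabla\in H^1(B,\operatorname{Hom}(A/B,\operatorname{End}(E)))$, then the Pontryagin spaces $$\operatorname{Pont}^l_A(E)\subseteq H^l(A)$$ are all trivial for $l>q$.
   Context: For a Lie algebroid $A\to M$, $\Omega^\bullet(A)=\Gamma(\wedge^\bullet A^* )$ with Lie algebroid differential $\mathbf d_A$ has cohomology $H^\bullet(A)$. For a vector bundle $E\to M$ choose any linear $A$-connection $\nabla'$ on $E$, with curvature $R_{\nabla'}\in\Gamma(\wedge^2A^*\otimes\operatorname{End}(E))$. For $i\ge1$ the form $\operatorname{tr}(R_{\nabla'}^i)\in\Omega^{2i}(A)$ is closed and its class $\sigma_A^i(E)\in H^{2i}(A)$ is independent of $\nabla'$. $\operatorname{Pont}_A^\bullet(E)\subseteq H^\bullet(A)$ is the $\mathbb R$-subalgebra generated by the $\sigma_A^i(E)$, $i\ge1$, and $\operatorname{Pont}_A^l(E)=\operatorname{Pont}_A^\bullet(E)\cap H^l(A)$. The codimension of $B$ in $A$ is $\operatorname{rank}A-\operatorname{rank}B$. A linear representation of $B$ on $E$ is a flat linear $B$-connection on $E$. Atiyah class: let $\tilde\nabla\colon\Gamma(A)\times\Gamma(E)\to\Gamma(E)$ be any linear $A$-connection extending $\nabla$, i.e. $\tilde\nabla_be=\nabla_be$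 for $b\in\Gamma(B)$, $e\in\Gamma(E)$. Since $\nabla$ is flat, $\omega_{\tilde\nabla}(b,\bar a)(e)=R_{\tilde\nabla}(b,a)e$ for $b\in\Gamma(B)$, $a\in\Gamma(A)$, $e\in\Gamma(E)$ is a well-defined element $\omega_{\tilde\nabla}\in\Omega^1(B,\operatorname{Hom}(A/B,\operatorname{End}(E)))$. The bundle $\operatorname{Hom}(A/B,\operatorname{End}(E))$ carries the flat $B$-connection $\nabla^{\operatorname{Hom}}$ induced by $\nabla$ and the flat Bott connection $\nabla^B_b\bar a=\overline{[b,a]}$ on $A/B$; $\omega_{\tilde\nabla}$ is closed for $\mathbf d_{\nabla^{\operatorname{Hom}}}$, and $\alpha_\nabla:=[\omega_{\tilde\nabla}]\in H^1(B,\operatorname{Hom}(A/B,\operatorname{End}(E)))$ is independent of the extension $\tilde\nabla$. It is called the Atiyah class of the representation $\nabla$ of $B\subseteq A$ on $E$. *)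

(* Defs.v *)
From HB Require Import structures.
From mathcomp Require Import all_boot all_order all_algebra all_fingroup.
From mathcomp Require Import all_classical all_reals all_analysis.
Set Implicit Arguments.
Unset Strict Implicit.
Unset Printing Implicit Defensive.
Import Order.TTheory GRing.Theory Num.Theory.
Import numFieldNormedType.Exports.
Local Open Scope classical_set_scope.
Local Open Scope ring_scope.

Section SmoothManifolds.
Variable R : realType.

(* Used only for open U: derivatives at points of U are then insensitive to
   the values of f outside U. *)
Fixpoint Ck n (k : nat) (U : set 'rV[R]_n) (f : 'rV[R]_n -> R) : Prop :=
  (forall x, U x -> {for x, continuous f}) /\
  if k is k'.+1 then
    forall i : 'I_n, (forall x, U x -> derivable f x (delta_mx 0 i)) /\
      Ck k' U (fun x => 'D_(delta_mx 0 i) f x)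
  else True.

Definition Cinfty n (U : set 'rV[R]_n) (f : 'rV[R]_n -> R) : Prop :=
  forall k, Ck k U f.

(* The total functions chart_map and chart_inv are meaningful only on
   chart_dom and chart_img. *)
Record chart (T : topologicalType) (n : nat) := Chart {
  chart_dom : set T;
  chart_map : T -> 'rV[R]_n;
  chart_inv : 'rV[R]_n -> T }.

Definition chart_img T n (c : chart T n) : set 'rV[R]_n :=
  chart_map c @` chart_dom c.

Definition is_chart T n (c : chart T n) : Prop :=
  [/\ open (chart_dom c), open (chart_img c),
      forall x, chart_dom c x -> chart_inv c (chart_map c x) = x,
      forall x, chart_dom c x -> {for x, continuous (chart_map c)} &
      forall y, chart_img c y -> {for y, continuous (chart_inv c)}].

Definition smooth_transition T n (c c' : chart T n) : Prop :=
  forall i, Cinfty (chart_map c @` (chart_dom c `&` chart_dom c'))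
    (fun y => chart_map c' (chart_inv c y) 0 i).

Record manifold := Manifold {
  manifold_sort :> topologicalType;
  manifold_dim : nat;
  atlas : set (chart manifold_sort manifold_dim);
  manifold_hausdorff : hausdorff_space manifold_sort;
  manifold_second_countable : @second_countable manifold_sort;
  atlas_chart : forall c, atlas c -> is_chart c;
  atlas_cover : forall x, exists2 c, atlas c & chart_dom c x;
  atlas_compat : forall c c', atlas c -> atlas c' -> smooth_transition c c' }.

(* U is meant to be open in M. *)
Definition smooth_on (M : manifold) (U : set M) (f : M -> R) : Prop :=
  forall c, atlas c ->
    Cinfty (chart_map c @` (chart_dom c `&` U)) (f \o chart_inv c).

Definition smooth_fun (M : manifold) (f : M -> R) : Prop := smooth_on setT f.

End SmoothManifolds.

Section VectorBundles.
Variables (R : realType) (M : manifold R).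

(* A local trivialization over U, given by the basis of each fibre that
   corresponds to the standard basis of R^r. *)
Record frame (V : M -> vectType R) (r : nat) := Frame {
  frame_dom : set M;
  frame_vec : forall x, r.-tuple (V x) }.

(* A vector bundle of constant rank, presented by its fibres and a cocycle of
   smoothly compatible local trivializations. *)
Record vbundle := VBundle {
  fiber :> M -> vectType R;
  rank : nat;
  frames : set (frame fiber rank);
  frame_open : forall e, frames e -> open (frame_dom e);
  frame_basis : forall e, frames e ->
    forall x, frame_dom e x -> basis_of fullv (frame_vec e x);
  frame_cover : forall x, exists2 e, frames e & frame_dom e x;
  frame_compat : forall e e', frames e -> frames e' -> forall i j : 'I_rank,
    smooth_on (frame_dom e `&` frame_dom e')
      (fun x => coord (frame_vec e' x) j (tnth (frame_vec e x) i)) }.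

(* All fibrewise families; Gamma(V) consists of those satisfying
   smooth_section.  Operators on sections below are defined on all families,
   but are constrained, and used, on smooth ones only. *)
Definition section (V : M -> vectType R) := forall x, V x.

Definition smooth_section (E : vbundle) (s : section E) : Prop :=
  forall e, frames e -> forall i,
    smooth_on (frame_dom e) (fun x => coord (frame_vec e x) i (s x)).

Definition sadd (V : M -> vectType R) (s t : section V) : section V :=
  fun x => s x + t x.

Definition sscale (V : M -> vectType R) (f : M -> R) (s : section V)
  : section V := fun x => f x *: s x.

Definition smooth_bundle_map (E F : vbundle)
    (phi : forall x, 'Hom(E x, F x)) : Prop :=
  forall e f, frames e -> frames f -> forall i j,
    smooth_on (frame_dom e `&` frame_dom f)
      (fun x => coord (frame_vec f x) j (phi x (tnth (frame_vec e x) i))).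

(* Tangent vectors at x are the derivations at x of the algebra of smooth
   functions. *)
Definition tangent_vector (x : M) (D : (M -> R) -> R) : Prop :=
  (forall (c : R) f g, smooth_fun f -> smooth_fun g ->
     D (fun y => c * f y + g y) = c * D f + D g) /\
  (forall f g, smooth_fun f -> smooth_fun g ->
     D (fun y => f y * g y) = f x * D g + D f * g x).

End VectorBundles.

Section LieAlgebroids.
Variables (R : realType) (M : manifold R).

Record is_anchor (A : vbundle M)
    (rho : forall x, A x -> (M -> R) -> R) : Prop := IsAnchor {
  anchor_tangent : forall x v, tangent_vector x (rho x v);
  anchor_linear : forall x (c : R) u v f, smooth_fun f ->
    rho x (c *: u + v) f = c * rho x u f + rho x v f;
  anchor_smooth : forall e f, frames e -> smooth_fun f -> forall i,
    smooth_on (frame_dom e) (fun x => rho x (tnth (frame_vec e x) i) f) }.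

(* bracket_anchor is a consequence of the other axioms, kept for convenience. *)
Record is_lie_bracket (A : vbundle M) (rho : forall x, A x -> (M -> R) -> R)
    (br : section A -> section A -> section A) : Prop := IsLieBracket {
  bracket_smooth : forall a b, smooth_section a -> smooth_section b ->
    smooth_section (br a b);
  bracket_linear : forall (k : R) a b c,
    smooth_section a -> smooth_section b -> smooth_section c ->
    forall x, br a (sadd (sscale (fun=> k) b) c) x = k *: br a b x + br a c x;
  bracket_anti : forall a b, smooth_section a -> smooth_section b ->
    forall x, br a b x = - br b a x;
  bracket_jacobi : forall a b c,
    smooth_section a -> smooth_section b -> smooth_section c ->
    forall x, br a (br b c) x + br b (br c a) x + br c (br a b) x = 0;
  bracket_leibniz : forall a b f,
    smooth_section a -> smooth_section b -> smooth_fun f ->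
    forall x, br a (sscale f b) x = f x *: br a b x + rho x (a x) f *: b x;
  bracket_anchor : forall a b f,
    smooth_section a -> smooth_section b -> smooth_fun f ->
    forall x, rho x (br a b x) f =
      rho x (a x) (fun y => rho y (b y) f) -
      rho x (b x) (fun y => rho y (a y) f) }.

Record lie_algebroid := LieAlgebroid {
  lie_bundle :> vbundle M;
  anchor : forall x, lie_bundle x -> (M -> R) -> R;
  bracket : section lie_bundle -> section lie_bundle -> section lie_bundle;
  anchorP : is_anchor anchor;
  bracketP : is_lie_bracket anchor bracket }.

Definition smap (B A : vbundle M) (iota : forall x, 'Hom(B x, A x))
  (b : section B) : section A := fun x => iota x (b x).

(* A Lie subalgebroid over M is given by its inclusion: an injective morphism
   of Lie algebroids over the identity of M. *)
Record lie_subalgebroid (B A : lie_algebroid)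
    (iota : forall x, 'Hom(B x, A x)) : Prop := LieSubalgebroid {
  sub_smooth : smooth_bundle_map (E := B) (F := A) iota;
  sub_inj : forall x, injective (iota x);
  sub_anchor : forall x v f, smooth_fun f ->
    anchor (iota x v) f = anchor v f;
  sub_bracket : forall b b', smooth_section b -> smooth_section b' ->
    forall x, smap iota (bracket b b') x =
              bracket (smap iota b) (smap iota b') x }.

Record is_connection (A : lie_algebroid) (E : vbundle M)
    (D : section A -> section E -> section E) : Prop := IsConnection {
  conn_smooth : forall a e, smooth_section a -> smooth_section e ->
    smooth_section (D a e);
  conn_linear_l : forall f a b e, smooth_fun f ->
    smooth_section a -> smooth_section b -> smooth_section e ->
    forall x, D (sadd (sscale f a) b) e x = f x *: D a e x + D b e x;
  conn_add_r : forall a e e',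
    smooth_section a -> smooth_section e -> smooth_section e' ->
    forall x, D a (sadd e e') x = D a e x + D a e' x;
  conn_leibniz : forall f a e, smooth_fun f ->
    smooth_section a -> smooth_section e ->
    forall x, D a (sscale f e) x = f x *: D a e x + anchor (a x) f *: e x }.

Definition curvature (A : lie_algebroid) (E : vbundle M)
    (D : section A -> section E -> section E)
    (a b : section A) (e : section E) : section E :=
  fun x => D a (D b e) x - D b (D a e) x - D (bracket a b) e x.

Definition representation (A : lie_algebroid) (E : vbundle M)
    (D : section A -> section E -> section E) : Prop :=
  is_connection D /\
  forall a b e, smooth_section a -> smooth_section b -> smooth_section e ->
    forall x, curvature D a b e x = 0.

End LieAlgebroids.

Section Forms.
Variables (R : realType) (M : manifold R).

Definition form (A V : M -> vectType R) (k : nat) :=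
  forall x, ('I_k -> A x) -> V x.

Definition upd (T : Type) k (v : 'I_k -> T) (i : 'I_k) (u : T) : 'I_k -> T :=
  fun j => if j == i then u else v j.

Definition alternating (A V : M -> vectType R) k (w : form A V k) : Prop :=
  (forall x v i (c : R) u u', w x (upd v i (c *: u + u')) =
     c *: w x (upd v i u) + w x (upd v i u')) /\
  (forall x v i j, i != j -> v i = v j -> w x v = 0).

(* The normalization matching the differentials below, which have no factor
   1/(k+1). *)
Definition wedge (A U V W : M -> vectType R) (m : forall x, U x -> V x -> W x)
    k l (w : form A U k) (w' : form A V l) : form A W (k + l) :=
  fun x v => ((k`! * l`!)%:R : R)^-1 *:
    \sum_(s : 'S_(k + l)) (-1) ^+ (s : bool) *:
      m x (w x (fun i => v (s (lshift l i))))
          (w' x (fun j => v (s (rshift k j)))).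

Definition trivial_line : M -> vectType R := fun=> R^o : vectType R.

Definition sform (A : M -> vectType R) k := form A trivial_line k.

Definition is_sform (A : vbundle M) k (w : sform A k) : Prop :=
  alternating w /\
  forall e, frames e -> forall I : 'I_k -> 'I_(rank A),
    smooth_on (frame_dom e)
      (fun x => w x (fun m => tnth (frame_vec e x) (I m))).

(* The arguments (a_m)_{m <> i} with a_j replaced by [a_i, a_j]. *)
Definition bracket_args (A : lie_algebroid M) k (a : 'I_k.+1 -> section A)
    (i j : 'I_k.+1) (x : M) : 'I_k -> A x :=
  fun m => if lift i m == j then bracket (a i) (a j) x else a (lift i m) x.

(* eta = d_A w, by the Koszul formula; a relation, which determines eta because
   vectors of A extend to smooth sections.  In the summand of (i, j) the bracket
   stands in the slot of a_j instead of the first one, which turns the usual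
   sign (-1)^(i+j) into -(-1)^i. *)
Definition is_differential (A : lie_algebroid M) k
    (w : sform A k) (eta : sform A k.+1) : Prop :=
  forall a : 'I_k.+1 -> section A, (forall i, smooth_section (a i)) ->
  forall x, eta x (fun i => a i x) =
    \sum_(i < k.+1) (-1) ^+ i *
      (anchor (a i x) (fun y => w y (fun m => a (lift i m) y)) -
       \sum_(j < k.+1 | (i < j)%N) w x (bracket_args a i j x)).

(* Inhomogeneous forms: as alternating forms of degree > rank A vanish, the
   direct product of the Omega^k(A) is their direct sum. *)
Definition tform (A : M -> vectType R) := forall k, sform A k.

Definition is_tform (A : vbundle M) (w : tform A) : Prop :=
  forall k, is_sform (w k).

Definition tzero (A : M -> vectType R) : tform A := fun _ _ _ => 0.

Definition tone (A : M -> vectType R) : tform A := fun k _ _ => (k == 0%N)%:R.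

Definition tadd (A : M -> vectType R) (w w' : tform A) : tform A :=
  fun k x v => w k x v + w' k x v.

Definition tscale (A : M -> vectType R) (c : R) (w : tform A) : tform A :=
  fun k x v => c * w k x v.

Definition tmul (A : M -> vectType R) (w w' : tform A) : tform A :=
  fun n x v => \sum_(i < n.+1)
    wedge (W := trivial_line) (fun _ (r s : R^o) => r * s) (w i) (w' (n - i)%N)
      (v \o cast_ord (subnKC (leq_ord i))).

Definition homogeneous (A : M -> vectType R) l (w : sform A l) : tform A :=
  fun n x v => if l =P n is ReflectT ln then w x (v \o cast_ord ln) else 0.

Definition is_tdifferential (A : lie_algebroid M) (w eta : tform A) : Prop :=
  (forall x v, eta 0%N x v = 0) /\ forall k, is_differential (w k) (eta k.+1).

Definition closed_form (A : lie_algebroid M) (w : tform A) : Prop :=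
  is_tform w /\ is_tdifferential w (@tzero A).

Definition cohomologous (A : lie_algebroid M) (w w' : tform A) : Prop :=
  exists2 eta : tform A, is_tform eta &
    is_tdifferential eta (tadd w (tscale (-1) w')).

Definition coh_class (A : lie_algebroid M) (w : tform A) : set (tform A) :=
  [set w' | is_tform w' /\ cohomologous w' w].

(* The total cohomology H(A), its elements being cosets of forms. *)
Definition coh_total (A : lie_algebroid M) : set (set (tform A)) :=
  [set coh_class w | w in @closed_form A].

Definition coh_degree (A : lie_algebroid M) (l : nat) : set (set (tform A)) :=
  [set coh_class (homogeneous w)
    | w in [set w : sform A l | closed_form (homogeneous w)]].

Definition coh_zero (A : lie_algebroid M) : set (tform A) :=
  coh_class (@tzero A).

Record subalgebra (A : lie_algebroid M) (S : set (set (tform A))) : Prop := {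
  subalg_coh : S `<=` @coh_total A;
  subalg_one : S (coh_class (@tone A));
  subalg_add : forall w w', closed_form w -> closed_form w' ->
    S (coh_class w) -> S (coh_class w') -> S (coh_class (tadd w w'));
  subalg_scale : forall c w, closed_form w ->
    S (coh_class w) -> S (coh_class (tscale c w));
  subalg_mul : forall w w', closed_form w -> closed_form w' ->
    S (coh_class w) -> S (coh_class w') -> S (coh_class (tmul w w')) }.

End Forms.

Arguments tzero {R M} A k x v.
Arguments tone {R M} A k x v.
Arguments coh_total {R M} A c.
Arguments coh_degree {R M} A l c.
Arguments coh_zero {R M} A w.

Section Pontryagin.
Variables (R : realType) (M : manifold R) (A : lie_algebroid M).
Variable E : vbundle M.

Definition endform k := form A (fun x => 'End(E x) : vectType R) k.

Definition is_endform k (w : endform k) : Prop :=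
  alternating w /\
  forall e f, frames e -> frames f ->
  forall (I : 'I_k -> 'I_(rank A)) (i j : 'I_(rank E)),
    smooth_on (frame_dom e `&` frame_dom f)
      (fun x => coord (frame_vec f x) j
        (w x (fun m => tnth (frame_vec e x) (I m)) (tnth (frame_vec f x) i))).

Definition is_curvature_form (D : section A -> section E -> section E)
    (w : endform 2) : Prop :=
  is_endform w /\
  forall (a : 'I_2 -> section A) (s : section E),
    (forall i, smooth_section (a i)) -> smooth_section s ->
    forall x, w x (fun i => a i x) (s x) =
              curvature D (a ord0) (a ord_max) s x.

(* The exponent is a wedge power with respect to composition in End(E);
   2 + i.*2 is convertible to i.+1.*2. *)
Fixpoint endform_exp (w : endform 2) (i : nat) : endform i.*2 :=
  if i is i'.+1 then
    wedge (W := fun x => 'End(E x) : vectType R)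
      (fun x g h => (g \o h)%VF) w (@endform_exp w i')
  else fun x _ => \1%VF.

Definition lfun_tr (V : vectType R) (g : 'End(V)) : R :=
  \sum_(i < \dim {:V}) coord (vbasis {:V}) i (g (tnth (vbasis {:V}) i)).

Definition endform_tr k (w : endform k) : sform A k :=
  fun x v => lfun_tr (w x v).

(* c = sigma^i_A(E), represented by means of some linear A-connection on E. *)
Definition is_sigma (i : nat) (c : set (tform A)) : Prop :=
  exists D w, [/\ is_connection D, is_curvature_form D w &
    c = coh_class (homogeneous (endform_tr (@endform_exp w i)))].

Definition Pont_total : set (set (tform A)) :=
  smallest (@subalgebra R M A) [set c | exists2 i, (0 < i)%N & is_sigma i c].

Definition Pont (l : nat) : set (set (tform A)) :=
  Pont_total `&` coh_degree A l.

End Pontryagin.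

Arguments Pont_total {R M} A E c.
Arguments Pont {R M} A E l c.

Section Atiyah.
Variables (R : realType) (M : manifold R) (B A : lie_algebroid M).
Variable iota : forall x, 'Hom(B x, A x).
Variable E : vbundle M.

(* Omega^k(B, Hom(A/B, End(E))), where Hom(A/B, End(E)) is the bundle of the
   linear maps from A to End(E) that vanish on B. *)
Definition hform k := form B (fun x => 'Hom(A x, 'End(E x)) : vectType R) k.

Definition is_hform k (w : hform k) : Prop :=
  [/\ alternating w,
      forall x v b, w x v (iota x b) = 0 &
      forall d e f, frames d -> frames e -> frames f ->
      forall (I : 'I_k -> 'I_(rank B)) (h : 'I_(rank A)) (i j : 'I_(rank E)),
        smooth_on (frame_dom d `&` frame_dom e `&` frame_dom f)
          (fun x => coord (frame_vec f x) j
            (w x (fun m => tnth (frame_vec d x) (I m))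
               (tnth (frame_vec e x) h) (tnth (frame_vec f x) i)))].

Variable D : section B -> section E -> section E.

(* x |-> ((nabla^Hom_b phi)(abar) e)(x), where the Bott connection maps the
   class of a to the class of [b, a]. *)
Definition nabla_Hom (b : section B)
    (phi : section (fun x => 'Hom(A x, 'End(E x)) : vectType R))
    (a : section A) (s : section E) : section E :=
  fun x => D b (fun y => phi y (a y) (s y)) x
           - phi x (bracket (smap iota b) a x) (s x)
           - phi x (a x) (D b s x).

(* eta = d_{nabla^Hom} w, see is_differential. *)
Definition is_hdifferential k (w : hform k) (eta : hform k.+1) : Prop :=
  forall (b : 'I_k.+1 -> section B) (a : section A) (s : section E),
    (forall i, smooth_section (b i)) -> smooth_section a ->
    smooth_section s ->
  forall x, eta x (fun i => b i x) (a x) (s x) =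
    \sum_(i < k.+1) (-1) ^+ i *:
      (nabla_Hom (b i) (fun y => w y (fun m => b (lift i m) y)) a s x -
       \sum_(j < k.+1 | (i < j)%N) w x (bracket_args b i j x) (a x) (s x)).

Definition hzero k : hform k := fun _ _ => 0.

Definition hclosed k (w : hform k) : Prop :=
  is_hform w /\ is_hdifferential w (@hzero k.+1).

(* The class of a closed w in H^{k+1}(B, Hom(A/B, End(E))). *)
Definition hclass k (w : hform k.+1) : set (hform k.+1) :=
  [set w' | hclosed w' /\ exists2 eta : hform k, is_hform eta &
    is_hdifferential eta (fun x v => w' x v - w x v)].

Definition extends (Dt : section A -> section E -> section E) : Prop :=
  forall b s, smooth_section b -> smooth_section s ->
    forall x, Dt (smap iota b) s x = D b s x.

Definition is_atiyah_form (Dt : section A -> section E -> section E)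
    (w : hform 1) : Prop :=
  is_hform w /\
  forall b a s, smooth_section b -> smooth_section a -> smooth_section s ->
    forall x, w x (fun=> b x) (a x) (s x) = curvature Dt (smap iota b) a s x.

Definition is_atiyah_class (c : set (hform 1)) : Prop :=
  exists Dt w, [/\ is_connection Dt, extends Dt, is_atiyah_form Dt w &
    c = hclass w].

(* alpha_nabla is the only c with is_atiyah_class c. *)
Definition vanishing_atiyah_class : Prop := is_atiyah_class (hclass (@hzero 1)).

End Atiyah.

(* Main.v *)
(** A primitive of the Atiyah cocycle corrects the extension of nabla to an
    A-connection on E whose curvature R vanishes as soon as one of its arguments
    lies in B.  The forms tr(R^i) are then basic: they are annihilated by
    contraction with B, that is, they come from A/B.  The classes of closed basic
    forms are a subalgebra of H(A), and a basic form of degree l > q vanishes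
    because A/B has rank q.

    That tr(R^i) represents sigma^i is Chern-Weil theory.  On the straight path
    of connections between two given ones, with difference theta and curvature
    R_t, the function t |-> tr(R_t^n) is polynomial with derivative
    d (n tr(theta R_t^(n-1))), and an exact quadrature formula replaces the
    integral over t.

    To keep signs and permutations away from these computations, forms are turned
    into functions on sequences of global sections; wedge product and
    differential then obey recursions in which the first section is contracted,
    and the Leibniz rule, associativity and the cyclicity of the trace are
    inductions on the sequence. *)
From HB Require Import structures.
From mathcomp Require Import all_boot all_order all_algebra all_fingroup.
From mathcomp Require Import all_classical all_reals all_analysis.
From mathcomp Require Import ring lra zify.
Require Import Defs.
Set Implicit Arguments.
Unset Strict Implicit.
Unset Printing Implicit Defensive.
Import Order.TTheory GRing.Theory Num.Theory.
Import numFieldNormedType.Exports.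
Local Open Scope classical_set_scope.
Local Open Scope ring_scope.

(** * Smooth functions and bump functions *)

(** Brackets and connections are operators on global sections, constrained on smooth ones only,
    whereas forms, traces and dimension counts live in the fibres. Bump functions join the two: they
    extend vectors and frames to global smooth sections, and an operator linear over smooth
    functions is then a fibrewise map. The Atiyah cocycle of an extension of nabla is the part of
    its curvature with one argument in B. Adding a section of Hom(A/B, End(E)) to the extension
    changes the cocycle by the differential of that section, so exactness is what allows to remove
    it. For the comparison of connections, a primitive has to be one form that serves all points and
    arguments. The degree of tr(R_t^n) in t is at most 2n everywhere, so that one finite set of
    nodes and weights suffices. Basic representatives of elements of the Pontryagin algebra are of
    mixed degree in general. A class of degree l is therefore compared with such a representative in
    degree l alone, and the component of degree l - 1 of a primitive of the difference does the
    rest. *)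

Section CkTheory.
Variables (R : realType) (n : nat).
Implicit Types (U V : set 'rV[R]_n) (f g : 'rV[R]_n -> R).

Lemma Ck_sub k U V f : V `<=` U -> Ck k U f -> Ck k V f.
Proof.
elim: k f => [|k IH] f VU /= [fc fd]; split => //; try by move=> x /VU /fc.
by move=> i; have [d1 d2] := fd i; split; [move=> x /VU /d1|exact: IH].
Qed.

(** Every clause of [Ck] is about the ambient germ of a function at one point, so a different set
    may be used at each point. *)
Lemma Ck_local k U f :
  (forall x, U x -> exists2 V, V x & Ck k V f) -> Ck k U f.
Proof.
elim: k f => [|k IH] f UV /=; split => //; try by move=> x /UV [V Vx [/(_ x Vx)]].
move=> i; split; first by move=> x /UV [V Vx [_ /(_ i) [/(_ x Vx)]]].
by apply: IH => x /UV [V Vx [_ /(_ i) [_ ?]]]; exists V.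
Qed.

Lemma Ck_pred k U f : Ck k.+1 U f -> Ck k U f.
Proof.
elim: k f => [|k IH] f /= [fc fd]; split => // i.
by have [d1 d2] := fd i; split => //; exact: IH.
Qed.

Lemma open_near_eq U f g x : open U -> {in U, f =1 g} -> U x ->
  {near x, f =1 g}.
Proof.
move=> oU fg Ux; apply: filterS (open_nbhs_nbhs (conj oU Ux)) => y Uy.
by apply: fg; rewrite inE.
Qed.

Lemma near_eq_continuous f g x : {near x, f =1 g} ->
  {for x, continuous f} -> {for x, continuous g}.
Proof.
move=> fg; rewrite /prop_for /continuous_at -(nbhs_singleton fg).
exact: (cvg_trans (near_eq_cvg fg)).
Qed.

Lemma Ck_ext k U f g : open U -> {in U, f =1 g} -> Ck k U f -> Ck k U g.
Proof.
move=> oU; elim: k f g => [|k IH] f g fg /= [fc fd]; split => //;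
  try by move=> x Ux; apply: near_eq_continuous (open_near_eq oU fg Ux) (fc x Ux).
move=> i; have [d1 d2] := fd i; split.
  by move=> x Ux; apply: near_eq_derivable (open_near_eq oU fg Ux) (d1 x Ux).
apply: IH d2 => x; rewrite inE => Ux.
exact: near_eq_derive (open_near_eq oU fg Ux).
Qed.

Lemma Ck_cst k U (c : R) : Ck k U (fun=> c).
Proof.
elim: k c => [|k IH] c /=; split => //; try by move=> x _; apply: cst_continuous.
move=> i; split; first by move=> x _; exact: (derivable_cst c x).
have -> : (fun x : 'rV[R]_n => 'D_(delta_mx 0 i) (fun=> c) x) = (fun=> 0 : R); last exact: IH.
by apply/funext => x; exact: (derive_cst (W := R^o) c).
Qed.

Lemma CkD k U f g : open U -> Ck k U f -> Ck k U g ->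
  Ck k U (fun x => f x + g x).
Proof.
move=> oU; elim: k f g => [|k IH] f g /= [fc fd] [gc gd]; split => //;
  try by move=> x Ux; apply: continuousD; [exact: fc|exact: gc].
move=> i; have [d1 d2] := fd i; have [e1 e2] := gd i; split.
  by move=> x Ux; apply: derivableD; [exact: d1|exact: e1].
apply: Ck_ext (IH _ _ d2 e2) => // x; rewrite inE => Ux.
by rewrite -deriveD //; [exact: d1|exact: e1].
Qed.

Lemma CkM k U f g : open U -> Ck k U f -> Ck k U g ->
  Ck k U (fun x => f x * g x).
Proof.
move=> oU; elim: k f g => [|k IH] f g Cf Cg; have := Cf; have := Cg;
  move=> /= [gc gd] [fc fd]; split => //;
  try by move=> x Ux; apply: continuousM; [exact: fc|exact: gc].
move=> i; have [d1 d2] := fd i; have [e1 e2] := gd i; split.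
  by move=> x Ux; apply: derivableM; [exact: d1|exact: e1].
have Df := IH _ _ (Ck_pred Cf) e2; have Dg := IH _ _ (Ck_pred Cg) d2.
apply: Ck_ext (CkD oU Df Dg) => // x; rewrite inE => Ux.
by have := deriveM (d1 x Ux) (e1 x Ux); rewrite /GRing.scale /= => <-.
Qed.

Lemma CkV k U f : open U -> (forall x, U x -> f x != 0) -> Ck k U f ->
  Ck k U (fun x => (f x)^-1).
Proof.
move=> oU f0; elim: k => [|k IH] Cf; have := Cf; move=> /= [fc fd]; split => //;
  try by move=> x Ux; apply: continuousV; [exact: f0|exact: fc].
move=> i; have [d1 d2] := fd i; split.
  by move=> x Ux; apply: derivableV; [exact: f0|exact: d1].
have If := IH (Ck_pred Cf).
apply: Ck_ext (CkM oU (CkM oU (CkM oU If If) (Ck_cst k U (-1))) d2) => // x.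
rewrite inE => Ux; rewrite deriveV; [|exact: f0|exact: d1].
by rewrite -invfM -expr2 mulrN1.
Qed.

(** On the line through [x] in direction [v], [f] is a function of one real variable, which reduces
    the claim to the one-dimensional chain rule. *)
Lemma derivable_comp1 (g : R -> R) f x v : derivable f x v ->
  derivable g (f x) 1 ->
  derivable (g \o f) x v /\ 'D_v (g \o f) x = 'D_1 g (f x) * 'D_v f x.
Proof.
move=> df dg.
have df' := (derivable1P f x v).1 df.
have fx0 : f (0 *: v + x) = f x by rewrite scale0r add0r.
have aux (h : 'rV[R]_n -> R) : 'D_v h x = 'D_1 (fun t : R => h (t *: v + x)) 0.
  rewrite /derive; set g1 := fun t => t^-1 *: _; set g2 := fun t => t^-1 *: _.
  suff -> : g1 = g2 by []; apply/funext => t; rewrite /g1 /g2 /=.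
  by rewrite addr0 scale0r add0r [_%:A]mulr1.
have comp1 (h : R -> R) (y : R) : h 0 = y -> derivable h 0 1 ->
    derivable g y 1 ->
    derivable (g \o h) 0 1 /\ 'D_1 (g \o h) 0 = 'D_1 g y * 'D_1 h 0.
  move=> <- dh dgh; split.
    apply: diff_derivable; apply: differentiable_comp.
      exact: (derivable1_diffP _ _).1 dh.
    exact: (derivable1_diffP _ _).1 dgh.
  rewrite -(derive1E (g \o h)) -(derive1E g) -(derive1E h).
  exact: (@derive1_comp R h g 0 dh dgh).
have [cd ce] := comp1 _ _ fx0 df' dg.
split; first exact/(derivable1P _ _ _).2.
by rewrite (aux (g \o f)) (aux f); exact: ce.
Qed.

(** The induction on [k] needs a class of outer functions closed under differentiation: the family
    [F], with [S] giving the index of the derivative. It is applied to [flat], indexed by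
    polynomials. *)
Lemma Ck_comp (T : Type) (F : T -> R -> R) (S : T -> T) k U f t : open U ->
  (forall t x, derivable (F t) x 1 /\ 'D_1 (F t) x = F (S t) x) ->
  Ck k U f -> Ck k U (fun x => F t (f x)).
Proof.
move=> oU FS; elim: k t => [|k IH] t Cf; have := Cf; move=> /= [fc fd];
  have Fc (x : 'rV[R]_n) : U x -> {for x, continuous (fun x => F t (f x))}.
- move=> Ux; apply: continuous_comp; first exact: fc.
  by apply/differentiable_continuous/derivable1_diffP; have [] := FS t (f x).
- by split.
- move=> Ux; apply: continuous_comp; first exact: fc.
  by apply/differentiable_continuous/derivable1_diffP; have [] := FS t (f x).
split => // i; have [d1 d2] := fd i; split.
  by move=> x Ux; have [] := derivable_comp1 (d1 x Ux) (FS t (f x)).1.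
apply: Ck_ext (CkM oU (IH (S t) (Ck_pred Cf)) d2) => // x; rewrite inE => Ux.
have [_ ->] := derivable_comp1 (d1 x Ux) (FS t (f x)).1.
by rewrite (FS t (f x)).2.
Qed.

End CkTheory.

(** * Functions that are flat at the origin *)

Section FlatFunctions.
Variable R : realType.

(** Admitting all polynomials makes this class closed under differentiation; [flat 1] is the
    building block of the bump functions. *)
Definition flat (p : {poly R}) (t : R) : R :=
  if 0 < t then p.[t^-1] * expR (- t^-1) else 0.

(* From (p(1/t) e^(-1/t))' = t^-2 (p - p')(1/t) e^(-1/t). *)
Definition flat_step (p : {poly R}) : {poly R} := 'X^2 * (p - p^`()).

(** Monomial by monomial, with u = 1/t: from u^(i+1) / (i+1)! <= e^u one gets u^i e^(-u) <= (i+1)!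
    t. *)
Lemma flat_bound p : exists C : R, 0 <= C /\ forall t, `|flat p t| <= C * `|t|.
Proof.
exists (\sum_(i < size p) `|p`_i| * i.+1`!%:R); split.
  by apply: sumr_ge0 => i _; rewrite mulr_ge0.
move=> t; rewrite /flat; case: ltP => [t0|_]; last first.
  by rewrite normr0 mulr_ge0// sumr_ge0// => i _; rewrite mulr_ge0.
rewrite horner_coef mulr_suml mulr_suml.
apply: le_trans (ler_norm_sum _ _ _) _; apply: ler_sum => i _.
rewrite !normrM -!mulrA ler_wpM2l//.
have u0 : 0 < t^-1 by rewrite invr_gt0.
have := expR_ge1Dxn i (ltW u0); rewrite expRN => le_exp.
rewrite (ger0_norm (ltW t0)) (ger0_norm (exprn_ge0 _ (ltW u0))).
rewrite ger0_norm ?invr_ge0 ?expR_ge0//.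
rewrite ler_pdivrMr ?expR_gt0//.
have fi : 0 < (i.+1`!)%:R :> R by rewrite ltr0n fact_gt0.
have {}le_exp : t^-1 ^+ i.+1 / (i.+1`!)%:R <= expR t^-1.
  by apply: le_trans le_exp; rewrite lerDr.
rewrite ler_pdivrMr// in le_exp.
rewrite -(@ler_pM2l _ t^-1)// -exprS; apply: le_trans le_exp _.
rewrite mulrC [(_ * t) * _]mulrAC.
rewrite mulrCA mulrC mulrA.
rewrite [X in _ <= X](_ : _ = i.+1`!%:R * expR t^-1 * (t^-1 * t)); last by ring.
by rewrite mulVf ?gt_eqF// mulr1 mulrC.
Qed.

(** Raises the order of vanishing at 0: the linear bound for ['X * p] becomes a quadratic bound for
    [p], which yields the derivative at 0. *)
Lemma flat_mulX p t : 0 < t -> flat p t = t * flat ('X * p) t.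
Proof.
move=> t0; rewrite /flat t0 hornerM hornerX !mulrA.
by rewrite divff ?gt_eqF// mul1r.
Qed.

Lemma derive_quad_bound (f : R -> R) (C : R) : 0 <= C ->
  (forall t, `|f t| <= C * (`|t| * `|t|)) ->
  derivable f 0 1 /\ 'D_1 f 0 = 0.
Proof.
move=> C0 fC.
have f0 : f 0 = 0 by apply/eqP; rewrite -normr_le0 (le_trans (fC 0))// normr0 !mulr0.
have cv : (fun h : R => h^-1 *: (f (h *: (1 : R) + 0) - f 0)) @ 0^' --> (0 : R).
  apply/cvgrPdist_lt => e e0.
  have d0 : 0 < e / (C + 1) by rewrite divr_gt0// ltr_wpDl.
  near=> h.
  have h0 : h != 0 by near: h; exact: nbhs_dnbhs_neq.
  have hd : `|h| < e / (C + 1).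
    near: h; apply: dnbhs0_lt; exact: d0.
  rewrite sub0r normrN f0 subr0 addr0 /GRing.scale /= mulr1 normrM normfV.
  rewrite mulrC ltr_pdivrMr ?normr_gt0//.
  apply: le_lt_trans (fC h) _; rewrite mulrA ltr_pM2r ?normr_gt0//.
  apply: (@le_lt_trans _ _ ((C + 1) * `|h|)); first by rewrite ler_wpM2r// lerDl.
  by rewrite mulrC -ltr_pdivlMr// ltr_wpDl.
split; first by apply/cvg_ex; exists 0; exact: cv.
exact: (cvg_lim (@norm_hausdorff _ _) cv).
Unshelve. all: by end_near. Qed.

Lemma is_derive_comp1 (f g : R -> R) (x df dg : R) : is_derive x 1 f df ->
  is_derive (f x) 1 g dg -> is_derive x 1 (g \o f) (dg * df).
Proof.
move=> [f1 <-] [g1 <-]; split.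
  apply: diff_derivable; apply: differentiable_comp.
    exact: (derivable1_diffP _ _).1 f1.
  exact: (derivable1_diffP _ _).1 g1.
rewrite -(derive1E (g \o f)) -(derive1E g) -(derive1E f).
exact: (@derive1_comp R f g x f1 g1).
Qed.

Lemma flat_derive p t :
  derivable (flat p) t 1 /\ 'D_1 (flat p) t = flat (flat_step p) t.
Proof.
have [t0|t0|->] := ltgtP t 0; last first.
- have [C [C0 HC]] := flat_bound ('X * p).
  have -> : flat (flat_step p) 0 = 0 by rewrite /flat ltxx.
  apply: (@derive_quad_bound _ C C0) => s.
  have [s0|s0] := ltP 0 s; last by rewrite /flat ltNge s0/= normr0 !mulr_ge0.
  rewrite flat_mulX// normrM mulrCA ler_wpM2l//.
- have e : {near t, (fun t => p.[t^-1] * expR (- t^-1)) =1 flat p}.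
    near=> s; rewrite /flat ifT//; near: s.
    exact: lt_nbhsr.
  have D : is_derive t 1 (fun t => p.[t^-1] * expR (- t^-1)) (flat (flat_step p) t).
    have tn : t != 0 by rewrite gt_eqF.
    have dV : is_derive t 1 (fun t : R => t^-1) (- t ^- 2).
      have dI : derivable (id : R -> R) t 1 by exact: derivable_id.
      apply: DeriveDef; first exact: (@derivableV _ _ (id : R -> R)).
      by rewrite (@deriveV _ _ (id : R -> R))// derive_id /GRing.scale /= mulr1.
    have dp : is_derive t 1 (fun t => p.[t^-1]) (p^`().[t^-1] * - t ^- 2).
      have dh : is_derive t^-1 1 (horner p) p^`().[t^-1].
        apply: DeriveDef; first exact: derivable_horner.
        by rewrite derivE derive1E.
      exact: is_derive_comp1 dV dh.
    have dN : is_derive t 1 (fun t : R => - t^-1) (- (- t ^- 2)) by exact: is_deriveN.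
    have de : is_derive t 1 (fun t : R => expR (- t^-1)) (expR (- t^-1) * - (- t ^- 2)).
      exact: is_derive_comp1.
    have -> : flat (flat_step p) t =
        p.[t^-1] * (expR (- t^-1) * - (- t ^- 2)) +
        expR (- t^-1) * (p^`().[t^-1] * - t ^- 2).
      rewrite /flat t0 /flat_step hornerM hornerXn hornerD hornerN exprVn.
      by ring.
    exact: is_deriveM dp de.
  by case: (near_eq_is_derive e D).
- have e : {near t, (fun=> 0 : R) =1 flat p}.
    near=> s; rewrite /flat ifF//; apply/negbTE; rewrite -leNgt; apply: ltW; near: s.
    exact: lt_nbhsl.
  have D : is_derive t 1 (fun=> 0 : R) (0 : R) by exact: is_derive_cst.
  have -> : flat (flat_step p) t = 0 by rewrite /flat ltNge ltW.
  by case: (near_eq_is_derive e D).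
Unshelve. all: by end_near. Qed.

End FlatFunctions.

(** * Smooth functions on a manifold *)

Section SmoothFunctions.
Variables (R : realType) (M : manifold R).
Implicit Types (U V W : set M) (f g : M -> R).

Lemma chart_img_open (c : chart R M (manifold_dim M)) U :
  atlas c -> open U -> open (chart_map c @` (chart_dom c `&` U)).
Proof.
move=> ca oU; have [od oi ck _ ci] := atlas_chart ca.
rewrite openE => _ [x [dx Ux] <-].
have ix : chart_img c (chart_map c x) by exists x.
have nU : nbhs (chart_map c x) (chart_inv c @^-1` U).
  by apply: ci => //; rewrite ck//; exact: open_nbhs_nbhs.
have nO : nbhs (chart_map c x) (chart_img c) by exact: open_nbhs_nbhs.
apply: filterS (filterI nU nO) => y [/= Uy [z dz zy]].
by exists z => //; split => //; rewrite -zy ck in Uy.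
Qed.

Lemma chart_imgP (c : chart R M (manifold_dim M)) U y : atlas c ->
  (chart_map c @` (chart_dom c `&` U)) y ->
  chart_dom c (chart_inv c y) /\ U (chart_inv c y).
Proof. by move=> ca [x [dx Ux] <-]; have [_ _ ck _ _] := atlas_chart ca; rewrite ck. Qed.

Lemma smooth_on_sub U V f : V `<=` U -> smooth_on U f -> smooth_on V f.
Proof.
by move=> VU sf c ca k; apply: Ck_sub (sf c ca k) => _ [x [dx /VU Ux] <-]; exists x.
Qed.

Lemma smooth_on_local U f :
  (forall x, U x -> exists2 V, V x & smooth_on V f) -> smooth_on U f.
Proof.
move=> UV c ca k; apply: Ck_local => _ [x [dx Ux] <-].
have [V Vx sV] := UV x Ux.
by exists (chart_map c @` (chart_dom c `&` V)); [exists x|exact: sV].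
Qed.

Lemma smooth_on_ext U f g : open U -> {in U, f =1 g} -> smooth_on U f ->
  smooth_on U g.
Proof.
move=> oU fg sf c ca k; apply: Ck_ext (sf c ca k); first exact: chart_img_open.
by move=> y; rewrite inE => /(chart_imgP ca)[_ Uy] /=; apply: fg; rewrite inE.
Qed.

Lemma smooth_on_cst U a : smooth_on U (fun=> a : R).
Proof. by move=> c ca k; exact: Ck_cst. Qed.

Lemma smooth_onD U f g : open U -> smooth_on U f -> smooth_on U g ->
  smooth_on U (fun x => f x + g x).
Proof.
by move=> oU sf sg c ca k; apply: CkD (sf c ca k) (sg c ca k); exact: chart_img_open.
Qed.

Lemma smooth_onM U f g : open U -> smooth_on U f -> smooth_on U g ->
  smooth_on U (fun x => f x * g x).
Proof.
by move=> oU sf sg c ca k; apply: CkM (sf c ca k) (sg c ca k); exact: chart_img_open.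
Qed.

Lemma smooth_onZ U a f : open U -> smooth_on U f ->
  smooth_on U (fun x => a * f x).
Proof. by move=> oU; apply: smooth_onM => //; exact: smooth_on_cst. Qed.

Lemma smooth_onN U f : open U -> smooth_on U f -> smooth_on U (fun x => - f x).
Proof.
move=> oU /(smooth_onZ (-1) oU); rewrite [X in smooth_on _ X -> _](_ : _ = \- f)//.
by apply/funext => x; rewrite mulN1r.
Qed.

Lemma smooth_on_sum U (I : Type) (r : seq I) (P : pred I) (F : I -> M -> R) :
  open U -> (forall i, P i -> smooth_on U (F i)) ->
  smooth_on U (fun x => \sum_(i <- r | P i) F i x).
Proof.
move=> oU sF; elim: r => [|i r IH].
  rewrite [X in smooth_on _ X](_ : _ = fun=> 0); first exact: smooth_on_cst.
  by apply/funext => x; rewrite big_nil.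
case Pi : (P i).
  rewrite [X in smooth_on _ X](_ : _ = fun x => F i x + \sum_(j <- r | P j) F j x).
    by apply: smooth_onD => //; exact: sF.
  by apply/funext => x; rewrite big_cons Pi.
rewrite [X in smooth_on _ X](_ : _ = fun x => \sum_(j <- r | P j) F j x)//.
by apply/funext => x; rewrite big_cons Pi.
Qed.

Lemma smooth_onV U f : open U -> (forall x, U x -> f x != 0) ->
  smooth_on U f -> smooth_on U (fun x => (f x)^-1).
Proof.
move=> oU f0 sf c ca k; apply: CkV (sf c ca k); first exact: chart_img_open.
by move=> y /(chart_imgP ca)[_ /f0].
Qed.

Lemma smooth_on_flat U f p : open U -> smooth_on U f ->
  smooth_on U (fun x => flat p (f x)).
Proof.
move=> oU sf c ca k; apply: (Ck_comp (S := @flat_step R)) (sf c ca k).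
  exact: chart_img_open.
exact: flat_derive.
Qed.

Lemma smooth_chart_coord (c : chart R M (manifold_dim M)) i : atlas c ->
  smooth_on (chart_dom c) (fun x => chart_map c x 0 i).
Proof. by move=> ca c' ca'; exact: atlas_compat. Qed.

Lemma smooth_continuous f : smooth_fun f -> continuous f.
Proof.
move=> sf x; have [c ca dx] := atlas_cover x.
have [od oi ck cc ci] := atlas_chart ca.
have cf : {for chart_map c x, continuous (f \o chart_inv c)}.
  by have [+ _] := sf c ca 0%N; apply; exists x.
have : {for x, continuous ((f \o chart_inv c) \o chart_map c)}.
  by apply: continuous_comp => //; exact: cc.
rewrite /prop_for /continuous_at /= ck// => cfx.
apply: cvg_trans cfx; apply: near_eq_cvg.
by apply: filterS (open_nbhs_nbhs (conj od dx)) => y dy /=; rewrite ck.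
Qed.

Lemma nonzero_open f : smooth_fun f -> open [set x | f x != 0].
Proof.
move=> /smooth_continuous cf.
have -> : [set x | f x != 0] = f @^-1` [set y | y != 0] by [].
apply: open_comp; first by move=> x _; exact: cf.
exact: open_neq.
Qed.

Definition bump_at (x : M) (W : set M) (f : M -> R) : Prop :=
  [/\ smooth_fun f, f x = 1 &
      exists K, [/\ closed K, K `<=` W & forall y, ~ K y -> f y = 0]].

(** Built in a chart as [flat 1] of r^2 - |y - y0|^2 and extended by 0. The set [K] is the image of
    a closed cube, compact and hence closed because the manifold is Hausdorff; this makes the
    extension by 0 smooth. *)
Lemma bump_exists x W : open W -> W x -> exists f, bump_at x W f.
Proof.
move=> oW Wx; have [c ca dx] := atlas_cover x.
have [od oi ck cc ci] := atlas_chart ca.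
set y0 := chart_map c x.
have oO := chart_img_open ca oW.
have /nbhs_ballP[e /= e0 eO] : nbhs y0 (chart_map c @` (chart_dom c `&` W)).
  by apply: open_nbhs_nbhs; split => //; exists x.
(* The ball of radius [e] is an open cube of half-side [e]; halving keeps the closed cube [Kb]
   inside it. *)
pose r := e / 2; have r0 : 0 < r by rewrite divr_gt0.
pose Kb := [set y : 'rV[R]_(manifold_dim M) |
  forall i, `[y0 0 i - r, y0 0 i + r]%classic (y 0 i)].
pose K := chart_inv c @` Kb.
have KbO : Kb `<=` chart_map c @` (chart_dom c `&` W).
  move=> y yr; apply: eO; split=> // i j; rewrite /ball /= ord1.
  have := yr j; rewrite /= in_itv /= -ler_distlC => /le_lt_trans; apply.
  by rewrite /r ltr_pdivrMr// ltr_pMr// ltr1n.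
have cKb : compact Kb.
  apply: (@rV_compact _ _ (fun i => `[y0 0 i - r, y0 0 i + r]%classic)) => i.
  exact: segment_compact.
have cK : closed K.
  apply: compact_closed; first exact: manifold_hausdorff.
  apply: continuous_compact => //.
  apply: continuous_in_subspaceT => y; rewrite inE => /KbO [z [dz Wz] <-].
  by apply: ci; exists z.
pose h (y : M) := r ^+ 2 - \sum_i (chart_map c y 0 i - y0 0 i) ^+ 2.
pose f y := if `[< chart_dom c y >] then flat 1 (h y) else 0.
have fK y : ~ K y -> f y = 0.
  move=> nK; rewrite /f; case: asboolP => // dy.
  rewrite /flat; case: ltP => // hy; exfalso; apply: nK.
  exists (chart_map c y); last by rewrite ck.
  move=> i; rewrite /= in_itv /= -ler_distlC -(ler_pXn2r (n := 2)) ?nnegrE ?(ltW r0)//.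
  rewrite real_normK ?num_real// -sqrrN opprB.
  rewrite subr_gt0 in hy; apply: le_trans (ltW hy).
  by rewrite (bigD1 i)//= lerDl sumr_ge0// => j _; exact: sqr_ge0.
have fx : 0 < f x.
  rewrite /f asboolT// /flat /h big1 ?subr0; last first.
    by move=> i _; rewrite subrr expr0n.
  by rewrite exprn_gt0// hornerC mul1r expR_gt0.
exists (fun y => (f x)^-1 * f y); split; last 1 first.
- exists K; split => //.
    by move=> _ [y /KbO [z [dz Wz] <-] <-]; rewrite ck.
  by move=> y /fK ->; rewrite mulr0.
- apply: smooth_onZ; first exact: openT.
  apply: smooth_on_local => y _; have [dy|ndy] := pselect (chart_dom c y).
    exists (chart_dom c) => //.
    apply: (@smooth_on_ext _ (fun y => flat 1 (h y))) => //.
      by move=> z; rewrite inE /f => dz; rewrite asboolT.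
    apply: smooth_on_flat => //; apply: smooth_onD => //.
      exact: smooth_on_cst.
    apply: smooth_onN => //; apply: smooth_on_sum => // i _.
    have si : smooth_on (chart_dom c) (fun z => chart_map c z 0 i - y0 0 i).
      by apply: smooth_onD => //; [exact: smooth_chart_coord|exact: smooth_on_cst].
    exact: smooth_onM.
  exists (~` K).
    by move=> [z /KbO [t [dt Wt] <-]]; rewrite ck// => ty; rewrite -ty in ndy.
  apply: (@smooth_on_ext _ (fun=> 0)); first exact: closed_openC.
    by move=> z; rewrite inE => /fK ->.
  exact: smooth_on_cst.
- by rewrite mulVf// gt_eqF.
Qed.

Lemma smooth_bumpM x W f g : open W -> bump_at x W f -> smooth_on W g ->
  smooth_fun (fun y => f y * g y).
Proof.
move=> oW [sf _ [K [cK KW fK]]] sg.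
apply: smooth_on_local => y _; have [Wy|nWy] := pselect (W y).
  exists W => //; apply: smooth_onM => //.
  exact: smooth_on_sub (@subsetT _ _) sf.
exists (~` K) => [/KW//|].
apply: (@smooth_on_ext _ (fun=> 0)); first exact: closed_openC.
  by move=> z; rewrite inE => /fK ->; rewrite mul0r.
exact: smooth_on_cst.
Qed.

End SmoothFunctions.

(** * Global sections and tensoriality *)

Section GlobalSections.
Variables (R : realType) (M : manifold R).

(** Bundling smoothness discharges the side conditions in the axioms of brackets and connections
    once and for all; proof irrelevance reduces equality to pointwise equality. The records [gsec]
    and [gend] follow the same pattern. *)
Record sfun := SFun { sfun_fun :> M -> R; sfunP : smooth_fun sfun_fun }.

Lemma sfun_inj (f g : sfun) : (forall x, f x = g x) -> f = g.
Proof.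
case: f g => [f sf] [g sg] /= fg.
have e : f = g by exact/funext.
by subst g; rewrite (Prop_irrelevance sf sg).
Qed.

HB.instance Definition _ := gen_eqMixin sfun.
HB.instance Definition _ := gen_choiceMixin sfun.

Definition sfun_cst (a : R) : sfun := SFun (smooth_on_cst setT a).
Definition sfun_add (f g : sfun) : sfun :=
  SFun (smooth_onD openT (sfunP f) (sfunP g)).
Definition sfun_opp (f : sfun) : sfun := SFun (smooth_onN openT (sfunP f)).
Definition sfun_mul (f g : sfun) : sfun :=
  SFun (smooth_onM openT (sfunP f) (sfunP g)).

Fact sfun_addA : associative sfun_add.
Proof. by move=> f g h; apply: sfun_inj => x; exact: addrA. Qed.
Fact sfun_addC : commutative sfun_add.
Proof. by move=> f g; apply: sfun_inj => x; exact: addrC. Qed.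
Fact sfun_add0 : left_id (sfun_cst 0) sfun_add.
Proof. by move=> f; apply: sfun_inj => x; exact: add0r. Qed.
Fact sfun_addN : left_inverse (sfun_cst 0) sfun_opp sfun_add.
Proof. by move=> f; apply: sfun_inj => x; exact: addNr. Qed.

HB.instance Definition _ :=
  GRing.isZmodule.Build sfun sfun_addA sfun_addC sfun_add0 sfun_addN.

Lemma sfun_sumE (I : Type) (r : seq I) (P : pred I) (F : I -> sfun) x :
  (\sum_(i <- r | P i) F i) x = \sum_(i <- r | P i) F i x.
Proof. by elim/big_rec2 : _ => // i _ y _ <-. Qed.

Variable E : vbundle M.

Record gsec := GSec {
  gsec_fun :> forall x, E x; gsecP : smooth_section (gsec_fun : section E) }.

Lemma gsec_inj (s t : gsec) : (forall x, s x = t x) -> s = t.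
Proof.
case: s t => [s ss] [t st] /= st_eq.
have e : s = t by exact: functional_extensionality_dep.
by subst t; rewrite (Prop_irrelevance ss st).
Qed.

HB.instance Definition _ := gen_eqMixin gsec.
HB.instance Definition _ := gen_choiceMixin gsec.

Fact gsec0_smooth : smooth_section (fun x => 0 : E x).
Proof.
move=> e fe i; rewrite [X in smooth_on _ X](_ : _ = fun=> 0).
  exact: smooth_on_cst.
by apply/funext => x; rewrite linear0.
Qed.
Fact gsecD_smooth (s t : gsec) : smooth_section (fun x => s x + t x).
Proof.
move=> e fe i; rewrite [X in smooth_on _ X](_ : _ =
  fun x => coord (frame_vec e x) i (s x) + coord (frame_vec e x) i (t x)).
  by apply: smooth_onD; [exact: frame_open|exact: gsecP|exact: gsecP].
by apply/funext => x; rewrite linearD.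
Qed.
Fact gsecZ_smooth (f : sfun) (s : gsec) : smooth_section (fun x => f x *: s x).
Proof.
move=> e fe i; rewrite [X in smooth_on _ X](_ : _ =
  fun x => f x * coord (frame_vec e x) i (s x)).
  apply: smooth_onM; [exact: frame_open| |exact: gsecP].
  exact: smooth_on_sub (@subsetT _ _) (sfunP f).
by apply/funext => x; rewrite linearZ.
Qed.
Fact gsecN_smooth (s : gsec) : smooth_section (fun x => - s x).
Proof.
have := gsecZ_smooth (sfun_cst (-1)) s.
rewrite (_ : (fun x => _) = (fun x => - s x))//.
by apply: functional_extensionality_dep => x; rewrite /= scaleN1r.
Qed.

Definition gsec0 : gsec := GSec gsec0_smooth.
Definition gsecD (s t : gsec) : gsec := GSec (gsecD_smooth s t).
Definition gsecN (s : gsec) : gsec := GSec (gsecN_smooth s).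
Definition gsecZ (f : sfun) (s : gsec) : gsec := GSec (gsecZ_smooth f s).

Fact gsec_addA : associative gsecD.
Proof. by move=> f g h; apply: gsec_inj => x; exact: addrA. Qed.
Fact gsec_addC : commutative gsecD.
Proof. by move=> f g; apply: gsec_inj => x; exact: addrC. Qed.
Fact gsec_add0 : left_id gsec0 gsecD.
Proof. by move=> f; apply: gsec_inj => x; exact: add0r. Qed.
Fact gsec_addN : left_inverse gsec0 gsecN gsecD.
Proof. by move=> f; apply: gsec_inj => x; exact: addNr. Qed.

HB.instance Definition _ :=
  GRing.isZmodule.Build gsec gsec_addA gsec_addC gsec_add0 gsec_addN.

Lemma gsec_sumE (I : Type) (r : seq I) (P : pred I) (F : I -> gsec) x :
  (\sum_(i <- r | P i) F i) x = \sum_(i <- r | P i) F i x.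
Proof. by elim/big_rec2 : _ => // i _ y _ <-. Qed.

Lemma gsecZ1 s : gsecZ (sfun_cst 1) s = s.
Proof. by apply: gsec_inj => x; rewrite /= scale1r. Qed.

Lemma gsecDE (s t : gsec) x : (s + t) x = s x + t x. Proof. by []. Qed.
Lemma gsec0E x : (0 : gsec) x = 0. Proof. by []. Qed.
Lemma gsecNE (s : gsec) x : (- s) x = - s x. Proof. by []. Qed.
Lemma gsecZE f (s : gsec) x : gsecZ f s x = f x *: s x. Proof. by []. Qed.
Lemma sfunDE (f g : sfun) x : (f + g) x = f x + g x. Proof. by []. Qed.
Lemma sfunNE (f : sfun) x : (- f) x = - f x. Proof. by []. Qed.

Section VbasisCoord.
Variables (V : vectType R) (i : 'I_(\dim {:V})).
Local Notation co := (coord (vbasis {:V}) i).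
Lemma vcoord0 : co 0 = 0. Proof. exact: linear0. Qed.
Lemma vcoordD u v : co (u + v) = co u + co v. Proof. exact: linearD. Qed.
Lemma vcoordN u : co (- u) = - co u. Proof. exact: linearN. Qed.
Lemma vcoordZ (k : R) u : co (k *: u) = k * co u. Proof. exact: linearZ. Qed.
End VbasisCoord.

(** Turns identities between vectors into identities between real numbers, which [ring] and [lra]
    can settle. *)
Lemma vec_ext (V : vectType R) (u v : V) :
  (forall i, coord (vbasis {:V}) i u = coord (vbasis {:V}) i v) -> u = v.
Proof.
move=> uv; rewrite (coord_vbasis (memvf u)) (coord_vbasis (memvf v)).
by apply: eq_bigr => i _; rewrite uv.
Qed.

Lemma coord_change (V : vectType R) n m (b : n.-tuple V) (c : m.-tuple V) i v :
  basis_of fullv b ->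
  coord c i v = \sum_j coord b j v * coord c i (tnth b j).
Proof.
move=> bb; rewrite {1}(coord_basis bb (memvf v)) linear_sum.
by apply: eq_bigr => j _; rewrite linearZ (tnth_nth 0).
Qed.

Lemma smooth_section_local (s : section E) :
  (forall x, exists U e, [/\ open U, U x, frames e, U `<=` frame_dom e &
    forall i, smooth_on U (fun y => coord (frame_vec e y) i (s y))]) ->
  smooth_section s.
Proof.
move=> H e fe i; apply: smooth_on_local => x ex.
have [U [e' [oU Ux fe' Ue' se']]] := H x.
have oUe : open (U `&` frame_dom e) by apply: openI => //; exact: frame_open.
exists (U `&` frame_dom e) => //.
apply: (@smooth_on_ext _ _ _ (fun y => \sum_j coord (frame_vec e' y) j (s y) *
  coord (frame_vec e y) i (tnth (frame_vec e' y) j))) => //.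
  move=> y; rewrite inE => -[Uy ey]; apply/esym/coord_change.
  exact: (frame_basis fe' (Ue' _ Uy)).
apply: smooth_on_sum => // j _; apply: smooth_onM => //.
  by apply: smooth_on_sub (se' j) => y [].
by apply: smooth_on_sub (frame_compat fe' fe j i) => y [/Ue'].
Qed.

(** A frame cut off by a bump function: globally smooth sections, to which brackets and connections
    apply, that agree with the frame at the centre [x]. *)
Record local_frame (x : M) := LocalFrame {
  lf_frame : frame E (rank E);
  lf_bump : sfun;
  lf_vec : 'I_(rank E) -> gsec;
  lf_frames : frames lf_frame;
  lf_bumpP : bump_at x (frame_dom lf_frame) lf_bump;
  lf_dom : frame_dom lf_frame x;
  lf_vecE : forall i y, lf_vec i y = lf_bump y *: tnth (frame_vec lf_frame y) i }.

Lemma local_frame_exists x e : frames e -> frame_dom e x ->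
  exists l : local_frame x, lf_frame l = e.
Proof.
move=> fe ex; have [f bf] := bump_exists (frame_open fe) ex.
have sf : smooth_fun f by case: bf.
have ss i : smooth_section (fun y => f y *: tnth (frame_vec e y) i).
  move=> e' fe' j; apply: smooth_on_local => y ey.
  have [dy|ndy] := pselect (frame_dom e y).
    exists (frame_dom e `&` frame_dom e') => //.
    have oU : open (frame_dom e `&` frame_dom e').
      by apply: openI; exact: frame_open.
    apply: (@smooth_on_ext _ _ _ (fun y => f y *
       coord (frame_vec e' y) j (tnth (frame_vec e y) i))) => //.
      by move=> z _; rewrite linearZ.
    apply: smooth_onM => //; last exact: frame_compat.
    exact: smooth_on_sub (@subsetT _ _) sf.
  have [_ _ [K [cK KW fK]]] := bf.
  exists (~` K); first by move=> /KW.
  apply: (@smooth_on_ext _ _ _ (fun=> 0)); first exact: closed_openC.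
    by move=> z; rewrite inE => /fK ->; rewrite scale0r linear0.
  exact: smooth_on_cst.
by exists (@LocalFrame x e (SFun sf) (fun i => GSec (ss i)) fe bf ex (fun _ _ => erefl)).
Qed.

Definition local_frame_at x : local_frame x :=
  let: exist2 e fe ex := cid2 (frame_cover E x) in
  sval (cid (local_frame_exists fe ex)).

Section LocalFrame.
Variables (x : M) (l : local_frame x).
Local Notation e := (lf_frame l).

Lemma lf_bump1 : lf_bump l x = 1.
Proof. by case: (lf_bumpP l). Qed.

Lemma lf_basis : basis_of fullv (frame_vec e x).
Proof. exact (frame_basis (lf_frames l) (lf_dom l)). Qed.

Lemma lf_vec1 i : lf_vec l i x = tnth (frame_vec e x) i.
Proof. by rewrite lf_vecE lf_bump1 scale1r. Qed.

Definition lf_coord (s : gsec) i : sfun :=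
  SFun (smooth_bumpM (frame_open (lf_frames l)) (lf_bumpP l)
    (gsecP s (lf_frames l) i)).

(** One factor of the bump function makes the coordinates globally smooth, the other one the frame
    vectors; hence the square. *)
Lemma lf_expand s : gsecZ (sfun_mul (lf_bump l) (lf_bump l)) s =
  \sum_i gsecZ (lf_coord s i) (lf_vec l i).
Proof.
apply: gsec_inj => y; rewrite gsec_sumE /=.
have [dy|ndy] := pselect (frame_dom e y); last first.
  have [_ _ [K [_ KW fK]]] := lf_bumpP l.
  have fy : lf_bump l y = 0 by apply: fK => /KW.
  by rewrite fy mul0r scale0r big1// => i _; rewrite mul0r scale0r.
rewrite {1}(coord_basis (frame_basis (lf_frames l) dy) (memvf (s y))).
rewrite scaler_sumr; apply: eq_bigr => i _.
by rewrite lf_vecE (tnth_nth 0) !scalerA; congr (_ *: _); ring.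
Qed.

(* Multiply s by the square of the bump function, which is 1 at x, and expand by
   lf_expand: all the coefficients are then globally smooth functions. *)
Lemma tensor_expand (V : lmodType R) (T : gsec -> V) :
  (forall f s t, T (gsecZ f s + t) = f x *: T s + T t) ->
  forall s, T s = \sum_i coord (frame_vec e x) i (s x) *: T (lf_vec l i).
Proof.
move=> TL s.
have T0 : T 0 = 0.
  by have := TL (sfun_cst (-1)) 0 0; rewrite scaleN1r addNr addr0 => <-; congr T;
     apply: gsec_inj => y; rewrite /= scaler0.
have TZ f t : T (gsecZ f t) = f x *: T t.
  by rewrite -[gsecZ f t]addr0 TL T0 addr0.
have TD t t' : T (t + t') = T t + T t'.
  have := TL (sfun_cst 1) t t'; rewrite scale1r => <-; congr (T (_ + _)).
  by apply: gsec_inj => y; rewrite /= scale1r.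
have := TZ (sfun_mul (lf_bump l) (lf_bump l)) s.
rewrite /= lf_bump1 mulr1 scale1r => <-; rewrite lf_expand.
rewrite (big_morph T TD T0); apply: eq_bigr => i _.
by rewrite TZ /= lf_bump1 mul1r.
Qed.

(** Constant coefficients make the extension linear in [u]; fibre maps defined by means of
    extensions inherit their linearity from this. *)
Definition lf_ext (u : E x) : gsec :=
  \sum_i gsecZ (sfun_cst (coord (frame_vec e x) i u)) (lf_vec l i).

Lemma lf_extE u : lf_ext u x = u.
Proof.
rewrite gsec_sumE [RHS](coord_basis lf_basis (memvf u)).
by apply: eq_bigr => i _; rewrite /= lf_vec1 (tnth_nth 0).
Qed.

Lemma lf_ext_linear a u v :
  lf_ext (a *: u + v) = gsecZ (sfun_cst a) (lf_ext u) + lf_ext v.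
Proof.
apply: gsec_inj => y; rewrite /= !gsec_sumE scaler_sumr -big_split.
by apply: eq_bigr => i _; rewrite /= linearP scalerDl scalerA.
Qed.

End LocalFrame.

Definition gext x (u : E x) : gsec := lf_ext (local_frame_at x) u.

Lemma gextE x (u : E x) : gext u x = u.
Proof. exact: lf_extE. Qed.

Lemma gext_linear x a (u v : E x) :
  gext (a *: u + v) = gsecZ (sfun_cst a) (gext u) + gext v.
Proof. exact: lf_ext_linear. Qed.

(** Immediate from the expansion in a local frame; it allows to replace [gext] by any other section
    with the same value at [x]. *)
Lemma tensor_local x (V : lmodType R) (T : gsec -> V) :
  (forall f s t, T (gsecZ f s + t) = f x *: T s + T t) ->
  forall s t : gsec, s x = t x -> T s = T t.
Proof.
by move=> TL s t st; rewrite !(tensor_expand (local_frame_at x) TL) st.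
Qed.

End GlobalSections.
Arguments gext {R M E} x u.

(** * Wedge product and differential of cochains on sequences *)

Section Cochains.
Variable G : Type.

Definition sg (V : zmodType) (b : bool) (u : V) : V := if b then - u else u.

Definition eps (V : zmodType) (w : seq G -> V) : seq G -> V :=
  fun s => sg (odd (size s)) (w s).

Definition ctr (V : Type) (a : G) (w : seq G -> V) : seq G -> V :=
  fun s => w (a :: s).

(* The wedge product of inhomogeneous cochains, defined through the rule
   i_a (v /\ w) = i_a v /\ w + eps v /\ i_a w, where eps is the sign of the
   degree and i_a = ctr a the contraction. *)
Fixpoint shuf (U V W : zmodType) (m : U -> V -> W) (v : seq G -> U)
    (w : seq G -> V) (s : seq G) : W :=
  if s is a :: s' then shuf m (ctr a v) w s' + shuf m (eps v) (ctr a w) s'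
  else m (v [::]) (w [::]).

Definition biadditive (U V W : zmodType) (m : U -> V -> W) :=
  (forall v, {morph m^~ v : u u' / u + u'}) /\
  (forall u, {morph m u : v v' / v + v'}).

Definition parity (V : zmodType) (p : bool) (w : seq G -> V) :=
  forall s, odd (size s) != p -> w s = 0.

Lemma morphD0 (U V : zmodType) (f : U -> V) : {morph f : x y / x + y} -> f 0 = 0.
Proof. by move=> fD; apply: (addrI (f 0)); rewrite -fD !addr0. Qed.

Lemma morphDN (U V : zmodType) (f : U -> V) : {morph f : x y / x + y} ->
  {morph f : x / - x}.
Proof.
by move=> fD x; apply: (addrI (f x)); rewrite -fD !subrr (morphD0 fD).
Qed.

Lemma morphD_sg (U V : zmodType) (f : U -> V) b : {morph f : x y / x + y} ->
  {morph f : x / sg b x}.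
Proof. by move=> fD x; case: b => //=; exact: morphDN. Qed.

Lemma sgD (V : zmodType) b : {morph @sg V b : x y / x + y}.
Proof. by move=> x y; case: b => //=; rewrite opprD. Qed.

Lemma sgK (V : zmodType) b : involutive (@sg V b).
Proof. by move=> x; case: b => //=; rewrite opprK. Qed.

Lemma epsK (V : zmodType) (w : seq G -> V) : eps (eps w) = w.
Proof. by apply/funext => s; exact: sgK. Qed.

Lemma ctr_eps (V : zmodType) a (w : seq G -> V) :
  ctr a (eps w) = \- (eps (ctr a w)).
Proof.
by apply/funext => s; rewrite /ctr /eps /sg /=; case: odd => //=; rewrite opprK.
Qed.

Lemma parity_ctr (V : zmodType) a p (w : seq G -> V) : parity p w ->
  parity (~~ p) (ctr a w).
Proof. by move=> pw s sp; apply: pw => /=; move: sp; case: odd; case: p. Qed.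

Lemma parity_eps (V : zmodType) p (w : seq G -> V) : parity p w ->
  eps w = sg p \o w.
Proof.
move=> pw; apply/funext => s /=; rewrite /eps.
have [->//|/pw ->] := eqVneq (odd (size s)) p.
by rewrite !(morphD0 (@sgD _ _)).
Qed.

Section Shuffle.
Variables (U V W : zmodType) (m : U -> V -> W) (mB : biadditive m).
Implicit Types (v : seq G -> U) (w : seq G -> V).

Lemma shufDl v v' w s : shuf m (v \+ v') w s = shuf m v w s + shuf m v' w s.
Proof.
elim: s v v' w => [|a s IH] v v' w /=; first by rewrite mB.1.
have -> : eps (v \+ v') = eps v \+ eps v' by apply/funext => t; exact: sgD.
by rewrite [ctr a (v \+ v')]/(ctr a v \+ ctr a v') !IH addrACA.
Qed.

Lemma shufDr v w w' s : shuf m v (w \+ w') s = shuf m v w s + shuf m v w' s.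
Proof.
elim: s v w w' => [|a s IH] v w w' /=; first by rewrite mB.2.
by rewrite [ctr a (w \+ w')]/(ctr a w \+ ctr a w') !IH addrACA.
Qed.

Lemma shufNl v w s : shuf m (\- v) w s = - shuf m v w s.
Proof.
elim: s v w => [|a s IH] v w /=; first exact: (morphDN (mB.1 _)).
have -> : eps (\- v) = \- eps v.
  by apply/funext => t; exact: (morphDN (@sgD _ _)).
by rewrite [ctr a (\- v)]/(\- ctr a v) !IH opprD.
Qed.

Lemma shufNr v w s : shuf m v (\- w) s = - shuf m v w s.
Proof.
elim: s v w => [|a s IH] v w /=; first exact: (morphDN (mB.2 _)).
by rewrite [ctr a (\- w)]/(\- ctr a w) !IH opprD.
Qed.

Lemma shuf0l w s : shuf m (fun=> 0) w s = 0.
Proof.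
elim: s w => [|a s IH] w /=; first exact: (morphD0 (mB.1 _)).
have -> : eps (fun=> 0 : U) = fun=> 0.
  by apply/funext => t; exact: (morphD0 (@sgD _ _)).
by rewrite !IH addr0.
Qed.

Lemma shuf0r v s : shuf m v (fun=> 0) s = 0.
Proof.
by elim: s v => [|a s IH] v /=; [exact: (morphD0 (mB.2 _))|rewrite !IH addr0].
Qed.

Lemma shuf_sgl b v w s : shuf m (sg b \o v) w s = sg b (shuf m v w s).
Proof. by case: b => //; exact: shufNl. Qed.

Lemma eps_shuf v w : eps (shuf m v w) = shuf m (eps v) (eps w).
Proof.
apply/funext => s; elim: s v w => [//|a s IH] v w /=.
rewrite !ctr_eps shufNl shufNr -!IH /eps /sg /=.
by case: odd => /=; rewrite ?opprD ?opprK.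
Qed.

Lemma parity_shuf p q v w : parity p v -> parity q w ->
  parity (p (+) q) (shuf m v w).
Proof.
move=> pv qw s; elim: s p q v w pv qw => [|a s IH] p q v w pv qw /=.
  case: p q pv qw => -[] // pv qw _.
    by rewrite (pv [::])// (morphD0 (mB.1 _)).
  by rewrite (qw [::])// (morphD0 (mB.2 _)).
move=> sp; rewrite (IH _ _ _ _ (parity_ctr a pv) qw); last first.
  by move: sp; case: odd; case: p {pv}; case: q {qw}.
rewrite add0r (parity_eps pv) shuf_sgl (IH _ _ _ _ pv (parity_ctr a qw)).
  exact: (morphD0 (@sgD _ _)).
by move: sp; case: odd; case: p {pv}; case: q {qw}.
Qed.

Lemma shuf_map (U' V' W' : zmodType) (m' : U' -> V' -> W') (f : U -> U')
    (g : V -> V') (h : W -> W') v w s :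
  {morph f : x y / x + y} -> {morph h : x y / x + y} ->
  (forall u u', h (m u u') = m' (f u) (g u')) ->
  h (shuf m v w s) = shuf m' (f \o v) (g \o w) s.
Proof.
move=> fD hD hm; elim: s v w => [|a s IH] v w /=; first exact: hm.
rewrite hD !IH; congr (_ + shuf _ _ _ _); apply/funext => t /=.
exact: morphD_sg.
Qed.

Lemma shuf_derivation (f : U -> U) (g : V -> V) (h : W -> W) v w s :
  {morph f : x y / x + y} -> {morph h : x y / x + y} ->
  (forall u u', h (m u u') = m (f u) u' + m u (g u')) ->
  h (shuf m v w s) = shuf m (f \o v) w s + shuf m v (g \o w) s.
Proof.
move=> fD hD hm; elim: s v w => [|a s IH] v w /=; first exact: hm.
rewrite hD !IH.
have -> : f \o eps v = eps (f \o v) by apply/funext => t /=; exact: morphD_sg.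
by rewrite addrACA.
Qed.

End Shuffle.

(** Contracting with the first section produces the same three terms on both sides, because [eps] is
    multiplicative by [eps_shuf]. *)
Lemma shufA (U V W X Y Z : zmodType) (m1 : U -> V -> X) (m2 : X -> W -> Z)
    (m3 : V -> W -> Y) (m4 : U -> Y -> Z) (v1 : seq G -> U) (v2 : seq G -> V)
    (v3 : seq G -> W) s :
  biadditive m1 -> biadditive m2 -> biadditive m3 -> biadditive m4 ->
  (forall u v w, m2 (m1 u v) w = m4 u (m3 v w)) ->
  shuf m2 (shuf m1 v1 v2) v3 s = shuf m4 v1 (shuf m3 v2 v3) s.
Proof.
move=> B1 B2 B3 B4 mA; elim: s v1 v2 v3 => [|a s IH] v1 v2 v3 /=; first exact: mA.
rewrite [ctr a (shuf m1 v1 v2)]/(shuf m1 (ctr a v1) v2 \+ shuf m1 (eps v1) (ctr a v2)).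
rewrite [ctr a (shuf m3 v2 v3)]/(shuf m3 (ctr a v2) v3 \+ shuf m3 (eps v2) (ctr a v3)).
by rewrite shufDl// shufDr// (eps_shuf B1) !IH addrA.
Qed.

(** Graded commutativity under a trace. A contraction flips one parity, and the [eps] that it picks
    up when it passes the other factor is the resulting change of [p && q]; parities thus suffice
    for the induction. *)
Lemma shuf_cyclic (U V W W' X : zmodType) (m : U -> V -> W) (m' : V -> U -> W')
    (tr : W -> X) (tr' : W' -> X) p q (v : seq G -> U) (w : seq G -> V) s :
  biadditive m -> biadditive m' ->
  {morph tr : x y / x + y} -> {morph tr' : x y / x + y} ->
  (forall u u', tr (m u u') = tr' (m' u' u)) ->
  parity p v -> parity q w ->
  tr (shuf m v w s) = sg (p && q) (tr' (shuf m' w v s)).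
Proof.
move=> B B' D D' trC; elim: s p q v w => [|a s IH] p q v w pv qw /=.
  rewrite trC; case: p q pv qw => -[] //= pv qw.
  by rewrite (pv [::])// (morphD0 (B'.2 _)) (morphD0 D') oppr0.
have ev := parity_eps pv; have ew := parity_eps qw.
rewrite D D' ev ew !shuf_sgl// (morphD_sg _ D) (morphD_sg _ D').
rewrite (IH (~~ p) q)//; last exact: parity_ctr.
rewrite (IH p (~~ q))//; last exact: parity_ctr.
by case: p {pv ev IH}; case: q {qw ew} => /=; rewrite ?opprK ?opprD ?opprK addrC.
Qed.

End Cochains.

(** * Lie derivative and differential of cochains *)

Section CartanEilenberg.
Variables (G : Type) (br : G -> G -> G).

Fixpoint brsum (V : zmodType) (a : G) (w : seq G -> V) (s : seq G) : V :=
  if s is b :: s' then w (br a b :: s') + brsum a (ctr b w) s' else 0.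

Definition lie (V : zmodType) (act : G -> V -> V) (a : G) (w : seq G -> V) s : V :=
  act a (w s) - brsum a w s.

(* Cartan's formula i_a d + d i_a = L_a, read as a recursive definition of d. *)
Fixpoint ced (V : zmodType) (act : G -> V -> V) (w : seq G -> V) (s : seq G) : V :=
  if s is a :: s' then lie act a w s' - ced act (ctr a w) s' else 0.

Lemma brsumD (V : zmodType) a (v w : seq G -> V) s :
  brsum a (v \+ w) s = brsum a v s + brsum a w s.
Proof.
elim: s v w => [|b s IH] v w /=; first by rewrite addr0.
by rewrite [ctr b (v \+ w)]/(ctr b v \+ ctr b w) IH addrACA.
Qed.

Lemma brsum0 (V : zmodType) a s : brsum a (fun=> 0 : V) s = 0.
Proof. by elim: s => //= b s; rewrite add0r. Qed.

Lemma brsumN (V : zmodType) a (w : seq G -> V) s :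
  brsum a (\- w) s = - brsum a w s.
Proof.
elim: s w => [|b s IH] w /=; first by rewrite oppr0.
by rewrite [ctr b (\- w)]/(\- ctr b w) IH opprD.
Qed.

Lemma brsum_eps (V : zmodType) a (w : seq G -> V) : brsum a (eps w) = eps (brsum a w).
Proof.
apply/funext => s; elim: s w => [|b s IH] w //=.
rewrite ctr_eps brsumN IH /eps /sg /=.
by case: odd => /=; rewrite ?opprK ?opprD.
Qed.

Lemma brsum_map (V V' : zmodType) (h : V -> V') a (w : seq G -> V) s :
  {morph h : x y / x + y} -> h (brsum a w s) = brsum a (h \o w) s.
Proof.
move=> hD; elim: s w => [|b s IH] w /=; first exact: morphD0.
by rewrite hD IH.
Qed.

(** Each entry of the sequence lands in exactly one of the two factors, so replacing one entry at a
    time obeys the product rule. *)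
Lemma brsum_shuf (U V W : zmodType) (m : U -> V -> W) a (v : seq G -> U)
    (w : seq G -> V) s : biadditive m ->
  brsum a (shuf m v w) s = shuf m (brsum a v) w s + shuf m v (brsum a w) s.
Proof.
move=> B; elim: s v w => [|b s IH] v w /=.
  by rewrite (morphD0 (B.1 _)) (morphD0 (B.2 _)) addr0.
rewrite [ctr b (shuf m v w)]/(shuf m (ctr b v) w \+ shuf m (eps v) (ctr b w)).
rewrite brsumD !IH -brsum_eps.
rewrite [ctr b (brsum a v)]/(ctr (br a b) v \+ brsum a (ctr b v)).
rewrite [ctr b (brsum a w)]/(ctr (br a b) w \+ brsum a (ctr b w)).
rewrite shufDl// shufDr//.
set x1 := shuf _ (ctr (br a b) v) _ _; set x2 := shuf _ _ (ctr (br a b) w) _.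
set x3 := shuf _ (brsum a (ctr b v)) _ _; set x4 := shuf _ (ctr b v) _ _.
set x5 := shuf _ (brsum a (eps v)) _ _; set x6 := shuf _ _ (brsum a (ctr b w)) _.
rewrite [LHS](AC (2*(2*2)) ((1*3)*5*(4*(2*6)))); reflexivity.
Qed.

Section Differential.
Variables (V : zmodType) (act : G -> V -> V).
Hypothesis actD : forall a, {morph act a : x y / x + y}.

Lemma lieD a (v w : seq G -> V) s :
  lie act a (v \+ w) s = lie act a v s + lie act a w s.
Proof. by rewrite /lie actD brsumD opprD addrACA. Qed.

Lemma cedD (v w : seq G -> V) s : ced act (v \+ w) s = ced act v s + ced act w s.
Proof.
elim: s v w => [|a s IH] v w /=; first by rewrite addr0.
by rewrite lieD [ctr a (v \+ w)]/(ctr a v \+ ctr a w) IH opprD addrACA.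
Qed.

Lemma lieN a (w : seq G -> V) s : lie act a (\- w) s = - lie act a w s.
Proof. by rewrite /lie (morphDN (actD a)) brsumN opprD. Qed.

Lemma cedN (w : seq G -> V) s : ced act (\- w) s = - ced act w s.
Proof.
elim: s w => [|a s IH] w /=; first by rewrite oppr0.
by rewrite lieN [ctr a (\- w)]/(\- ctr a w) IH -opprD.
Qed.

Lemma lie_eps a (w : seq G -> V) : lie act a (eps w) = eps (lie act a w).
Proof.
apply/funext => s; rewrite /lie brsum_eps /eps.
by rewrite (morphD_sg _ (actD a)) sgD (morphDN (@sgD _ _)).
Qed.

Lemma ced_eps (w : seq G -> V) : ced act (eps w) = \- eps (ced act w).
Proof.
apply/funext => s; elim: s w => [|a s IH] w /=.
  by rewrite /eps /= oppr0.
rewrite ctr_eps cedN IH lie_eps /eps /sg /=.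
by case: odd => /=; rewrite ?opprK ?opprD ?opprK.
Qed.

(** Confines identities such as [bianchi] to sequences of a single length. *)
Lemma ced_degree k (w : seq G -> V) : (forall s, size s != k -> w s = 0) ->
  forall s, size s != k.+1 -> ced act w s = 0.
Proof.
move=> wk s; elim: s k w wk => [//|a s IH] k w wk /= sk.
have brs t : size t != k -> brsum a w t = 0.
  elim: t k w wk {IH sk} => [//|b t IHt] k w wk /= tk.
  rewrite wk// add0r; case: k tk wk => [_|k tk] wk.
    have w0 : ctr b w = fun=> 0 by apply/funext => u; exact: wk.
    by rewrite w0 brsum0.
  by apply: (IHt k) => // u uk; apply: wk.
rewrite /lie wk// (morphD0 (actD a)) brs// subr0 sub0r.
case: k sk wk {brs} => [sk|k sk] wk.
  have -> : ctr a w = fun=> 0 by apply/funext => u; exact: wk.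
  have aux t : ced act (fun=> 0) t = 0.
    elim: t => //= b t IHt.
    have -> : ctr b (fun=> 0 : V) = fun=> 0 by [].
    rewrite IHt subr0 /lie (morphD0 (actD b)).
    by rewrite brsum0 subr0.
  by rewrite aux oppr0.
by rewrite (IH k) ?oppr0// => u uk; apply: wk.
Qed.

End Differential.

Lemma ced_map (V V' : zmodType) (act : G -> V -> V) (act' : G -> V' -> V')
    (h : V -> V') (w : seq G -> V) s :
  {morph h : x y / x + y} -> (forall a v, h (act a v) = act' a (h v)) ->
  h (ced act w s) = ced act' (h \o w) s.
Proof.
move=> hD hact; elim: s w => [|a s IH] w /=; first exact: morphD0.
rewrite hD (morphDN hD) IH /lie hD (morphDN hD) hact (brsum_map _ _ _ hD)//.
Qed.

(** Contract with the first section and use i_a d = L_a - d i_a: the Lie derivative is a derivation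
    of the product, and the other terms are induction hypotheses for contracted factors. The signs
    match because d anticommutes with [eps]. *)
Lemma ced_shuf (U V W : zmodType) (m : U -> V -> W) (aU : G -> U -> U)
    (aV : G -> V -> V) (aW : G -> W -> W) (v : seq G -> U) (w : seq G -> V) s :
  biadditive m ->
  (forall a, {morph aU a : x y / x + y}) ->
  (forall a, {morph aV a : x y / x + y}) ->
  (forall a, {morph aW a : x y / x + y}) ->
  (forall a u u', aW a (m u u') = m (aU a u) u' + m u (aV a u')) ->
  ced aW (shuf m v w) s = shuf m (ced aU v) w s + shuf m (eps v) (ced aV w) s.
Proof.
move=> B DU DV DW am; elim: s v w => [|a s IH] v w /=.
  by rewrite (morphD0 (B.1 _)) (morphD0 (B.2 _)) addr0.
have lie_shuf t : lie aW a (shuf m v w) t =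
    shuf m (lie aU a v) w t + shuf m v (lie aV a w) t.
  rewrite {1}/lie (shuf_derivation (f := aU a) (g := aV a) (m := m))//.
  rewrite brsum_shuf// [lie aU a v]/((aU a \o v) \+ \- brsum a v).
  rewrite [lie aV a w]/((aV a \o w) \+ \- brsum a w).
  by rewrite shufDl// shufDr// shufNl// shufNr// opprD addrACA.
rewrite lie_shuf [ctr a (shuf m v w)]/(shuf m (ctr a v) w \+ shuf m (eps v) (ctr a w)).
have e1 : shuf m (ctr a (ced aU v)) w s =
    shuf m (lie aU a v) w s - shuf m (ced aU (ctr a v)) w s.
  by rewrite -(shufNl B (ced _ _)) -(shufDl B).
have e2 : shuf m v (ctr a (ced aV w)) s =
    shuf m v (lie aV a w) s - shuf m v (ced aV (ctr a w)) s.
  by rewrite -(shufNr B _ (ced _ _)) -(shufDr B).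
rewrite cedD// !IH epsK e1 e2 ced_eps// ctr_eps !shufNl//.
set x1 := shuf _ (lie _ _ _) _ _; set x2 := shuf _ _ (lie _ _ _) _.
set x3 := shuf _ (ced _ (ctr _ _)) _ _; set x4 := shuf _ (eps (ctr _ _)) _ _.
set x5 := shuf _ (eps (ced _ _)) _ _; set x6 := shuf _ _ (ced _ (ctr _ _)) _.
rewrite !opprD !opprK; rewrite [LHS](AC (2*(2*2)) ((1*3)*5*(4*(2*6)))).
reflexivity.
Qed.

End CartanEilenberg.

(** * Connections and curvature *)

Lemma lin_sum (R : realType) (V W : lmodType R) (h : V -> W) (I : Type)
    (r : seq I) (c : I -> R) (u : I -> V) :
  (forall k v v', h (k *: v + v') = k *: h v + h v') ->
  h (\sum_(i <- r) c i *: u i) = \sum_(i <- r) c i *: h (u i).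
Proof.
move=> hL; have h0 : h 0 = 0.
  by have := hL (-1) 0 0; rewrite scaleN1r addNr scaleN1r addNr.
by elim: r => [|i r IH]; rewrite ?big_nil// !big_cons hL IH.
Qed.

Lemma lfun_of_linear (R : realType) (V W : vectType R) (h : V -> W) :
  (forall k v v', h (k *: v + v') = k *: h v + h v') ->
  {g : 'Hom(V, W) | forall v, g v = h v}.
Proof.
move=> hL; have hL' : linear h by [].
pose hl : {linear V -> W} := HB.pack h (GRing.isLinear.Build R V W _ h hL').
by exists (linfun hl) => v; rewrite lfunE.
Qed.

(** Replaces the [vbasis] of a fibre, chosen without regard to the other fibres, by a basis from a
    smooth frame. *)
Lemma lfun_trE (R : realType) (V : vectType R) n (b : n.-tuple V) (g : 'End(V)) :
  basis_of fullv b -> lfun_tr g = \sum_i coord b i (g (tnth b i)).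
Proof.
move=> bb; rewrite /lfun_tr.
have vb : basis_of fullv (vbasis {:V}) by exact: vbasisP.
transitivity (\sum_i \sum_j coord b j (g (tnth (vbasis {:V}) i)) *
    coord (vbasis {:V}) i (tnth b j)).
  by apply: eq_bigr => i _; rewrite (coord_change _ _ _ bb).
rewrite exchange_big; apply: eq_bigr => j _ /=.
rewrite [in RHS](coord_basis vb (memvf (tnth b j))) !linear_sum.
by apply: eq_bigr => i _; rewrite !linearZ mulrC (tnth_nth 0 (vbasis _)).
Qed.

Lemma lfun_tr_linear (R : realType) (V : vectType R) k (g h : 'End(V)) :
  lfun_tr (k *: g + h) = k * lfun_tr g + lfun_tr h.
Proof.
rewrite /lfun_tr mulr_sumr -big_split; apply: eq_bigr => i _ /=.
by rewrite add_lfunE scale_lfunE linearD linearZ.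
Qed.

Section AlgebroidSections.
Variables (R : realType) (M : manifold R) (A : lie_algebroid M).

Definition gbr (a b : gsec A) : gsec A :=
  GSec (bracket_smooth (bracketP A) (gsecP a) (gsecP b)).

Lemma anchorP_linear (f : sfun M) x (k : R) (u v : A x) :
  anchor (k *: u + v) f = k * anchor u f + anchor v f.
Proof. exact: (anchor_linear (anchorP A)) (sfunP f). Qed.

Fact grho_smooth (a : gsec A) (f : sfun M) :
  smooth_fun (fun x => anchor (a x) f).
Proof.
apply: smooth_on_local => x _; have [e fe ex] := frame_cover A x.
exists (frame_dom e) => //; have oe := frame_open fe.
apply: (@smooth_on_ext _ _ _ (fun y => \sum_i coord (frame_vec e y) i (a y) *
    anchor (tnth (frame_vec e y) i) f)) => //.
  move=> y; rewrite inE => ey.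
  rewrite [in RHS](coord_basis (frame_basis fe ey) (memvf (a y))).
  rewrite (@lin_sum _ _ R^o (fun v => anchor v f)); last exact: anchorP_linear.
  by apply: eq_bigr => i _; rewrite (tnth_nth 0).
apply: smooth_on_sum => // i _; apply: smooth_onM => //; first exact: gsecP.
exact: (anchor_smooth (anchorP A)) (sfunP f) _.
Qed.

Definition grho (a : gsec A) (f : sfun M) : sfun M := SFun (grho_smooth a f).

Lemma grhoD a : {morph grho a : f g / f + g}.
Proof.
move=> f g; apply: sfun_inj => x /=.
have [/(_ 1 f g (sfunP f) (sfunP g)) + _] := anchor_tangent (anchorP A) (a x).
rewrite mul1r => <-; congr (anchor _ _).
by apply/funext => y /=; rewrite mul1r.
Qed.

Lemma grhoM a f g :
  grho a (sfun_mul f g) = sfun_mul (grho a f) g + sfun_mul f (grho a g).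
Proof.
apply: sfun_inj => x /=.
have [_ ->] := anchor_tangent (anchorP A) (a x); [|exact: sfunP|exact: sfunP].
by rewrite addrC.
Qed.

(** The product rule on 1 * 1 kills the constant 1, and linearity then kills all constants. *)
Lemma grho_cst a k : grho a (sfun_cst M k) = 0.
Proof.
have c0 : grho a (sfun_cst M 0) = 0 by exact: (morphD0 (grhoD a)).
have c1 : grho a (sfun_cst M 1) = 0.
  have := grhoM a (sfun_cst M 1) (sfun_cst M 1).
  have -> : sfun_mul (sfun_cst M 1) (sfun_cst M 1) = sfun_cst M 1.
    by apply: sfun_inj => x; rewrite /= mulr1.
  move=> e; apply: sfun_inj => x; have /(congr1 (fun f : sfun M => f x)) /= := e.
  by rewrite mulr1 mul1r => /eqP; rewrite -subr_eq0 opprD addrA subrr sub0r oppr_eq0 => /eqP.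
apply: sfun_inj => x /=.
have [/(_ k (sfun_cst M 1) (sfun_cst M 0)) + _] := anchor_tangent (anchorP A) (a x).
move=> /(_ (sfunP _) (sfunP _)) e.
have -> : (fun=> k) = (fun y : M => k * sfun_cst M 1 y + sfun_cst M 0 y).
  by apply/funext => y /=; rewrite mulr1 addr0.
rewrite e; move/(congr1 (fun f : sfun M => f x)): c1 => /= ->.
by move/(congr1 (fun f : sfun M => f x)): c0 => /= ->; rewrite mulr0 addr0.
Qed.

Lemma gbrN (a b : gsec A) : gbr a b = - gbr b a.
Proof.
by apply: gsec_inj => x; exact: (bracket_anti (bracketP A)) (gsecP a) (gsecP b) x.
Qed.

Lemma gbrDr (a b c : gsec A) : gbr a (b + c) = gbr a b + gbr a c.
Proof.
apply: gsec_inj => x.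
have := bracket_linear (bracketP A) 1 (gsecP a) (gsecP b) (gsecP c) x.
have -> : sadd (sscale (fun=> 1) b) c = (b + c : gsec A).
  by apply: functional_extensionality_dep => y; rewrite /sadd /sscale scale1r.
by rewrite scale1r.
Qed.

Lemma gbr_jacobi (a b c : gsec A) :
  gbr a (gbr b c) + gbr b (gbr c a) + gbr c (gbr a b) = 0.
Proof.
by apply: gsec_inj => x; exact: (bracket_jacobi (bracketP A)) (gsecP a) (gsecP b) (gsecP c) x.
Qed.

Lemma gbrZr (a b : gsec A) f :
  gbr a (gsecZ f b) = gsecZ f (gbr a b) + gsecZ (grho a f) b.
Proof.
by apply: gsec_inj => x; exact: (bracket_leibniz (bracketP A)) (gsecP a) (gsecP b) (sfunP f) x.
Qed.

End AlgebroidSections.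

(** * Sections of the endomorphism bundle and their trace *)

Section EndSections.
Variables (R : realType) (M : manifold R) (E : vbundle M).

(** Smoothness is expressed by the action on global sections, so that composites are smooth at
    once. *)
Record gend := GEnd {
  gend_fun :> forall x, 'End(E x);
  gendP : forall s : gsec E, smooth_section (fun x => gend_fun x (s x)) }.

Definition gapp (t : gend) (s : gsec E) : gsec E := GSec (gendP t s).

Lemma gend_inj (t u : gend) : (forall x, t x = u x) -> t = u.
Proof.
case: t u => [t st] [u su] /= tu.
have e : t = u by exact: functional_extensionality_dep.
by subst u; rewrite (Prop_irrelevance st su).
Qed.

Lemma gend_ext (t u : gend) : (forall s, gapp t s = gapp u s) -> t = u.
Proof.
move=> tu; apply: gend_inj => x; apply/lfunP => v.
by move/(congr1 (fun s : gsec E => s x)): (tu (gext x v)); rewrite /= gextE.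
Qed.

HB.instance Definition _ := gen_eqMixin gend.
HB.instance Definition _ := gen_choiceMixin gend.

Fact gend0P (s : gsec E) : smooth_section (fun x => (0 : 'End(E x)) (s x)).
Proof.
rewrite (_ : (fun x => _) = (0 : gsec E) :> (forall x, E x)); first exact: gsecP.
by apply: functional_extensionality_dep => x; rewrite zero_lfunE.
Qed.
Fact gendDP (t u : gend) (s : gsec E) :
  smooth_section (fun x => (t x + u x) (s x)).
Proof.
rewrite (_ : (fun x => _) = (gapp t s + gapp u s) :> (forall x, E x)); first exact: gsecP.
by apply: functional_extensionality_dep => x; rewrite add_lfunE.
Qed.
Fact gendNP (t : gend) (s : gsec E) : smooth_section (fun x => (- t x) (s x)).
Proof.
rewrite (_ : (fun x => _) = (- gapp t s) :> (forall x, E x)); first exact: gsecP.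
by apply: functional_extensionality_dep => x; rewrite opp_lfunE.
Qed.
Fact gend_compP (t u : gend) (s : gsec E) :
  smooth_section (fun x => (t x \o u x)%VF (s x)).
Proof.
rewrite (_ : (fun x => _) = gapp t (gapp u s) :> (forall x, E x)); first exact: gsecP.
by apply: functional_extensionality_dep => x; rewrite comp_lfunE.
Qed.
Fact gend_idP (s : gsec E) : smooth_section (fun x => (\1 : 'End(E x))%VF (s x)).
Proof.
rewrite (_ : (fun x => _) = s :> (forall x, E x)); first exact: gsecP.
by apply: functional_extensionality_dep => x; rewrite id_lfunE.
Qed.

Definition gend0 := GEnd gend0P.
Definition gendD t u := GEnd (gendDP t u).
Definition gendN t := GEnd (gendNP t).
Definition gend_comp t u := GEnd (gend_compP t u).
Definition gend_id := GEnd gend_idP.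

Fact gend_addA : associative gendD.
Proof. by move=> f g h; apply: gend_inj => x; exact: addrA. Qed.
Fact gend_addC : commutative gendD.
Proof. by move=> f g; apply: gend_inj => x; exact: addrC. Qed.
Fact gend_add0 : left_id gend0 gendD.
Proof. by move=> f; apply: gend_inj => x; exact: add0r. Qed.
Fact gend_addN : left_inverse gend0 gendN gendD.
Proof. by move=> f; apply: gend_inj => x; exact: addNr. Qed.

HB.instance Definition _ :=
  GRing.isZmodule.Build gend gend_addA gend_addC gend_add0 gend_addN.

Lemma gappD t u s : gapp (t + u) s = gapp t s + gapp u s.
Proof. by apply: gsec_inj => x; rewrite /= add_lfunE. Qed.

Lemma gapp_linear t f (s s' : gsec E) :
  gapp t (gsecZ f s + s') = gsecZ f (gapp t s) + gapp t s'.
Proof. by apply: gsec_inj => x; rewrite /= linearP. Qed.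

Lemma gappDr t (s s' : gsec E) : gapp t (s + s') = gapp t s + gapp t s'.
Proof. by apply: gsec_inj => x; rewrite /= linearD. Qed.

Lemma gapp_comp t u s : gapp (gend_comp t u) s = gapp t (gapp u s).
Proof. by apply: gsec_inj => x; rewrite /= comp_lfunE. Qed.

Lemma gend_comp_biadditive : biadditive gend_comp.
Proof.
split=> u v w; apply: gend_inj => x; apply/lfunP => s /=.
  by rewrite !(comp_lfunE, add_lfunE).
by rewrite !(comp_lfunE, add_lfunE) linearD.
Qed.

(** The fibre map evaluates [T] on the linear extension [gext], and [tensor_local] shows that any
    extension gives the same value. Curvatures, commutators with a connection and differences of
    connections become endomorphism sections in this way. *)
Lemma gend_of_tensor (T : gsec E -> gsec E) :
  (forall f s t, T (gsecZ f s + t) = gsecZ f (T s) + T t) ->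
  {t : gend | forall s, gapp t s = T s}.
Proof.
move=> TL.
have hL x k (v v' : E x) :
    T (gext x (k *: v + v')) x = k *: T (gext x v) x + T (gext x v') x.
  by rewrite gext_linear TL.
pose t x := sval (lfun_of_linear (hL x)).
have tE (s : gsec E) x : t x (s x) = T s x.
  rewrite /t; case: (lfun_of_linear _) => g /= ->.
  apply: (@tensor_local _ _ _ x _ (fun s => T s x)); last exact: gextE.
  by move=> f s1 s2; rewrite TL.
have tS (s : gsec E) : smooth_section (fun x => t x (s x)).
  rewrite (_ : (fun x => _) = T s :> (forall x, E x)); first exact: gsecP.
  by apply: functional_extensionality_dep => x; exact: tE.
by exists (GEnd tS) => s; apply: gsec_inj => x; exact: tE.
Qed.

(** The square of the bump function is the price of globally smooth diagonal entries; it is divided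
    out in [gtr_smooth] and differentiated in [gtr_act]. *)
Lemma lf_trace x (l : local_frame E x) (t : gend) y :
  \sum_j lf_coord l (gapp t (lf_vec l j)) j y =
  lf_bump l y * lf_bump l y * lfun_tr (t y).
Proof.
have [dy|ndy] := pselect (frame_dom (lf_frame l) y); last first.
  have [_ _ [K [_ KW fK]]] := lf_bumpP l.
  have fy : lf_bump l y = 0 by apply: fK => /KW.
  by rewrite fy !mul0r big1// => i _ /=; rewrite fy mul0r.
rewrite (lfun_trE _ (frame_basis (lf_frames l) dy)) mulr_sumr.
by apply: eq_bigr => i _; rewrite /= lf_vecE linearZ /= linearZ mulrA.
Qed.

Fact gtr_smooth (t : gend) : smooth_fun (fun x => lfun_tr (t x)).
Proof.
apply: smooth_on_local => x _; set l := local_frame_at E x.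
pose U := [set y | lf_bump l y != 0].
have oU : open U by exact: nonzero_open (sfunP _).
exists U; first by rewrite /U /= lf_bump1 oner_neq0.
have sb : smooth_on U (lf_bump l) by exact: smooth_on_sub (@subsetT _ _) (sfunP _).
have sV : smooth_on U (fun y => (lf_bump l y)^-1) by exact: smooth_onV.
apply: (@smooth_on_ext _ _ _ (fun y => (lf_bump l y)^-1 * (lf_bump l y)^-1 *
   \sum_j lf_coord l (gapp t (lf_vec l j)) j y)) => //.
  move=> y; rewrite inE => Uy; rewrite lf_trace -invfM mulrA mulVf ?mul1r//.
  by rewrite mulf_neq0.
apply: smooth_onM => //; first exact: smooth_onM.
by apply: smooth_on_sum => // i _; exact: smooth_on_sub (@subsetT _ _) (sfunP _).
Qed.

Definition gtr (t : gend) : sfun M := SFun (gtr_smooth t).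

Lemma gtrD : {morph gtr : t u / t + u}.
Proof.
by move=> t u; apply: sfun_inj => x /=; rewrite -[t x in LHS]scale1r lfun_tr_linear mul1r.
Qed.

End EndSections.

Section Connections.
Variables (R : realType) (M : manifold R) (A : lie_algebroid M) (E : vbundle M).
Variables (D : section A -> section E -> section E) (cD : is_connection D).

Definition gnab (a : gsec A) (s : gsec E) : gsec E :=
  GSec (conn_smooth cD (gsecP a) (gsecP s)).

Lemma gnab_linear f (a b : gsec A) s :
  gnab (gsecZ f a + b) s = gsecZ f (gnab a s) + gnab b s.
Proof.
apply: gsec_inj => x.
exact: (conn_linear_l cD (sfunP f) (gsecP a) (gsecP b) (gsecP s) x).
Qed.

Lemma gnabDl (a b : gsec A) s : gnab (a + b) s = gnab a s + gnab b s.
Proof. by rewrite -[a in LHS]gsecZ1 gnab_linear gsecZ1. Qed.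

Lemma gnabDr a (s t : gsec E) : gnab a (s + t) = gnab a s + gnab a t.
Proof. by apply: gsec_inj => x; exact: (conn_add_r cD (gsecP a) (gsecP s) (gsecP t) x). Qed.

Lemma gnabZr f a (s : gsec E) :
  gnab a (gsecZ f s) = gsecZ f (gnab a s) + gsecZ (grho a f) s.
Proof. by apply: gsec_inj => x; exact: (conn_leibniz cD (sfunP f) (gsecP a) (gsecP s) x). Qed.

(** The terms rho(a)(f) t(s) from the two Leibniz rules cancel. *)
Fact gnab_commutator_tensor (a : gsec A) (t : gend E) f (s s' : gsec E) :
  let T s := gnab a (gapp t s) - gapp t (gnab a s) in
  T (gsecZ f s + s') = gsecZ f (T s) + T s'.
Proof.
rewrite /= gapp_linear !gnabDr !gnabZr !gappDr.
have gappZ u : gapp t (gsecZ f u) = gsecZ f (gapp t u).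
  by apply: gsec_inj => x; rewrite /= linearZ.
have ZB u v : gsecZ f (u - v) = gsecZ f u - gsecZ f v.
  by apply: gsec_inj => x; rewrite /= scalerBr.
have -> : gapp t (gsecZ (grho a f) s) = gsecZ (grho a f) (gapp t s).
  by apply: gsec_inj => x; rewrite /= linearZ.
rewrite gappZ ZB !opprD [LHS](AC (3*3) (((1*4)*(2*5))*(3*6))) /=.
by rewrite subrr addr0.
Qed.

End Connections.

Section CovariantDerivative.
Variables (R : realType) (M : manifold R) (A : lie_algebroid M) (E : vbundle M).

Lemma grho_gbr (a b : gsec A) f :
  grho (gbr a b) f = grho a (grho b f) - grho b (grho a f).
Proof.
by apply: sfun_inj => x; exact: (bracket_anchor (bracketP A) (gsecP a) (gsecP b) (sfunP f) x).
Qed.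

Section OneConnection.
Variables (D : section A -> section E -> section E) (cD : is_connection D).
Local Notation nab := (gnab cD).

(** The induced connection on End(E), t |-> [nabla_a, t]. *)
Definition gact (a : gsec A) (t : gend E) : gend E :=
  sval (gend_of_tensor (gnab_commutator_tensor cD a t)).

Lemma gactE a t s : gapp (gact a t) s = nab a (gapp t s) - gapp t (nab a s).
Proof. by rewrite /gact; case: gend_of_tensor => u /= ->. Qed.

Lemma gappBr (t : gend E) (s s' : gsec E) : gapp t (s - s') = gapp t s - gapp t s'.
Proof. by rewrite gappDr (morphDN (gappDr t)). Qed.

Lemma gactD a : {morph gact a : t u / t + u}.
Proof.
move=> t u; apply: gend_ext => s.
by rewrite gappD !gactE !gappD gnabDr opprD addrACA.
Qed.

Lemma gact_comp a t u :
  gact a (gend_comp t u) = gend_comp (gact a t) u + gend_comp t (gact a u).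
Proof.
apply: gend_ext => s; rewrite gappD !gapp_comp !gactE !gapp_comp gappBr.
by rewrite addrA subrK.
Qed.

Lemma gact_id a : gact a (gend_id E) = 0.
Proof.
have gid s : gapp (gend_id E) s = s by apply: gsec_inj => x; rewrite /= id_lfunE.
apply: gend_ext => s; rewrite gactE !gid subrr.
by apply: gsec_inj => x; rewrite /= zero_lfunE.
Qed.

(* At the centre x of a local frame (s_j), cut off by f, expand
   f^2 t(s_j) = sum_i c_ij s_i with c_ij globally smooth: the terms with
   nabla s_i cancel in the trace of [nabla_a, t], leaving rho(a)(sum_j c_jj). *)
Lemma gtr_act a t : gtr (gact a t) = grho a (gtr t).
Proof.
apply: sfun_inj => x; set l := local_frame_at E x.
set e := frame_vec (lf_frame l) x.
have be : basis_of fullv e := lf_basis l.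
pose f2 := sfun_mul (lf_bump l) (lf_bump l).
have f21 : f2 x = 1 by rewrite /f2 /= lf_bump1 mulr1.
have lfx (u : gsec E) j : lf_coord l u j x = coord e j (u x).
  by rewrite /= lf_bump1 mul1r.
have nabsum (F : 'I_(rank E) -> gsec E) :
    nab a (\sum_i F i) = \sum_i nab a (F i).
  by apply: (big_morph (nab a) (gnabDr cD a)); exact: morphD0 (gnabDr cD a).
have nabZx f (u : gsec E) j : coord e j (nab a (gsecZ f u) x) =
    f x * coord e j (nab a u x) + grho a f x * coord e j (u x).
  rewrite gnabZr -[LHS]/(coord e j (f x *: nab a u x + grho a f x *: u x)).
  by rewrite linearD !linearZ.
(* Apply nabla to the expansion of f^2 u. The term with the derivative of f^2 is kept; it cancels
   against the one in [rsc]. *)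
have key (u : gsec E) j : coord e j (nab a u x) =
    \sum_i lf_coord l u i x * coord e j (nab a (lf_vec l i) x)
    + grho a (lf_coord l u j) x - grho a f2 x * lf_coord l u j x.
  have e0 := nabZx f2 u j; rewrite f21 mul1r in e0.
  apply: (canRL (addrK _)); rewrite lfx -e0.
  rewrite /f2 lf_expand nabsum gsec_sumE linear_sum.
  rewrite (eq_bigr (fun i => lf_coord l u i x * coord e j (nab a (lf_vec l i) x) +
     (if i == j then grho a (lf_coord l u i) x else 0))); last first.
    move=> i _; apply: etrans (nabZx _ _ _) _; rewrite lf_vec1.
    rewrite (tnth_nth 0) coord_free ?(basis_free be)//.
    by rewrite eq_sym; case: eqP => _; rewrite ?mulr1 ?mulr0.
  by rewrite big_split /= -big_mkcond big_pred1_eq.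
pose c i j := lf_coord l (gapp t (lf_vec l j)) i.
have cE i j : c i j x = coord e i (t x (tnth e j)).
  by rewrite /c lfx -lf_vec1.
have sc : \sum_j c j j = sfun_mul f2 (gtr t).
  by apply: sfun_inj => y; rewrite sfun_sumE lf_trace.
have trx : \sum_j c j j x = gtr t x.
  by rewrite -sfun_sumE sc /= -/f2 -[_ * _]/(f2 x * _) f21 mul1r.
have rsc : \sum_j grho a (c j j) x = grho a f2 x * gtr t x + grho a (gtr t) x.
  rewrite -(sfun_sumE _ _ (fun j => grho a (c j j))).
  rewrite -(big_morph (grho a) (grhoD a) (morphD0 (grhoD a))) sc grhoM.
  by rewrite -[LHS]/(grho a f2 x * gtr t x + f2 x * grho a (gtr t) x) f21 mul1r.
have actx j : coord e j (gact a t x (tnth e j)) =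
    coord e j (nab a (gapp t (lf_vec l j)) x) -
    \sum_i coord e i (nab a (lf_vec l j) x) * c j i x.
  have := congr1 (fun s : gsec E => coord e j (s x)) (gactE a t (lf_vec l j)).
  rewrite -[LHS]/(coord e j (gact a t x (lf_vec l j x))) lf_vec1 => ->.
  rewrite -[LHS]/(coord e j (nab a (gapp t (lf_vec l j)) x - t x (nab a (lf_vec l j) x))).
  rewrite linearB; congr (_ - _).
  rewrite {1}(coord_basis be (memvf (nab a (lf_vec l j) x))) !linear_sum.
  by apply: eq_bigr => i _; rewrite cE !linearZ (tnth_nth 0).
pose w i j := coord e j (nab a (lf_vec l i) x).
have S1 : \sum_j coord e j (nab a (gapp t (lf_vec l j)) x) =
    \sum_j \sum_i c i j x * w i j + (grho a f2 x * gtr t x + grho a (gtr t) x)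
    - grho a f2 x * gtr t x.
  rewrite -rsc -trx mulr_sumr -big_split -sumrB.
  by apply: eq_bigr => j _; exact: key.
have S2 : \sum_j \sum_i w j i * c j i x = \sum_j \sum_i c i j x * w i j.
  by rewrite exchange_big; apply: eq_bigr => j _; apply: eq_bigr => i _; rewrite mulrC.
rewrite -[LHS]/(lfun_tr (gact a t x)) (lfun_trE _ be).
rewrite (eq_bigr _ (fun j _ => actx j)) sumrB S1 S2.
by ring.
Qed.

(** The terms with one derivative of [f] cancel in pairs, and those with two cancel against the
    Leibniz term of nabla along the bracket, by [grho_gbr]. *)
Fact gcurv_tensor (a b : gsec A) f (s s' : gsec E) :
  let T s := nab a (nab b s) - nab b (nab a s) - nab (gbr a b) s in
  T (gsecZ f s + s') = gsecZ f (T s) + T s'.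
Proof.
rewrite /= !(gnabDr, gnabZr) grho_gbr; apply: gsec_inj => x.
apply: vec_ext => i; rewrite !(gsecDE, gsecNE, gsecZE, sfunDE, sfunNE).
rewrite !(vcoordD, vcoordN, vcoordZ); ring.
Qed.

Definition gcurv (a b : gsec A) : gend E :=
  sval (gend_of_tensor (gcurv_tensor a b)).

Lemma gcurvE a b s :
  gapp (gcurv a b) s = nab a (nab b s) - nab b (nab a s) - nab (gbr a b) s.
Proof. by rewrite /gcurv; case: gend_of_tensor => u /= ->. Qed.

End OneConnection.
End CovariantDerivative.

(** * Curvature, Bianchi identity and the straight path of connections *)

Section Curvature.
Variables (R : realType) (M : manifold R) (A : lie_algebroid M) (E : vbundle M).

Fact gendZP (f : sfun M) (t : gend E) (s : gsec E) :
  smooth_section (fun x => (f x *: t x) (s x)).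
Proof.
rewrite (_ : (fun x => _) = gsecZ f (gapp t s) :> (forall x, E x)); first exact: gsecP.
by apply: functional_extensionality_dep => x; rewrite scale_lfunE.
Qed.

Definition gendZ f t : gend E := GEnd (gendZP f t).

Lemma gappZ f t s : gapp (gendZ f t) s = gsecZ f (gapp t s).
Proof. by apply: gsec_inj => x; rewrite /= scale_lfunE. Qed.

Lemma gappN (t : gend E) s : gapp (- t) s = - gapp t s.
Proof. by apply: gsec_inj => x; rewrite /= opp_lfunE. Qed.

Lemma gapp0 (s : gsec E) : gapp 0 s = 0.
Proof. by apply: gsec_inj => x; rewrite /= zero_lfunE. Qed.

Lemma gapprZ f (t : gend E) s : gapp t (gsecZ f s) = gsecZ f (gapp t s).
Proof. by apply: gsec_inj => x; rewrite /= linearZ. Qed.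

Lemma gbrDl (a b c : gsec A) : gbr (a + b) c = gbr a c + gbr b c.
Proof. by rewrite gbrN gbrDr opprD -!gbrN. Qed.

Lemma gbrNr (a b : gsec A) : gbr a (- b) = - gbr a b.
Proof. exact: morphDN (gbrDr a) b. Qed.

Lemma gbrZl f (a b : gsec A) :
  gbr (gsecZ f a) b = gsecZ f (gbr a b) - gsecZ (grho b f) a.
Proof.
rewrite gbrN gbrZr opprD [gbr a b]gbrN; congr (_ - _).
by apply: gsec_inj => x; rewrite /= scalerN.
Qed.

Section OneConnection.
Variables (D : section A -> section E -> section E) (cD : is_connection D).
Local Notation nab := (gnab cD).

Lemma gnabNl a s : nab (- a) s = - nab a s.
Proof. exact: (morphDN (fun a b => gnabDl cD a b s)). Qed.

Lemma gnabNr a s : nab a (- s) = - nab a s.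
Proof. exact: (morphDN (gnabDr cD a)). Qed.

Lemma gnabZl f a s : nab (gsecZ f a) s = gsecZ f (nab a s).
Proof.
have nab0 : nab 0 s = 0 by exact: (morphD0 (fun a b => gnabDl cD a b s)).
by rewrite -[gsecZ f a]addr0 gnab_linear nab0 addr0.
Qed.

Definition gnabE := (gnabDl, gnabDr, gnabNl, gnabNr, gnabZl, gnabZr).

Lemma gcurv_anti a b : gcurv cD a b = - gcurv cD b a.
Proof.
apply: gend_ext => s; rewrite gappN !gcurvE (gbrN b a) gnabNl.
apply: gsec_inj => x; apply: vec_ext => i.
by rewrite !(gsecDE, gsecNE) !(vcoordD, vcoordN); ring.
Qed.

Lemma gcurv_linear f a b c :
  gcurv cD (gsecZ f a + b) c = gendZ f (gcurv cD a c) + gcurv cD b c.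
Proof.
apply: gend_ext => s; rewrite gappD gappZ !gcurvE gbrDl gbrZl !gnabE.
apply: gsec_inj => x; apply: vec_ext => i.
by rewrite !(gsecDE, gsecNE, gsecZE) !(vcoordD, vcoordN, vcoordZ); ring.
Qed.

Definition curv_cochain (s : seq (gsec A)) : gend E :=
  if s is [:: a; b] then gcurv cD a b else 0.

Lemma curv_cochain_degree s : size s != 2 -> curv_cochain s = 0.
Proof. by case: s => [|a [|b [|c s]]]. Qed.

(** On three sections everything cancels formally, except the derivatives along double brackets,
    which the Jacobi identity of the algebroid settles. *)
Lemma bianchi s : ced (@gbr _ _ A) (gact cD) curv_cochain s = 0.
Proof.
have [/eqP s3|s3] := boolP (size s == 3); last first.
  exact: (ced_degree _ (gactD cD) curv_cochain_degree).
case: s s3 => [//|a [//|b [//|c [|//]]]] _ /=.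
rewrite /lie /ctr /=; apply: gend_ext => s.
have j := gbr_jacobi a b c.
have {}j : nab (gbr a (gbr b c)) s =
    nab (gbr (gbr a b) c) s + nab (gbr b (gbr a c)) s.
  rewrite -gnabDl; congr (nab _ _); apply/eqP; rewrite -subr_eq0 opprD.
  have -> : - gbr (gbr a b) c = gbr c (gbr a b) by rewrite [RHS]gbrN.
  have -> : - gbr b (gbr a c) = gbr b (gbr c a) by rewrite -gbrNr -gbrN.
  by rewrite addrA addrAC j.
rewrite !(gappD, gappN, gactE, gcurvE, gapp0, gnabE) j.
apply: gsec_inj => x; apply: vec_ext => i.
by rewrite !(gsecDE, gsecNE, gsec0E) !(vcoordD, vcoordN, vcoord0); ring.
Qed.

End OneConnection.

Section TwoConnections.
Variables (D0 D1 : section A -> section E -> section E).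
Variables (c0 : is_connection D0) (c1 : is_connection D1).
Local Notation nab0 := (gnab c0).
Local Notation nab1 := (gnab c1).

Fact gdiff_tensor (a : gsec A) f (s s' : gsec E) :
  let T s := nab1 a s - nab0 a s in
  T (gsecZ f s + s') = gsecZ f (T s) + T s'.
Proof.
rewrite /= !gnabE; apply: gsec_inj => x; apply: vec_ext => i.
by rewrite !(gsecDE, gsecNE, gsecZE) !(vcoordD, vcoordN, vcoordZ); ring.
Qed.

Definition gdiff (a : gsec A) : gend E := sval (gend_of_tensor (gdiff_tensor a)).

Lemma gdiffE a s : gapp (gdiff a) s = nab1 a s - nab0 a s.
Proof. by rewrite /gdiff; case: gend_of_tensor => u /= ->. Qed.

Lemma gdiff_linear f a b : gdiff (gsecZ f a + b) = gendZ f (gdiff a) + gdiff b.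
Proof.
apply: gend_ext => s; rewrite gappD gappZ !gdiffE !gnabE.
apply: gsec_inj => x; apply: vec_ext => i.
by rewrite !(gsecDE, gsecNE, gsecZE) !(vcoordD, vcoordN, vcoordZ); ring.
Qed.

Definition conn_path (t : R) (a : section A) (s : section E) : section E :=
  fun x => (1 - t) *: D0 a s x + t *: D1 a s x.

Lemma conn_pathP t : is_connection (conn_path t).
Proof.
split.
- move=> a s sa ss.
  exact: (gsecP (gsecZ (sfun_cst M (1 - t)) (nab0 (GSec sa) (GSec ss)) +
                 gsecZ (sfun_cst M t) (nab1 (GSec sa) (GSec ss)))).
- move=> f a b s sf sa sb ss x; rewrite /conn_path.
  rewrite (conn_linear_l c0 sf sa sb ss) (conn_linear_l c1 sf sa sb ss).
  by apply: vec_ext => i; rewrite !(vcoordD, vcoordZ); ring.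
- move=> a s s' sa ss ss' x; rewrite /conn_path.
  rewrite (conn_add_r c0 sa ss ss') (conn_add_r c1 sa ss ss').
  by apply: vec_ext => i; rewrite !(vcoordD, vcoordZ); ring.
- move=> f a s sf sa ss x; rewrite /conn_path.
  rewrite (conn_leibniz c0 sf sa ss) (conn_leibniz c1 sf sa ss).
  by apply: vec_ext => i; rewrite !(vcoordD, vcoordZ); ring.
Qed.

Local Notation nabt t := (gnab (conn_pathP t)).
Local Notation cst := (sfun_cst M).

Lemma gnab_path t a s : nabt t a s = nab0 a s + gsecZ (cst t) (gapp (gdiff a) s).
Proof.
rewrite gdiffE; apply: gsec_inj => x; rewrite !(gsecDE, gsecNE, gsecZE).
rewrite -[LHS]/((1 - t) *: nab0 a s x + t *: nab1 a s x) /=.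
by apply: vec_ext => i; rewrite !(vcoordD, vcoordN, vcoordZ); ring.
Qed.

Definition diff_cochain (s : seq (gsec A)) : gend E :=
  if s is [:: a] then gdiff a else 0.

Lemma diff_cochain_degree s : size s != 1 -> diff_cochain s = 0.
Proof. by case: s => [|a [|b s]]. Qed.

(** The wedge square of theta, the difference of the two connections. *)
Definition diff_square (a b : gsec A) : gend E :=
  gend_comp (gdiff a) (gdiff b) - gend_comp (gdiff b) (gdiff a).

(** The coefficient of t in the curvature along the path, which is the covariant differential of
    theta for [c0]. This formula reads it off from the quadratic polynomial at t = 1. *)
Definition curv_linear_part (a b : gsec A) : gend E :=
  gcurv c1 a b - gcurv c0 a b - diff_square a b.

Lemma gcurv_path t a b : gcurv (conn_pathP t) a b =
  gcurv c0 a b + gendZ (cst t) (curv_linear_part a b)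
  + gendZ (cst (t ^+ 2)) (diff_square a b).
Proof.
apply: gend_ext => s; rewrite !(gappD, gappZ, gappN, gapp_comp, gcurvE).
rewrite !gnab_path !gnabE !(gapprZ, gappDr, gdiffE, gnabE) !grho_cst.
apply: gsec_inj => x; apply: vec_ext => i.
rewrite !(gsecDE, gsecNE, gsecZE, vcoordD, vcoordN, vcoordZ).
by rewrite -[sfun_fun 0 x]/(0 : R) /=; ring.
Qed.

Lemma ced_diff t a b : ced (@gbr _ _ A) (gact (conn_pathP t)) diff_cochain [:: a; b] =
  curv_linear_part a b + gendZ (cst (2 * t)) (diff_square a b).
Proof.
rewrite /= /lie /ctr /=; apply: gend_ext => s.
rewrite !(gappD, gappZ, gappN, gapp0, gapp_comp, gcurvE, gactE, gnab_path).
rewrite !(gapprZ, gappDr, gdiffE, gnabE).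
apply: gsec_inj => x; apply: vec_ext => i.
rewrite !(gsecDE, gsecNE, gsecZE, gsec0E, vcoordD, vcoordN, vcoordZ, vcoord0).
by rewrite /=; ring.
Qed.

End TwoConnections.
End Curvature.

(** * Forms and their wedge product *)

Section Multilinear.
Variables (R : realType).

Definition altmap (V W : lmodType R) k (w : ('I_k -> V) -> W) : Prop :=
  (forall v i (c : R) u u', w (upd v i (c *: u + u')) =
     c *: w (upd v i u) + w (upd v i u')) /\
  (forall v i j, i != j -> v i = v j -> w v = 0).

Lemma upd_id (T : Type) k (v : 'I_k -> T) i : upd v i (v i) = v.
Proof. by apply/funext => j; rewrite /upd; case: eqP => // ->. Qed.

(** Serves twice: for smoothness of forms, where [e] is a local frame, and for the degree bound,
    where [e] is a basis of a complement of B in a fibre. *)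
Lemma slot_induction (T J : Type) k (e : J -> T) (S : T -> Prop)
    (Q : ('I_k -> T) -> Prop) :
  (forall I : 'I_k -> J, Q (e \o I)) ->
  (forall v i u, S u -> (forall j, Q (upd v i (e j))) -> Q (upd v i u)) ->
  forall v, (forall i, S (v i)) -> Q v.
Proof.
move=> Qe Qu.
(* The slots from [m] on already hold members of [e]; the induction step converts one more slot. *)
suff H m v : (forall i : 'I_k, (i < m)%N -> S (v i)) ->
    (forall i : 'I_k, (m <= i)%N -> exists j, v i = e j) -> Q v.
  by move=> v Sv; apply: (H k) => // i; rewrite leqNgt ltn_ord.
elim: m v => [|m IH] v Sv ev.
  have /choice[I vI] : forall i, exists j, v i = e j by move=> i; exact: ev.
  by have -> : v = e \o I by exact/funext.
have [mk|km] := ltnP m k; last first.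
  apply: IH => i; first by move=> im; apply: Sv; rewrite ltnW.
  by move=> mi; have := leq_trans km mi; rewrite leqNgt ltn_ord.
rewrite -(upd_id v (Ordinal mk)); apply: Qu; first exact: Sv.
move=> j; apply: IH => i im; rewrite /upd; case: eqP => [ei|/eqP ne].
- by rewrite ei /= ltnn in im.
- by apply: Sv; rewrite ltnW.
- by exists j.
- apply: ev; rewrite ltn_neqAle im andbT; apply: contra ne => /eqP e'.
  exact/eqP/val_inj.
Qed.

Section AltMap.
Variables (V W : lmodType R) (k : nat) (w : ('I_k -> V) -> W).
Hypothesis wA : altmap w.

Lemma altmap_sum v i (J : Type) (r : seq J) (c : J -> R) (u : J -> V) :
  w (upd v i (\sum_(j <- r) c j *: u j)) = \sum_(j <- r) c j *: w (upd v i (u j)).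
Proof.
exact: (@lin_sum _ _ _ (fun x => w (upd v i x))) (fun c u u' => wA.1 v i c u u').
Qed.

Lemma altmapD v i u u' : w (upd v i (u + u')) = w (upd v i u) + w (upd v i u').
Proof. by have := wA.1 v i 1 u u'; rewrite !scale1r. Qed.

(** Polarization: expand the vanishing value with v_i + v_j in both slots. *)
Lemma altmap_tperm v i j : i != j -> w (v \o tperm i j) = - w v.
Proof.
move=> ij; pose f a b := w (upd (upd v i a) j b).
have fDl a a' b : f (a + a') b = f a b + f a' b.
  have C c : upd (upd v i c) j b = upd (upd v j b) i c.
    apply/funext => m; rewrite /upd.
    by have [->|//] := eqVneq m j; rewrite eq_sym (negPf ij).
  by rewrite /f !C altmapD.
have fDr a b b' : f a (b + b') = f a b + f a b' by exact: altmapD.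
have f0 a : f a a = 0.
  by apply: (wA.2 _ i j ij); rewrite /upd (negPf ij) !eqxx.
have fv : f (v i) (v j) = w v.
  rewrite /f upd_id; congr w; exact: upd_id.
have fs : f (v j) (v i) = w (v \o tperm i j).
  rewrite /f; congr w; apply/funext => m; rewrite /upd /=.
  case: tpermP => [->|->|/eqP/negPf -> /eqP/negPf ->//].
    by rewrite (negPf ij) eqxx.
  by rewrite eqxx.
have := f0 (v i + v j); rewrite fDl !fDr !f0 add0r addr0 fv fs addrC.
by move=> /eqP; rewrite addr_eq0 => /eqP.
Qed.

Lemma altmap_perm v (s : 'S_k) : w (v \o s) = sg (odd_perm s) (w v).
Proof.
have [ts -> dts] := prod_tpermP s.
elim: ts dts v => [|t ts IH] dts v.
  rewrite big_nil odd_perm1 /=; congr w; apply/funext => i.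
  by rewrite /= perm1.
move: dts => /= /andP[dt dts]; rewrite big_cons.
rewrite odd_mul_tperm dt -[in RHS](opprK (w v)).
have -> : v \o (tperm t.1 t.2 * \prod_(t0 <- ts) tperm t0.1 t0.2)%g =
    (v \o (\prod_(t0 <- ts) tperm t0.1 t0.2)%g) \o tperm t.1 t.2.
  by apply/funext => i; rewrite /= permM.
by rewrite altmap_tperm// IH//; case: odd_perm => /=; rewrite ?opprK.
Qed.

End AltMap.
End Multilinear.

(** * Smoothness of forms, on frames and on global sections *)

Section SmoothForms.
Variables (R : realType) (M : manifold R) (A : vbundle M).

Lemma alternatingP (V : M -> vectType R) k (w : form A V k) :
  alternating w <-> forall x, altmap (w x).
Proof.
split=> [[wl wa] x|wA].
  by split=> [v i c u u'|v i j ij vij]; [exact: wl|exact: wa ij vij].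
by split=> [x v i c u u'|x v i j ij vij]; [exact: (wA x).1|exact: (wA x).2 ij vij].
Qed.

Lemma secarg k (v : 'I_k -> section A) i (u : section A) x :
  (fun m => upd v i u m x) = upd (fun m => v m x) i (u x).
Proof. by apply/funext => m; rewrite /upd; case: eqP. Qed.

(* The arguments are replaced by combinations of the e_j one slot at a time. *)
Lemma smooth_slots k (U : set M) (f : forall x, ('I_k -> A x) -> R)
    (J : finType) (e : J -> section A) (S : section A -> Prop) :
  open U ->
  (forall x v i c u u', f x (upd v i (c *: u + u')) =
     c * f x (upd v i u) + f x (upd v i u')) ->
  (forall u, S u -> exists2 c : J -> M -> R, (forall j, smooth_on U (c j)) &
     forall x, U x -> u x = \sum_j c j x *: e j x) ->
  (forall I : 'I_k -> J, smooth_on U (fun x => f x (fun m => e (I m) x))) ->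
  forall v, (forall i, S (v i)) -> smooth_on U (fun x => f x (fun m => v m x)).
Proof.
move=> oU fl Sc fe.
apply: (slot_induction (e := e)) => [I|v i u Su Qe]; first exact: fe.
have [c sc uc] := Sc u Su.
apply: (@smooth_on_ext _ _ _
  (fun x => \sum_j c j x * f x (fun m => upd v i (e j) m x))) => //.
  move=> x; rewrite inE => Ux.
  rewrite [in RHS]secarg uc//.
  rewrite (@lin_sum R _ R^o (fun u => f x (upd (fun m => v m x) i u))); last exact: fl.
  by apply: eq_bigr => j _; rewrite secarg.
by apply: smooth_on_sum => // j _; exact: smooth_onM.
Qed.

Lemma smooth_slots_sections k (W : set M) (f : forall x, ('I_k -> A x) -> R) e :
  open W -> frames e ->
  (forall x v i c u u', f x (upd v i (c *: u + u')) =
     c * f x (upd v i u) + f x (upd v i u')) ->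
  (forall I : 'I_k -> 'I_(rank A), smooth_on (frame_dom e `&` W)
     (fun x => f x (fun m => tnth (frame_vec e x) (I m)))) ->
  forall a : 'I_k -> gsec A,
    smooth_on (frame_dom e `&` W) (fun x => f x (fun m => a m x)).
Proof.
move=> oW fe fl fI a.
have oU : open (frame_dom e `&` W) by apply: openI => //; exact: frame_open.
apply: (@smooth_slots k _ f _ (fun j x => tnth (frame_vec e x) j)
  (fun u => smooth_section u) oU fl _ fI a) => [u su|i]; last exact: gsecP.
exists (fun j x => coord (frame_vec e x) j (u x)).
  by move=> j; apply: smooth_on_sub (su e fe j) => x [].
move=> x [ex _]; rewrite {1}(coord_basis (frame_basis fe ex) (memvf (u x))).
by apply: eq_bigr => j _; rewrite (tnth_nth 0).
Qed.

(** Near a given point the frame vectors are the global sections [lf_vec] divided by the bump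
    function, so values on global sections control those on frames. *)
Lemma smooth_slots_frames k (W : set M) (f : forall x, ('I_k -> A x) -> R) :
  open W ->
  (forall x v i c u u', f x (upd v i (c *: u + u')) =
     c * f x (upd v i u) + f x (upd v i u')) ->
  (forall a : 'I_k -> gsec A, smooth_on W (fun x => f x (fun m => a m x))) ->
  forall e, frames e -> forall I : 'I_k -> 'I_(rank A),
    smooth_on (frame_dom e `&` W)
      (fun x => f x (fun m => tnth (frame_vec e x) (I m))).
Proof.
move=> oW fl fa e fe I; apply: smooth_on_local => x [ex Wx].
have [l le] := local_frame_exists fe ex.
pose U := W `&` [set y | lf_bump l y != 0].
have oU : open U by apply: openI => //; exact: nonzero_open (sfunP _).
have sb : smooth_on U (lf_bump l).
  exact: smooth_on_sub (@subsetT _ _) (sfunP (lf_bump l)).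
exists U; first by split; rewrite //= lf_bump1 oner_neq0.
pose S (u : section A) := exists j, u = fun y => tnth (frame_vec e y) j.
apply: (@smooth_slots k U f _ (fun j => gsec_fun (lf_vec l j)) S oU fl _ _
  (fun m y => tnth (frame_vec e y) (I m))) => [u [j ->]|I'|i]; last by exists (I i).
  exists (fun j' y => if j' == j then (lf_bump l y)^-1 else 0).
    move=> j'; case: eqP => _; last exact: smooth_on_cst.
    by apply: smooth_onV => // y [].
  move=> y [_ fy]; rewrite (bigD1 j)//= eqxx big1 ?addr0; last first.
    by move=> j' /negPf ->; rewrite scale0r.
  by rewrite lf_vecE le scalerA mulVf// scale1r.
by apply: smooth_on_sub (fa (lf_vec l \o I')) => y [].
Qed.

Lemma is_sform_smooth k (w : sform A k) : is_sform w ->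
  forall a : 'I_k -> gsec A, smooth_fun (fun x => w x (fun m => a m x)).
Proof.
move=> [[wl _] sw] a; apply: smooth_on_local => x _.
have [e fe ex] := frame_cover A x.
exists (frame_dom e `&` setT) => //; apply: smooth_slots_sections => //.
  exact: openT.
by rewrite setIT; exact: sw.
Qed.

Lemma is_sformP k (w : sform A k) : alternating w ->
  (forall a : 'I_k -> gsec A, smooth_fun (fun x => w x (fun m => a m x))) ->
  is_sform w.
Proof.
move=> wA sw; split => // e fe I; rewrite -[frame_dom e]setIT.
by apply: smooth_slots_frames => //; [exact: openT|exact: wA.1].
Qed.

End SmoothForms.

Section SmoothEndForms.
Variables (R : realType) (M : manifold R) (A : lie_algebroid M) (E : vbundle M).

Lemma end_coord_linear k (w : @endform R M A E k) : alternating w ->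
  forall x (h : 'I_(rank E)) (b : (rank E).-tuple (E x)) (u : E x) v i (c : R) t t',
  coord b h (w x (upd v i (c *: t + t')) u) =
  c * coord b h (w x (upd v i t) u) + coord b h (w x (upd v i t') u).
Proof.
move=> [wl _] x h b u v i c t t'.
by rewrite wl add_lfunE scale_lfunE linearD linearZ.
Qed.

Lemma is_endform_smooth k (w : @endform R M A E k) : is_endform w ->
  forall (a : 'I_k -> gsec A) (s : gsec E),
    smooth_section (fun x => w x (fun m => a m x) (s x)).
Proof.
move=> [wA sw] a s; apply: smooth_section_local => x.
have [e fe ex] := frame_cover A x; have [f ff fx] := frame_cover E x.
have oe := frame_open fe; have of_ := frame_open ff.
exists (frame_dom e `&` frame_dom f), f; split; [exact: openI|by []|by []| |].
  by move=> y [].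
move=> j; apply: (@smooth_on_ext _ _ _ (fun y => \sum_i coord (frame_vec f y) i (s y) *
   coord (frame_vec f y) j (w y (fun m => a m y) (tnth (frame_vec f y) i)))).
- exact: openI.
- move=> y; rewrite inE => -[ey fy].
  rewrite [in RHS](coord_basis (frame_basis ff fy) (memvf (s y))) !linear_sum.
  by apply: eq_bigr => i _; rewrite !linearZ (tnth_nth 0).
apply: smooth_on_sum => [|i _]; first exact: openI.
apply: smooth_onM; first exact: openI.
  by apply: smooth_on_sub (gsecP s ff i) => y [].
apply: (@smooth_slots_sections _ _ A k _
  (fun y v => coord (frame_vec f y) j (w y v (tnth (frame_vec f y) i)))) => //.
  by move=> *; apply: end_coord_linear.
by move=> I; exact: sw.
Qed.

Lemma is_endformP k (w : @endform R M A E k) : alternating w ->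
  (forall (a : 'I_k -> gsec A) (s : gsec E),
    smooth_section (fun x => w x (fun m => a m x) (s x))) ->
  is_endform w.
Proof.
move=> wA sw; split => // e f fe ff I i j.
apply: (@smooth_slots_frames _ _ A k _
  (fun y v => coord (frame_vec f y) j (w y v (tnth (frame_vec f y) i)))) => //.
- exact: frame_open.
- by move=> *; apply: end_coord_linear.
move=> a; apply: smooth_on_local => x fx.
have [l lf] := local_frame_exists ff fx.
pose U := [set y | lf_bump l y != 0].
have oU : open U by exact: nonzero_open (sfunP _).
have oUf : open (U `&` frame_dom f) by apply: openI => //; exact: frame_open.
exists (U `&` frame_dom f); first by split => //; rewrite /U /= lf_bump1 oner_neq0.
apply: (@smooth_on_ext _ _ _ (fun y => (lf_bump l y)^-1 *
  coord (frame_vec f y) j (w y (fun m => a m y) (lf_vec l i y)))) => //.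
  move=> y; rewrite inE => -[Uy fy].
  by rewrite lf_vecE lf !linearZ mulrA mulVf// mul1r.
apply: smooth_onM => //.
  apply: smooth_onV => //; first by move=> y [].
  exact: smooth_on_sub (@subsetT _ _) (sfunP (lf_bump l)).
by apply: smooth_on_sub (sw a (lf_vec l i) f ff j) => y [].
Qed.

End SmoothEndForms.

(** * Permutation sums and the recursive product *)

Section PermutationSums.
Variable R : realType.

Lemma lift_perm0_inj n : injective (fun p : 'I_n.+1 * 'S_n => lift_perm p.1 ord0 p.2).
Proof.
move=> [i s] [j t] /= /permP e.
have ij : i = j.
  apply/eqP; case: (unliftP i j) => [m jm|->//]; have := e j.
  by rewrite lift_perm_id jm lift_perm_lift => /(congr1 val).
subst j; congr pair; apply/permP => m; have := e (lift i m).
by rewrite !lift_perm_lift => /lift_inj.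
Qed.

(** Sorts the permutations by the index that they send to [ord0]. *)
Lemma sum_lift_perm (V : zmodType) n (F : 'S_n.+1 -> V) :
  \sum_s F s = \sum_i \sum_(s : 'S_n) F (lift_perm i ord0 s).
Proof.
rewrite pair_big /= (reindex (fun p : 'I_n.+1 * 'S_n => lift_perm p.1 ord0 p.2))//.
apply: onW_bij; apply: inj_card_bij; first exact: lift_perm0_inj.
by rewrite card_prod !card_Sn card_ord factS.
Qed.

Variables (U V W : lmodType R).

Definition permsum (X : Type) n (F : seq X -> W) (v : 'I_n -> X) : W :=
  \sum_(s : 'S_n) sg (odd_perm s) (F [seq v (s i) | i <- enum 'I_n]).

Lemma seq_ord (X : Type) n (x0 : X) (s : seq X) : size s = n ->
  [seq nth x0 s (i : 'I_n) | i <- enum 'I_n] = s.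
Proof.
move=> sn; apply: (@eq_from_nth _ x0); first by rewrite size_map size_enum_ord.
move=> i; rewrite size_map size_enum_ord => iN.
by rewrite (nth_map (Ordinal iN)) ?size_enum_ord// nth_enum_ord.
Qed.

Lemma nth_seq_ord (X : Type) n (x0 : X) (v : 'I_n -> X) (i : 'I_n) :
  nth x0 [seq v j | j <- enum 'I_n] i = v i.
Proof. by rewrite (nth_map i) ?size_enum_ord// nth_ord_enum. Qed.

Lemma map_enum_ordS (X : Type) n (v : 'I_n.+1 -> X) :
  [seq v i | i <- enum 'I_n.+1] =
  v ord0 :: [seq v (lift ord0 i) | i <- enum 'I_n].
Proof. by rewrite enum_ordSl /= -map_comp. Qed.

(** The index [i] is the position where [v ord0] lands; the sign of [lift_perm i ord0 s] is (-1)^i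
    times that of [s]. *)
Lemma permsum_rec (X : Type) n (F : seq X -> W) (v : 'I_n.+1 -> X) :
  permsum F v = \sum_(i < n.+1) sg (odd i)
    (permsum (fun t => F (take i t ++ v ord0 :: drop i t)) (v \o lift ord0)).
Proof.
rewrite /permsum sum_lift_perm; apply: eq_bigr => i _.
rewrite (big_morph _ (sgD (odd i)) (morphD0 (@sgD _ _))); apply: eq_bigr => s _.
rewrite odd_lift_perm /= addbF; set t := [seq _ | _ <- _]; set t' := map _ _.
have -> : t = take i t' ++ v ord0 :: drop i t'.
  have st' : size t' = n by rewrite size_map size_enum_ord.
  have iN : (i <= n)%N by rewrite -ltnS.
  apply: (@eq_from_nth _ (v ord0)).
    rewrite size_map size_enum_ord size_cat /= size_take size_drop st'.
    by case: ltnP => ni; lia.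
  move=> j; rewrite size_map size_enum_ord => jN.
  rewrite -[j]/(val (Ordinal jN)) nth_seq_ord nth_cat size_take st'.
  have -> : (if (i < n)%N then i : nat else n) = i by case: ltnP => //; lia.
  case: (unliftP i (Ordinal jN)) => [m em|em]; last first.
    by rewrite em lift_perm_id ltnn subnn.
  rewrite em lift_perm_lift -[val (lift i m)]/(bump i m) /bump.
  have [im|im] := leqP i m.
    rewrite ifF; last by apply/negbTE; rewrite -leqNgt; lia.
    have -> : (true + m - i = (m - i).+1)%N by lia.
    by rewrite /= nth_drop subnKC// nth_seq_ord.
  by rewrite add0n im nth_take// nth_seq_ord.
by case: (odd i); case: (odd_perm s) => //=; rewrite opprK.
Qed.

Lemma eq_permsum (X : Type) n (F F' : seq X -> W) (v : 'I_n -> X) :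
  (forall t, size t = n -> F t = F' t) -> permsum F v = permsum F' v.
Proof.
by move=> FF'; apply: eq_bigr => s _; rewrite FF'// size_map size_enum_ord.
Qed.

Lemma permsum_sg (X : Type) n b (F : seq X -> W) (v : 'I_n -> X) :
  permsum (fun t => sg b (F t)) v = sg b (permsum F v).
Proof.
rewrite (big_morph _ (sgD b) (morphD0 (@sgD _ _))); apply: eq_bigr => s _.
by case: b; case: odd_perm.
Qed.

Definition homog (X : Type) (Z : zmodType) k (w : seq X -> Z) :=
  forall s, size s != k -> w s = 0.

(** The form of alternation that fits [permsum_rec], where the first argument is inserted at
    position [i]. *)
Definition antisym (X : Type) (Z : zmodType) (w : seq X -> Z) :=
  forall a s i, (i <= size s)%N ->
    w (take i s ++ a :: drop i s) = sg (odd i) (w (a :: s)).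

Lemma homog_ctr (X : Type) (Z : zmodType) k (a : X) (w : seq X -> Z) :
  homog k.+1 w -> homog k (ctr a w).
Proof. by move=> hw s sk; apply: hw => /=; rewrite eqSS. Qed.

Lemma homog_ctr0 (X : Type) (Z : zmodType) (a : X) (w : seq X -> Z) :
  homog 0 w -> ctr a w = fun=> 0.
Proof. by move=> hw; apply/funext => s; exact: hw. Qed.

Lemma homog_parity (X : Type) (Z : zmodType) k (w : seq X -> Z) :
  homog k w -> parity (odd k) w.
Proof. by move=> hw s sk; apply: hw; apply: contra sk => /eqP ->. Qed.

Lemma antisym_ctr (X : Type) (Z : zmodType) (a : X) (w : seq X -> Z) :
  antisym w -> antisym (ctr a w).
Proof.
move=> aw b s i si; rewrite /ctr.
have := aw b (a :: s) i.+1 si; rewrite /= => ->.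
have := aw b (a :: s) 1%N isT; rewrite /= take0 drop0 /= => ->.
by rewrite /sg /=; case: odd; rewrite /= ?opprK.
Qed.

Lemma homog_shuf (X : Type) (m : U -> V -> W) k l (v : seq X -> U)
    (w : seq X -> V) : biadditive m ->
  homog k v -> homog l w -> homog (k + l)%N (shuf m v w).
Proof.
move=> B hv hw s; elim: s k l v w hv hw => [|a s IH] k l v w hv hw /= skl.
  case: k hv skl => [|k] hv; last by rewrite hv// (morphD0 (B.1 _)).
  by case: l hw => [//|l] hw; rewrite hw// (morphD0 (B.2 _)).
rewrite (parity_eps (homog_parity hv)) shuf_sgl//.
have -> : shuf m (ctr a v) w s = 0.
  case: k hv skl => [|k] hv skl; first by rewrite (homog_ctr0 a hv) shuf0l.
  by apply: (IH k l _ _ (homog_ctr a hv) hw); move: skl; rewrite addSn eqSS.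
have -> : shuf m v (ctr a w) s = 0.
  case: l hw skl => [|l] hw skl; first by rewrite (homog_ctr0 a hw) shuf0r.
  by apply: (IH k l _ _ hv (homog_ctr a hw)); move: skl; rewrite addnS eqSS.
by rewrite (morphD0 (@sgD _ _)) addr0.
Qed.

(** By [permsum_rec] the first argument is inserted at position i. For i < k it enters [v] and gives
    the term with [v] contracted, for i >= k it enters [w]. The cases occur k and l times, which
    turns (k-1)! l! and k! (l-1)! into k! l!. *)
Lemma permsum_shuf (X : Type) (m : U -> V -> W) k l n (v : seq X -> U)
    (w : seq X -> V) (x : 'I_n -> X) : biadditive m -> (k + l = n)%N ->
  homog k v -> homog l w -> antisym v -> antisym w ->
  permsum (fun t => m (v (take k t)) (w (drop k t))) x =
  (k`! * l`!)%:R *: shuf m v w [seq x i | i <- enum 'I_n].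
Proof.
move=> B; elim: n k l v w x => [|n IH] k l v w x kl hv hw av aw.
  move: kl => /eqP; rewrite addn_eq0 => /andP[/eqP -> /eqP ->].
  rewrite /permsum (big_pred1 1%g); last first.
    by move=> s /=; apply/esym/eqP/permP => -[].
  by rewrite odd_perm1 enum_ord0 /= scale1r.
rewrite permsum_rec map_enum_ordS /=; set a := x ord0; set y := x \o lift ord0.
pose T1 := shuf m (ctr a v) w [seq x (lift ord0 i) | i <- enum 'I_n].
pose T2 := shuf m v (ctr a w) [seq x (lift ord0 i) | i <- enum 'I_n].
have H (i : 'I_n.+1) : sg (odd i) (permsum (fun t =>
      m (v (take k (take i t ++ a :: drop i t)))
        (w (drop k (take i t ++ a :: drop i t)))) y) =
    if (i < k)%N then ((k.-1)`! * l`!)%:R *: T1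
    else sg (odd k) ((k`! * (l.-1)`!)%:R *: T2).
  have iN := ltn_ord i; case: ltnP => ik.
    case: k ik kl hv => // k ik kl hv; rewrite /= -(IH k l (ctr a v) w y)//.
    - apply: (canLR (sgK _)); rewrite -permsum_sg.
      apply: eq_permsum => t tn; rewrite take_cat size_take tn.
      have -> : (if (i < n)%N then i : nat else n) = i by case: ltnP => //; lia.
      rewrite ifF; last by apply/negbTE; lia.
      rewrite drop_cat size_take tn.
      have -> : (if (i < n)%N then i : nat else n) = i by case: ltnP => //; lia.
      rewrite ifF; last by apply/negbTE; lia.
      have -> : (k.+1 - i = (k - i).+1)%N by lia.
      rewrite /= drop_drop subnK//.
      have <- : take i (take k t) = take i t by rewrite take_takel//; lia.
      have -> : take (k - i) (drop i t) = drop i (take k t) by rewrite take_drop subnK.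
      rewrite av; last by rewrite size_take tn; case: ifP; lia.
      by rewrite -(morphD_sg _ (B.1 _)).
    - by lia.
    - exact: homog_ctr.
    - exact: antisym_ctr.
  case: l kl hw => [|l] kl hw; first by have := ltn_ord i; lia.
  rewrite /= -(IH k l v (ctr a w) y)//.
  - rewrite -!permsum_sg; apply: eq_permsum => t tn.
    have st : (if (i < n)%N then i : nat else n) = i by case: ltnP => //; lia.
    rewrite take_cat size_take tn st drop_cat size_take tn st.
    have takeE : take k (take i t) = take k t by rewrite take_takel.
    case: ltnP => ki.
      rewrite takeE; have <- : take (i - k) (drop k t) = drop k (take i t).
        by rewrite take_drop subnK.
      have <- : drop (i - k) (drop k t) = drop i t by rewrite drop_drop subnK.
      rewrite aw; last by rewrite size_drop tn; lia.
      rewrite (morphD_sg _ (B.2 _)) oddB//.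
      by case: (odd i); case: (odd k) => //=; rewrite ?opprK.
    have <- : i = k :> nat by lia.
    by rewrite subnn take0 drop0 cats0.
  - by lia.
  - exact: homog_ctr.
  - exact: antisym_ctr.
rewrite (eq_bigr _ (fun i _ => H i)) (bigID (fun i : 'I_n.+1 => i < k)%N) /=.
rewrite (eq_bigr (fun=> ((k.-1)`! * l`!)%:R *: T1)); last by move=> i ->.
rewrite [X in _ + X](eq_bigr (fun=> sg (odd k) ((k`! * (l.-1)`!)%:R *: T2))); last first.
  by move=> i /negbTE ->.
rewrite !sumr_const.
have c1 : #|[pred i : 'I_n.+1 | (i < k)%N]| = k.
  have kn : (k <= n.+1)%N by lia.
  rewrite -sum1_card (eq_bigl (fun i : 'I_n.+1 => (i < k)%N))//.
  by rewrite (big_ord_narrow kn) sum1_card card_ord.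
have c2 : #|[pred i : 'I_n.+1 | ~~ (i < k)%N]| = l.
  have := cardC [pred i : 'I_n.+1 | (i < k)%N]; rewrite c1 card_ord => e.
  have -> : #|[pred i : 'I_n.+1 | ~~ (i < k)%N]| =
      #|[predC [pred i : 'I_n.+1 | (i < k)%N]]| by exact: eq_card.
  by apply: (@addnI k); rewrite e kl.
rewrite c1 c2 (parity_eps (homog_parity hv)) shuf_sgl// -/T1 -/T2 scalerDr.
clear H IH; congr (_ + _).
  (* The truncated predecessor does no harm: for k = 0 both the count and [T1] are 0. *)
  case: k {c1 c2 kl av} hv @T1 @T2 => [|k] hv T1 T2.
    by rewrite /T1 (homog_ctr0 a hv) shuf0l// !scaler0 mul0rn.
  by rewrite -scaler_nat scalerA -natrM factS mulnA.
have main : ((k`! * (l.-1)`!)%:R *: T2) *+ l = (k`! * l`!)%:R *: T2.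
  case: l {c1 c2 kl aw} hw @T1 @T2 => [|l] hw T1 T2.
    by rewrite /T2 (homog_ctr0 a hw) shuf0r// !scaler0 mul0rn.
  by rewrite -scaler_nat scalerA -natrM factS mulnCA.
by case: (odd k); rewrite /= ?mulNrn ?scalerN main.
Qed.

End PermutationSums.

Section Hats.
Variable R : realType.

(** Extension by 0 to the other lengths gives forms of all degrees one common type. The default
    value of [nth] is never reached. *)
Definition hat (X W : zmodType) k (w : ('I_k -> X) -> W) (s : seq X) : W :=
  if size s == k then w (fun i => nth 0 s i) else 0.

Lemma hat_homog (X W : zmodType) k (w : ('I_k -> X) -> W) : homog k (hat w).
Proof. by move=> s /negPf; rewrite /hat => ->. Qed.

Lemma hat_seq (X W : zmodType) k (w : ('I_k -> X) -> W) (v : 'I_k -> X) :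
  hat w [seq v i | i <- enum 'I_k] = w v.
Proof.
rewrite /hat size_map size_enum_ord eqxx; congr w; apply/funext => i.
exact: nth_seq_ord.
Qed.

(** Moving the entry at position [i] to the front is the permutation [lift_perm i ord0 1], of sign
    (-1)^i. *)
Lemma hat_antisym (X W : lmodType R) k (w : ('I_k -> X) -> W) : altmap w ->
  antisym (hat w).
Proof.
move=> wA a s i si; rewrite /hat size_cat /= size_takel// size_drop.
have -> : (i + (size s - i).+1 = (size s).+1)%N by lia.
case: eqP => [sk|_]; last by rewrite (morphD0 (@sgD _ _)).
subst k; have iN : (i < (size s).+1)%N by [].
rewrite -[odd i]addbF -[odd i (+) false]/(odd (Ordinal iN) (+) odd (ord0 : 'I_(size s).+1)).
rewrite -[_ (+) _]addbF -[false in X in sg X](odd_perm1 'I_(size s)) -odd_lift_perm.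
rewrite -altmap_perm//; congr w; apply/funext => m /=.
case: (unliftP (Ordinal iN) m) => [m' ->|->]; last first.
  rewrite lift_perm_id nth_cat size_takel//=.
  by rewrite ltnn subnn.
rewrite lift_perm_lift perm1 nth_cat size_takel//=.
have [im|im] := leqP i m'.
  have -> : bump i m' = m'.+1 by rewrite /bump im.
  rewrite ltnNge (leqW im) /= subSn//= nth_drop subnKC//.
have -> : bump i m' = m' by rewrite /bump leqNgt im.
by rewrite im nth_take.
Qed.

Definition bilinear_op (U V W : lmodType R) (m : U -> V -> W) :=
  (forall k u u' v, m (k *: u + u') v = k *: m u v + m u' v) /\
  (forall k u v v', m u (k *: v + v') = k *: m u v + m u v').

Lemma bilinear_biadditive (U V W : lmodType R) (m : U -> V -> W) :
  bilinear_op m -> biadditive m.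
Proof.
move=> [ml mr]; split=> [v u u'|u v v'].
  by have := ml 1 u u' v; rewrite !scale1r.
by have := mr 1 u v v'; rewrite !scale1r.
Qed.

End Hats.

(** * The wedge product as a product of cochains *)

Section Wedge.
Variables (R : realType) (M : manifold R) (A U V W : M -> vectType R).
Variable m : forall x, U x -> V x -> W x.

(** Linearity holds term by term, as slot [i] is read by exactly one factor, at position s^-1 i. If
    two arguments are equal, composing with their transposition turns the sum into its opposite. *)
Lemma wedge_altmap k l (w : form A U k) (w' : form A V l) x :
  bilinear_op (@m x) -> altmap (w x) -> altmap (w' x) ->
  altmap (wedge m w w' (x := x)).
Proof.
move=> [ml mr] wA wA'; split.
  move=> v i c u u'; rewrite /wedge scalerA mulrC -scalerA -scalerDr; congr (_ *: _).
  rewrite scaler_sumr -big_split; apply: eq_bigr => s _ /=.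
  rewrite scalerA mulrC -scalerA -scalerDr; congr (_ *: _).
  have si (j : 'I_(k + l)) t : upd v i t (s j) = upd (v \o s) (s^-1 i)%g t j.
    by rewrite /upd (can2_eq (permK s) (permKV s)).
  have E1 t : (fun i0 => upd v i t (s (lshift l i0))) =
      (fun i0 => upd (v \o s) (s^-1 i)%g t (lshift l i0)) by apply/funext => ?.
  have E2 t : (fun i0 => upd v i t (s (rshift k i0))) =
      (fun i0 => upd (v \o s) (s^-1 i)%g t (rshift k i0)) by apply/funext => ?.
  rewrite !E1 !E2; case: (split_ordP (s^-1 i)%g) => j ->.
    have L t : (fun i0 => upd (v \o s) (lshift l j) t (lshift l i0)) =
        upd (fun i0 => v (s (lshift l i0))) j t.
      by apply/funext => i0; rewrite /upd /= (inj_eq (@lshift_inj _ _)).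
    have Q t : (fun i0 => upd (v \o s) (lshift l j) t (rshift k i0)) =
        (fun i0 => v (s (rshift k i0))).
      by apply/funext => i0; rewrite /upd /= eq_rlshift.
    by rewrite !L !Q wA.1 ml.
  have L t : (fun i0 => upd (v \o s) (rshift k j) t (rshift k i0)) =
      upd (fun i0 => v (s (rshift k i0))) j t.
    by apply/funext => i0; rewrite /upd /= (inj_eq (@rshift_inj _ _)).
  have Q t : (fun i0 => upd (v \o s) (rshift k j) t (lshift l i0)) =
      (fun i0 => v (s (lshift l i0))).
    by apply/funext => i0; rewrite /upd /= eq_lrshift.
  by rewrite !L !Q wA'.1 mr.
move=> v i j ij vij; rewrite /wedge; set S := \sum_s _.
suff -> : S = 0 by rewrite scaler0.
have S2 : S = - S.
  rewrite {1}/S (reindex_inj (mulIg (tperm i j))) /= /S -sumrN.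
  apply: eq_bigr => s _; rewrite odd_permM odd_tperm ij addbT -scaleNr.
  have vt n : v (tperm i j n) = v n.
    by case: tpermP => // ->.
  congr (_ *: m _ _).
  - by case: odd_perm; rewrite /= ?expr0 ?expr1 ?opprK.
  - by congr (w x); apply/funext => n; rewrite permM vt.
  - by congr (w' x); apply/funext => n; rewrite permM vt.
have : 2%:R *: S = 0 by rewrite scaler_nat mulr2n {1}S2 addNr.
by move/eqP; rewrite scaler_eq0 pnatr_eq0 /= => /eqP.
Qed.

(** The normalization of [wedge] cancels the multiplicity k! l! of [permsum_shuf]. *)
Lemma wedge_shuf k l (w : form A U k) (w' : form A V l) x (v : 'I_(k + l) -> A x) :
  bilinear_op (@m x) -> altmap (w x) -> altmap (w' x) ->
  wedge m w w' v =
  shuf (@m x) (hat (w x)) (hat (w' x)) [seq v i | i <- enum 'I_(k + l)].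
Proof.
move=> mB wA wA'; have B := bilinear_biadditive mB.
have fact0 : ((k`! * l`!)%:R : R) != 0.
  by rewrite pnatr_eq0 -lt0n muln_gt0 !fact_gt0.
rewrite -[RHS]scale1r -[1](mulVf fact0) -scalerA.
rewrite -(permsum_shuf v B erefl (hat_homog _) (hat_homog _)
  (hat_antisym wA) (hat_antisym wA')).
rewrite /wedge /permsum; congr (_ *: _); apply: eq_bigr => s _.
set t := [seq _ | _ <- _].
have st : size t = (k + l)%N by rewrite size_map size_enum_ord.
have -> : hat (w x) (take k t) = w x (fun i => v (s (lshift l i))).
  rewrite /hat size_take st.
  have -> : (if (k < k + l)%N then k else (k + l)%N) = k by case: ltnP => //; lia.
  rewrite eqxx; congr (w x); apply/funext => i.
  by rewrite nth_take// -[i : nat]/(lshift l i : nat) nth_seq_ord.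
have -> : hat (w' x) (drop k t) = w' x (fun i => v (s (rshift k i))).
  rewrite /hat size_drop st addKn eqxx; congr (w' x); apply/funext => i.
  by rewrite nth_drop -[(k + i)%N]/(rshift k i : nat) nth_seq_ord.
by case: odd_perm; rewrite /= ?expr0 ?expr1 ?scale1r ?scaleN1r.
Qed.

Lemma hat_wedge k l (w : form A U k) (w' : form A V l) x :
  bilinear_op (@m x) -> altmap (w x) -> altmap (w' x) ->
  hat (wedge m w w' (x := x)) = shuf (@m x) (hat (w x)) (hat (w' x)).
Proof.
move=> mB wA wA'; apply/funext => s.
have [skl|skl] := eqVneq (size s) (k + l)%N; last first.
  rewrite hat_homog// (homog_shuf (bilinear_biadditive mB) (hat_homog _) (hat_homog _))//.
by rewrite -(seq_ord 0 skl) hat_seq wedge_shuf// (seq_ord 0 skl).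
Qed.

End Wedge.

Section InhomogeneousForms.
Variables (R : realType) (M : manifold R) (A : lie_algebroid M).

Definition that (w : tform A) x (s : seq (A x)) : R :=
  w (size s) x (fun i => nth 0 s i).

Lemma that_ord (w : tform A) x n (v : 'I_n -> A x) :
  that w [seq v i | i <- enum 'I_n] = w n x v.
Proof.
rewrite /that.
(* The degree read off from the sequence equals [n] only propositionally; as a variable it can be
   substituted. *)
suff H n' (e : n' = n) (f : 'I_n' -> A x) : (forall i, f i = v (cast_ord e i)) ->
    w n' x f = w n x v.
  have e : size [seq v i | i <- enum 'I_n] = n by rewrite size_map size_enum_ord.
  by apply: (H _ e) => i; rewrite -[i : nat]/(cast_ord e i : nat) nth_seq_ord.
subst n'; move=> fv; congr (w n x); apply/funext => i; rewrite fv.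
by congr v; apply: val_inj.
Qed.

Lemma that_hat (w : tform A) x (s : seq (A x)) :
  that w s = hat (W := R^o) (w (size s) x) s.
Proof. by rewrite /hat eqxx. Qed.

Lemma that_homogeneous l (w : sform A l) x :
  that (homogeneous w) (x := x) = hat (W := R^o) (w x).
Proof.
apply/funext => s; rewrite /that /homogeneous /hat.
case: eqP => [e|ne]; last by rewrite eq_sym (introF eqP ne).
by subst l; rewrite eqxx; congr (w x).
Qed.

Fact mulr_bilinear : bilinear_op (fun r s : R^o => r * s : R^o).
Proof.
by split=> k u v v' /=; rewrite ?mulrDl ?mulrDr /GRing.scale /= ?mulrA// [u * k]mulrC.
Qed.

Lemma shuf_suml (G J : Type) (U V W : zmodType) (m : U -> V -> W) (r : seq J)
    (v : J -> seq G -> U) (w : seq G -> V) s : biadditive m ->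
  shuf m (fun t => \sum_(j <- r) v j t) w s = \sum_(j <- r) shuf m (v j) w s.
Proof.
move=> B; elim: r => [|j r IH].
  rewrite big_nil -[RHS](shuf0l B w s); congr (shuf m _ w s).
  by apply/funext => t; rewrite big_nil.
rewrite big_cons -IH -(shufDl B); congr (shuf m _ w s).
by apply/funext => t; rewrite big_cons.
Qed.

Lemma shuf_sumr (G J : Type) (U V W : zmodType) (m : U -> V -> W) (r : seq J)
    (v : seq G -> U) (w : J -> seq G -> V) s : biadditive m ->
  shuf m v (fun t => \sum_(j <- r) w j t) s = \sum_(j <- r) shuf m v (w j) s.
Proof.
move=> B; elim: r => [|j r IH].
  rewrite big_nil -[RHS](shuf0r B v s); congr (shuf m v _ s).
  by apply/funext => t; rewrite big_nil.
rewrite big_cons -IH -(shufDr B); congr (shuf m v _ s).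
by apply/funext => t; rewrite big_cons.
Qed.

Lemma eq_shuf (G : Type) (U V W : zmodType) (m : U -> V -> W)
    (v v' : seq G -> U) (w w' : seq G -> V) s :
  (forall t, (size t <= size s)%N -> v t = v' t) ->
  (forall t, (size t <= size s)%N -> w t = w' t) ->
  shuf m v w s = shuf m v' w' s.
Proof.
elim: s v v' w w' => [|a s IH] v v' w w' vv ww /=; first by rewrite vv ?ww.
congr (_ + _); apply: IH => t ts; rewrite /ctr /eps ?vv ?ww//; exact: leqW.
Qed.

(** On sequences of length at most n both forms are finite sums of their components of degree at
    most n, and by degree only the pairs (i, n - i) contribute at length n. *)
Lemma that_tmul (w w' : tform A) x :
  (forall k, altmap (W := R^o) (w k x)) -> (forall k, altmap (W := R^o) (w' k x)) ->
  that (tmul w w') (x := x) =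
  shuf (fun r s : R^o => r * s) (that w (x := x)) (that w' (x := x)).
Proof.
move=> wA wA'; have B := bilinear_biadditive mulr_bilinear.
apply/funext => s; pose n := size s.
have D (u : tform A) t : (size t <= n)%N ->
    that u t = \sum_(i < n.+1) hat (W := R^o) (u i x) t.
  move=> tn; rewrite that_hat (bigD1 (Ordinal (tn : (size t < n.+1)%N)))//=.
  rewrite big1 ?addr0// => i /eqP ne; apply: hat_homog; apply/eqP => e.
  by apply: ne; exact: val_inj.
rewrite (eq_shuf _ (D w) (D w')) (shuf_suml _ _ _ _ B).
rewrite /that /tmul -/n; apply: eq_bigr => i _.
rewrite (shuf_sumr _ _ _ _ B) (bigD1 (rev_ord i))//= subSS big1 ?addr0; last first.
  move=> j /eqP ji; apply: (homog_shuf B (hat_homog _) (hat_homog _)).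
  apply/eqP => e; apply: ji; apply: val_inj => /=.
  by rewrite subSS -[size s]/n in e *; lia.
rewrite wedge_shuf//; last exact: mulr_bilinear.
congr shuf; rewrite -[RHS](seq_ord 0 (erefl n)).
set e := subnKC _.
have sn : size [seq ((fun i0 : 'I_n => nth 0 s i0) \o cast_ord e) j |
    j <- enum 'I_(i + (n - i))] = n.
  by rewrite size_map size_enum_ord e.
apply: (@eq_from_nth _ 0) => [|j]; first by rewrite sn size_map size_enum_ord.
rewrite sn => jn; rewrite -{2}[j]/(val (Ordinal jn)) nth_seq_ord.
have jn' : (j < i + (n - i))%N by rewrite e.
by rewrite -{1}[j]/(val (Ordinal jn')) nth_seq_ord.
Qed.

End InhomogeneousForms.

(** * Forms as cochains on global sections *)

Lemma shuf_premap (G H : Type) (f : G -> H) (U V W : zmodType) (m : U -> V -> W)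
    (v : seq H -> U) (w : seq H -> V) s :
  shuf m (v \o map f) (w \o map f) s = shuf m v w (map f s).
Proof.
elim: s v w => [//|a s IH] v w /=.
have -> : eps (v \o map f) = eps v \o map f.
  by apply/funext => t; rewrite /eps /= size_map.
by rewrite -!IH.
Qed.

Lemma eq_hat_map (X Y Z : zmodType) k (w : ('I_k -> Y) -> Z) (f : X -> Y) s :
  hat w (map f s) = if size s == k then w (fun i => f (nth 0 s i)) else 0.
Proof.
rewrite /hat size_map; case: eqP => // sk; congr w; apply/funext => i.
by rewrite (nth_map 0)// sk.
Qed.

(** * The recursive differential as a Koszul formula *)

Section KoszulFormula.
Variables (G : Type) (br : G -> G -> G) (V : zmodType) (act : G -> V -> V).

Lemma brsum_enum k b (w : seq G -> V) (c : 'I_k -> G) :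
  brsum br b w [seq c m | m <- enum 'I_k] =
  \sum_(j < k) w [seq (if m == j then br b (c m) else c m) | m <- enum 'I_k].
Proof.
elim: k w c => [|k IH] w c; first by rewrite enum_ord0 big_ord0.
rewrite map_enum_ordS /= IH big_ord_recl; congr (_ + _).
  by rewrite map_enum_ordS eqxx; congr (w (_ :: _)); exact: eq_map.
apply: eq_bigr => j _; rewrite map_enum_ordS (negPf (neq_lift _ _)).
by congr (w (_ :: _)); apply: eq_map => m; rewrite (inj_eq lift_inj).
Qed.

(** Each step of Cartan's recursion contracts with one more section and changes the sign. After i
    steps it contributes the Lie derivative along a_i, whose brackets involve later sections only,
    each in its own slot; this is the shape of [is_differential]. *)
Lemma ced_enum k (w : seq G -> V) (a : 'I_k.+1 -> G) :
  ced br act w [seq a i | i <- enum 'I_k.+1] =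
  \sum_(i < k.+1) sg (odd i)
    (act (a i) (w [seq a (lift i m) | m <- enum 'I_k]) -
     \sum_(j < k.+1 | (i < j)%N)
       w [seq (if lift i m == j then br (a i) (a j) else a (lift i m)) |
            m <- enum 'I_k]).
Proof.
elim: k w a => [|k IH] w a.
  rewrite map_enum_ordS /= big_ord1 /= /lie !enum_ord0 /= subr0.
  by rewrite big_pred0// => j; rewrite ord1.
rewrite map_enum_ordS [LHS]/= IH [in RHS]big_ord_recl; congr (_ + _).
  rewrite /= /lie brsum_enum [in RHS]big_mkcond [in RHS]big_ord_recl /= add0r.
  congr (_ - _).
  apply: eq_bigr => j _; congr w; apply: eq_map => m.
  by rewrite (inj_eq lift_inj); case: eqP => // ->.
rewrite -sumrN; apply: eq_bigr => i _ /=.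
have lift2 (m : 'I_k) : lift (lift ord0 i) (lift ord0 m) = lift ord0 (lift i m).
  by apply: val_inj; rewrite /= /bump /=; case: leqP; case: leqP; lia.
have lift20 : lift (lift ord0 i) ord0 = ord0 :> 'I_k.+2 by apply: val_inj.
have -> (x : V) : sg (odd (bump 0 i)) x = - sg (odd i) x.
  by rewrite /bump /=; case: odd; rewrite /= ?opprK.
congr (- sg _ (_ - _)).
  rewrite /ctr map_enum_ordS lift20; congr (act _ (w (_ :: _))).
  by apply: eq_map => m; rewrite lift2.
rewrite [RHS]big_mkcond big_ord_recl /= add0r -big_mkcond.
apply: eq_big => [j|j ij]; first by rewrite /= /bump /= !add1n ltnS.
rewrite /ctr map_enum_ordS lift20; congr (w (_ :: _)).
apply: eq_map => m; rewrite lift2 (inj_eq lift_inj)//.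
Qed.

End KoszulFormula.

Section FormsAsCochains.
Variables (R : realType) (M : manifold R) (A : lie_algebroid M).
Implicit Types (w eta : tform A).

Fact ghat_smooth w : is_tform w ->
  forall s : seq (gsec A), smooth_fun (fun x => that w [seq (a : gsec A) x | a <- s]).
Proof.
move=> hw s; have := is_sform_smooth (hw (size s)) (fun i => nth 0 s i).
rewrite (_ : (fun x => _) = (fun x => that w [seq (a : gsec A) x | a <- s]))//.
apply/funext => x; rewrite -that_ord; congr (that w _).
by rewrite -[in RHS](seq_ord 0 (erefl (size s))) -[RHS]map_comp.
Qed.

Definition ghat w (hw : is_tform w) (s : seq (gsec A)) : sfun M :=
  SFun (ghat_smooth hw s).

Lemma ghat_ord w (hw : is_tform w) k (a : 'I_k -> gsec A) x :
  ghat hw [seq a i | i <- enum 'I_k] x = w k x (fun i => a i x).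
Proof. by rewrite -(that_ord w (fun i => a i x)) /= -[in LHS]map_comp. Qed.

(** Closedness and exactness enter the recursive calculus through this equivalence; [ced_enum] makes
    the two formulas coincide. *)
Lemma is_tdifferentialP w eta (hw : is_tform w) (he : is_tform eta) :
  is_tdifferential w eta <->
  forall s, ced (@gbr _ _ A) (@grho _ _ A) (ghat hw) s = ghat he s.
Proof.
have K k (a : 'I_k.+1 -> gsec A) x :
    ced (@gbr _ _ A) (@grho _ _ A) (ghat hw) [seq a i | i <- enum 'I_k.+1] x =
    \sum_(i < k.+1) (-1) ^+ i *
      (anchor (a i x) (fun y => w k y (fun m => a (lift i m) y)) -
       \sum_(j < k.+1 | (i < j)%N) w k x (bracket_args (fun i => gsec_fun (a i)) i j x)).
  rewrite ced_enum sfun_sumE; apply: eq_bigr => i _.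
  have -> (f : sfun M) : sg (odd i) f x = (-1) ^+ i * f x.
    by rewrite -signr_odd; case: odd; rewrite /= ?expr1 ?expr0 ?mulN1r ?mul1r.
  rewrite sfunDE sfunNE sfun_sumE; congr (_ * (_ - _)).
    congr (anchor _ _); apply/funext => y; exact: ghat_ord.
  apply: eq_bigr => j _.
  rewrite (ghat_ord hw (fun m =>
    if lift i m == j then gbr (a i) (a j) else a (lift i m))).
  by congr (w k x); apply/funext => m; rewrite /bracket_args; case: eqP.
split.
  move=> [e0 ek] s; apply: sfun_inj => x.
  case: s => [|a s]; first by rewrite /= /that e0.
  have ss : size (a :: s) = (size s).+1 by [].
  rewrite -(seq_ord 0 ss) K ghat_ord; apply/esym; apply: ek => i; exact: gsecP.
move=> H; split.
  (* The empty sequence carries the condition that [eta] has no component of degree 0. *)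
  move=> x v; have := congr1 (fun f : sfun M => f x) (H [::]).
  move=> /esym e0; apply: etrans e0; congr (eta 0%N x).
  by apply/funext => -[].
move=> k a sa x; pose b i := GSec (sa i).
by rewrite -(ghat_ord he b) -H K.
Qed.

Lemma is_tform0 : is_tform (tzero A).
Proof.
move=> k; apply: is_sformP; first by split => // x v i c u u'; rewrite /tzero scaler0 addr0.
by move=> a; exact: (smooth_on_cst setT (0 : R)).
Qed.

Lemma closed_formP w (hw : is_tform w) : closed_form w <->
  forall s, ced (@gbr _ _ A) (@grho _ _ A) (ghat hw) s = 0.
Proof.
have z s : ghat is_tform0 s = 0 by apply: sfun_inj.
split=> [[_ /(is_tdifferentialP hw is_tform0) dw] s|dw]; first by rewrite dw z.
by split => //; apply/(is_tdifferentialP hw is_tform0) => s; rewrite dw z.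
Qed.

End FormsAsCochains.

(** * Closed forms and the algebra structure of cohomology *)

Section FormAlgebra.
Variables (R : realType) (M : manifold R) (A : lie_algebroid M).
Implicit Types (w eta : tform A).
Local Notation d := (ced (@gbr _ _ A) (@grho _ _ A)).
Local Notation mul := (@sfun_mul R M).

Lemma sfun_mul_biadditive : biadditive mul.
Proof.
by split=> f g h; apply: sfun_inj => x /=; rewrite ?mulrDl ?mulrDr.
Qed.

Lemma is_tform_altmap w : is_tform w -> forall k x, altmap (W := R^o) (w k x).
Proof. by move=> hw k x; have [/alternatingP wA _] := hw k. Qed.

Lemma is_tformP w : (forall k x, altmap (W := R^o) (w k x)) ->
  (forall k (a : 'I_k -> gsec A), smooth_fun (fun x => w k x (fun i => a i x))) ->
  is_tform w.
Proof. by move=> wA sw k; apply: is_sformP => //; apply/alternatingP. Qed.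

Lemma is_tform_tadd w eta : is_tform w -> is_tform eta -> is_tform (tadd w eta).
Proof.
move=> hw he; apply: is_tformP => [k x|k a].
  have [wl wa] := is_tform_altmap hw k x; have [el ea] := is_tform_altmap he k x.
  split=> [v i c u u'|v i j ij vij]; rewrite /tadd.
    by rewrite wl el scalerDr addrACA.
  by rewrite (wa v i j)// (ea v i j)// addr0.
exact: (sfunP (SFun (is_sform_smooth (hw k) a) + SFun (is_sform_smooth (he k) a))).
Qed.

Lemma is_tform_tscale c w : is_tform w -> is_tform (tscale c w).
Proof.
move=> hw; apply: is_tformP => [k x|k a].
  have [wl wa] := is_tform_altmap hw k x.
  split=> [v i c' u u'|v i j ij vij]; rewrite /tscale.
    by rewrite wl mulrDr /GRing.scale /= mulrCA.
  by rewrite (wa v i j)// mulr0.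
exact: (sfunP (sfun_mul (sfun_cst M c) (SFun (is_sform_smooth (hw k) a)))).
Qed.

Definition teps w : tform A := fun k x v => (-1) ^+ k * w k x v.

Lemma is_tform_teps w : is_tform w -> is_tform (teps w).
Proof.
move=> hw; apply: is_tformP => [k x|k a].
  by have [+ _] := is_tform_tscale ((-1) ^+ k) hw k; move/alternatingP; apply.
exact: (is_sform_smooth (is_tform_tscale ((-1) ^+ k) hw k)).
Qed.

Lemma is_tform_tone : is_tform (tone A).
Proof.
apply: is_tformP => [k x|k a]; last exact: (smooth_on_cst setT ((k == 0%N)%:R : R)).
case: k => [|k]; first by split=> v [].
by split=> [v i c u u'|//]; rewrite /tone /= scaler0 addr0.
Qed.

Lemma is_tform_homogeneous l (w : sform A l) : is_sform w -> is_tform (homogeneous w).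
Proof.
move=> hw k; rewrite /homogeneous; case: eqP => [e|_]; last exact: (is_tform0 A k).
subst k; suff -> : (fun x (v : 'I_l -> A x) => w x (v \o cast_ord (erefl l))) = w by [].
apply: functional_extensionality_dep => x; apply/funext => v.
by congr (w x); apply/funext => i; congr v; apply: val_inj.
Qed.

Lemma ghat_tadd w eta (hw : is_tform w) (he : is_tform eta)
    (h : is_tform (tadd w eta)) s : ghat h s = ghat hw s + ghat he s.
Proof. by apply: sfun_inj. Qed.

Lemma ghat_teps w (hw : is_tform w) (h : is_tform (teps w)) : ghat h = eps (ghat hw).
Proof.
apply/funext => s; apply: sfun_inj => x.
transitivity ((-1) ^+ size s * ghat hw s x).
  by rewrite /= /that /teps {1}size_map.
by rewrite -signr_odd /eps; case: odd; rewrite /= ?expr1 ?mulN1r ?expr0 ?mul1r.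
Qed.

Lemma tmul_altmap w eta k x : is_tform w -> is_tform eta ->
  altmap (W := R^o) (tmul w eta (k := k) (x := x)).
Proof.
move=> hw he.
have H (i : 'I_k.+1) := wedge_altmap (m := fun _ (r s : R^o) => r * s : R^o)
  (mulr_bilinear R) (is_tform_altmap hw i x) (is_tform_altmap he (k - i) x).
split=> [v i c u u'|v i j ij vij].
  rewrite /tmul scaler_sumr -big_split; apply: eq_bigr => n _ /=.
  set e := subnKC _.
  have updE t : upd v i t \o cast_ord e = upd (v \o cast_ord e) (cast_ord (esym e) i) t.
    apply/funext => m; rewrite /upd /= -(inj_eq (@cast_ord_inj _ _ (esym e))).
    by rewrite cast_ordK.
  by rewrite !updE (H n).1.
rewrite /tmul big1// => n _; set e := subnKC _.
apply: ((H n).2 _ (cast_ord (esym e) i) (cast_ord (esym e) j)) => /=.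
  by rewrite (inj_eq (@cast_ord_inj _ _ _)).
by rewrite !cast_ordKV.
Qed.

Lemma that_tmul_ghat w eta (hw : is_tform w) (he : is_tform eta) (s : seq (gsec A)) x :
  that (tmul w eta) [seq (a : gsec A) x | a <- s] = shuf mul (ghat hw) (ghat he) s x.
Proof.
rewrite (that_tmul (fun k => is_tform_altmap hw k x) (fun k => is_tform_altmap he k x)).
rewrite (shuf_map (m' := fun r s : R^o => r * s : R^o) (f := fun f : sfun M => f x : R^o)
  (g := fun f : sfun M => f x : R^o) (h := fun f : sfun M => f x : R^o))//.
by rewrite -shuf_premap.
Qed.

Lemma is_tform_tmul w eta : is_tform w -> is_tform eta -> is_tform (tmul w eta).
Proof.
move=> hw he; apply: is_tformP => [k x|k a]; first exact: tmul_altmap.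
have := sfunP (shuf mul (ghat hw) (ghat he) [seq a i | i <- enum 'I_k]).
congr smooth_on; apply/funext => x.
by rewrite -that_tmul_ghat -[in LHS]map_comp that_ord.
Qed.

Lemma ghat_tmul w eta (hw : is_tform w) (he : is_tform eta)
    (h : is_tform (tmul w eta)) : ghat h = shuf mul (ghat hw) (ghat he).
Proof. by apply/funext => s; apply: sfun_inj => x; exact: that_tmul_ghat. Qed.

Lemma sfun_mul_cstD c : {morph mul (sfun_cst M c) : f g / f + g}.
Proof. by move=> f g; exact: sfun_mul_biadditive.2. Qed.

Lemma d_tscale c (v : seq (gsec A) -> sfun M) s :
  d (fun s => mul (sfun_cst M c) (v s)) s = mul (sfun_cst M c) (d v s).
Proof.
apply/esym; apply: (@ced_map _ _ _ _ _ _ (mul (sfun_cst M c))); first exact: sfun_mul_cstD.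
move=> a f; rewrite grhoM grho_cst.
by apply: sfun_inj => x; rewrite /= mul0r add0r.
Qed.

Lemma d_mul (v w : seq (gsec A) -> sfun M) s :
  d (shuf mul v w) s = shuf mul (d v) w s + shuf mul (eps v) (d w) s.
Proof.
apply: ced_shuf; [exact: sfun_mul_biadditive|exact: grhoD..|exact: grhoM].
Qed.

Lemma dD (v w : seq (gsec A) -> sfun M) s : d (v \+ w) s = d v s + d w s.
Proof. exact: (cedD _ (@grhoD _ _ A)). Qed.

Lemma cohomologousP w w' (hw : is_tform w) (hw' : is_tform w') :
  cohomologous w w' <-> exists eta (he : is_tform eta),
    forall s, d (ghat he) s = ghat hw s - ghat hw' s.
Proof.
have hN := is_tform_tscale (-1) hw'; have hB := is_tform_tadd hw hN.
have E s : ghat hB s = ghat hw s - ghat hw' s.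
  by apply: sfun_inj => x; rewrite /= /that /tadd /tscale mulN1r.
split=> [[eta he /(is_tdifferentialP he hB) H]|[eta [he H]]].
  by exists eta, he => s; rewrite H E.
by exists eta => //; apply/(is_tdifferentialP he hB) => s; rewrite H E.
Qed.

Lemma d0 s : d (fun=> 0) s = 0.
Proof.
have z f : mul (sfun_cst M 0) f = 0 by apply: sfun_inj => x; rewrite /= mul0r.
rewrite -[RHS](z (d (fun=> 0) s)) -d_tscale.
by congr ced; apply/funext => t; rewrite z.
Qed.

Lemma cohomologous_refl w : is_tform w -> cohomologous w w.
Proof.
move=> hw; apply/(cohomologousP hw hw); exists (tzero A), (is_tform0 A) => s.
rewrite subrr -[RHS](d0 s); congr ced; apply/funext => t.
by apply: sfun_inj.
Qed.

Lemma cohomologous_comb w1 w2 w3 w4 c : is_tform w1 -> is_tform w2 ->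
  is_tform w3 -> is_tform w4 -> cohomologous w1 w2 -> cohomologous w3 w4 ->
  cohomologous (tadd (tscale c w1) w3) (tadd (tscale c w2) w4).
Proof.
move=> h1 h2 h3 h4 /(cohomologousP h1 h2)[e [he e12]] /(cohomologousP h3 h4)[f [hf f34]].
have g1 := is_tform_tadd (is_tform_tscale c h1) h3.
have g2 := is_tform_tadd (is_tform_tscale c h2) h4.
apply/(cohomologousP g1 g2).
exists (tadd (tscale c e) f), (is_tform_tadd (is_tform_tscale c he) hf) => s.
transitivity (mul (sfun_cst M c) (d (ghat he) s) + d (ghat hf) s).
  by rewrite -d_tscale -dD; congr ced; apply/funext => t; apply: sfun_inj.
rewrite e12 f34; apply: sfun_inj => x /=; rewrite /that /tadd /tscale; ring.
Qed.

(** Pairs with the same difference share their primitives. Transitivity and symmetry follow from it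
    and from [cohomologous_comb] with coefficients 1 and -1. *)
Lemma cohomologous_eq w1 w2 w3 w4 : is_tform w1 -> is_tform w2 ->
  is_tform w3 -> is_tform w4 ->
  (forall k x v, w1 k x v - w2 k x v = w3 k x v - w4 k x v) ->
  cohomologous w1 w2 -> cohomologous w3 w4.
Proof.
move=> h1 h2 h3 h4 e /(cohomologousP h1 h2)[f [hf f12]].
apply/(cohomologousP h3 h4); exists f, hf => s; rewrite f12.
by apply: sfun_inj => x; exact: e.
Qed.

Lemma cohomologous_trans w1 w2 w3 : is_tform w1 -> is_tform w2 -> is_tform w3 ->
  cohomologous w1 w2 -> cohomologous w2 w3 -> cohomologous w1 w3.
Proof.
move=> h1 h2 h3 c12 c23.
apply: cohomologous_eq (cohomologous_comb 1 h1 h2 h2 h3 c12 c23) => //.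
- by apply: is_tform_tadd => //; exact: is_tform_tscale.
- by apply: is_tform_tadd => //; exact: is_tform_tscale.
by move=> k x v; rewrite /tadd /tscale; ring.
Qed.

Lemma cohomologous_sym w1 w2 : is_tform w1 -> is_tform w2 ->
  cohomologous w1 w2 -> cohomologous w2 w1.
Proof.
move=> h1 h2 c12.
apply: cohomologous_eq (cohomologous_comb (-1) h1 h2 h1 h1 c12 (cohomologous_refl h1)) => //.
- by apply: is_tform_tadd => //; exact: is_tform_tscale.
- by apply: is_tform_tadd => //; exact: is_tform_tscale.
by move=> k x v; rewrite /tadd /tscale; ring.
Qed.

Lemma coh_class_eq w1 w2 : is_tform w1 -> is_tform w2 ->
  cohomologous w1 w2 -> coh_class w1 = coh_class w2.
Proof.
move=> h1 h2 c12; apply/seteqP; split=> w [hw c]; split => //.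
  exact: (cohomologous_trans hw h1 h2).
by apply: (cohomologous_trans hw h2 h1) => //; exact: cohomologous_sym.
Qed.

Lemma coh_class_inj w1 w2 : is_tform w1 -> coh_class w1 = coh_class w2 ->
  cohomologous w1 w2.
Proof.
move=> h1 e; have : coh_class w1 w1 by split => //; exact: cohomologous_refl.
by rewrite e => -[].
Qed.

Lemma closed_tmul w1 w2 : closed_form w1 -> closed_form w2 -> closed_form (tmul w1 w2).
Proof.
move=> [h1 c1] [h2 c2]; apply/(closed_formP (is_tform_tmul h1 h2)) => s.
have {}c1 : d (ghat h1) = fun=> 0 by apply/funext; apply/closed_formP.
have {}c2 : d (ghat h2) = fun=> 0 by apply/funext; apply/closed_formP.
rewrite ghat_tmul d_mul c1 c2 (shuf0l sfun_mul_biadditive).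
by rewrite (shuf0r sfun_mul_biadditive) addr0.
Qed.

Lemma closed_comb c w1 w2 : closed_form w1 -> closed_form w2 ->
  closed_form (tadd (tscale c w1) w2).
Proof.
move=> [h1 c1] [h2 c2].
apply/(closed_formP (is_tform_tadd (is_tform_tscale c h1) h2)) => s.
have {}c1 : d (ghat h1) = fun=> 0 by apply/funext; apply/closed_formP.
have {}c2 : d (ghat h2) = fun=> 0 by apply/funext; apply/closed_formP.
transitivity (mul (sfun_cst M c) (d (ghat h1) s) + d (ghat h2) s).
  by rewrite -d_tscale -dD; congr ced; apply/funext => t; apply: sfun_inj.
by rewrite c1 c2; apply: sfun_inj => x; rewrite /= mulr0 addr0.
Qed.

Lemma closed_tone : closed_form (tone A).
Proof.
apply/(closed_formP is_tform_tone) => s.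
have h0 t : size t != 0%N -> ghat is_tform_tone t = 0.
  by move=> t0; apply: sfun_inj => x; rewrite /= /that /tone size_map (negPf t0).
have [/eqP s1|s1] := boolP (size s == 1%N); last first.
  exact: (ced_degree _ (@grhoD _ _ A) h0).
case: s s1 => [//|a [|//]] _; rewrite /= /lie /= !subr0.
rewrite (_ : ghat _ _ = sfun_cst M 1) ?grho_cst//.
by apply: sfun_inj.
Qed.

Lemma cohomologous_tmul w0 w1 v0 v1 : closed_form w0 -> closed_form w1 ->
  closed_form v0 -> closed_form v1 ->
  cohomologous w1 w0 -> cohomologous v1 v0 ->
  cohomologous (tmul w1 v1) (tmul w0 v0).
Proof.
move=> [hw0 cw0] [hw1 cw1] [hv0 cv0] [hv1 cv1].
move=> /(cohomologousP hw1 hw0)[e [he e10]] /(cohomologousP hv1 hv0)[f [hf f10]].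
have hw := is_tform_tmul hw1 hv1; have hv := is_tform_tmul hw0 hv0.
have h1 := is_tform_tmul he hv1; have hE := is_tform_teps hw0.
have h2 := is_tform_tmul hE hf.
apply/(cohomologousP hw hv).
(* From w1 v1 - w0 v0 = (w1 - w0) v1 + w0 (v1 - v0). The Leibniz rule puts [eps] on the left factor,
   and [teps] compensates for it. *)
exists (tadd (tmul e v1) (tmul (teps w0) f)), (is_tform_tadd h1 h2) => s.
rewrite [ghat _](_ : _ = ghat h1 \+ ghat h2); last first.
  by apply/funext => t; exact: ghat_tadd.
have B := sfun_mul_biadditive.
have {}cw0 : d (ghat hw0) = fun=> 0 by apply/funext; apply/closed_formP.
have {}cv1 : d (ghat hv1) = fun=> 0 by apply/funext; apply/closed_formP.
have dE : d (ghat hE) = fun=> 0.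
  apply/funext => t; rewrite (ghat_teps hw0) (ced_eps _ (@grhoD _ _ A)) cw0.
  by rewrite /eps /sg /=; case: odd; rewrite ?oppr0.
rewrite dD !ghat_tmul !d_mul cv1 dE (shuf0l B) (shuf0r B) addr0 add0r.
rewrite (ghat_teps hw0) epsK.
have -> : d (ghat he) = ghat hw1 \+ \- ghat hw0 by apply/funext.
have -> : d (ghat hf) = ghat hv1 \+ \- ghat hv0 by apply/funext.
rewrite (shufDl B) (shufDr B) (shufNl B) (shufNr B) addrA subrK//.
Qed.

End FormAlgebra.

(** * Endomorphism-valued forms and traces of curvature powers *)

Section EndFormsAsCochains.
Variables (R : realType) (M : manifold R) (A : lie_algebroid M) (E : vbundle M).

Definition fib_comp x : 'End(E x) -> 'End(E x) -> 'End(E x) := fun g h => (g \o h)%VF.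

Lemma fib_comp_bilinear x : bilinear_op (@fib_comp x).
Proof.
split=> k u v w; apply/lfunP => z.
  by rewrite /fib_comp !(comp_lfunE, add_lfunE, scale_lfunE).
by rewrite /fib_comp !(comp_lfunE, add_lfunE, scale_lfunE) linearD linearZ.
Qed.

Local Notation EE := (fun x => 'End(E x) : vectType R).

Definition ewedge k l (w : @endform R M A E k) (w' : @endform R M A E l) :
    @endform R M A E (k + l)%N :=
  wedge (W := fun x => 'End(E x) : vectType R) fib_comp w w'.

Fact ghatE_smooth k (w : @endform R M A E k) : is_endform w ->
  forall (s : seq (gsec A)) (t : gsec E),
  smooth_section (fun x => hat (w x) [seq (a : gsec A) x | a <- s] (t x)).
Proof.
move=> hw s t; have [sk|sk] := eqVneq (size s) k.
  have := is_endform_smooth hw (fun i => nth 0 s i) t.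
  congr smooth_section; apply: functional_extensionality_dep => x.
  by rewrite eq_hat_map sk eqxx.
have := gsecP (0 : gsec E); congr smooth_section.
apply: functional_extensionality_dep => x.
by rewrite eq_hat_map (negPf sk) zero_lfunE.
Qed.

Definition ghatE k (w : @endform R M A E k) (hw : is_endform w) (s : seq (gsec A)) :
  gend E := GEnd (ghatE_smooth hw s).

Lemma is_endform_altmap k (w : @endform R M A E k) : is_endform w ->
  forall x, altmap (w x).
Proof. by case=> /alternatingP. Qed.

Lemma ghatE_ord k (w : @endform R M A E k) (hw : is_endform w) (a : 'I_k -> gsec A) x :
  ghatE hw [seq a i | i <- enum 'I_k] x = w x (fun i => a i x).
Proof. by rewrite /= -[in LHS]map_comp hat_seq. Qed.

Lemma hat_ewedge_ghatE k l (w : @endform R M A E k) (w' : @endform R M A E l)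
    (hw : is_endform w) (hw' : is_endform w') (s : seq (gsec A)) x :
  hat (ewedge w w' (x := x)) [seq (a : gsec A) x | a <- s] =
  shuf (@gend_comp _ _ E) (ghatE hw) (ghatE hw') s x.
Proof.
have aw := is_endform_altmap hw x; have aw' := is_endform_altmap hw' x.
rewrite /ewedge (@hat_wedge R M A EE EE EE fib_comp k l w w' x (fib_comp_bilinear x) aw aw').
rewrite (shuf_map (m' := @fib_comp x) (f := fun t : gend E => t x)
  (g := fun t : gend E => t x) (h := fun t : gend E => t x))//.
by rewrite -shuf_premap.
Qed.

Lemma is_endform_ewedge k l (w : @endform R M A E k) (w' : @endform R M A E l) :
  is_endform w -> is_endform w' -> is_endform (ewedge w w').
Proof.
move=> hw hw'; apply: is_endformP.
  apply/alternatingP => x.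
  apply: (@wedge_altmap R M A EE EE EE fib_comp); first exact: fib_comp_bilinear.
    exact: is_endform_altmap.
  exact: is_endform_altmap.
move=> a s.
have := gendP (shuf (@gend_comp _ _ E) (ghatE hw) (ghatE hw')
  [seq a i | i <- enum 'I_(k + l)%N]) s.
congr smooth_section; apply: functional_extensionality_dep => x.
by rewrite -hat_ewedge_ghatE -[in LHS]map_comp hat_seq.
Qed.

Lemma ghatE_ewedge k l (w : @endform R M A E k) (w' : @endform R M A E l)
    (hw : is_endform w) (hw' : is_endform w') (h : is_endform (ewedge w w')) :
  ghatE h = shuf (@gend_comp _ _ E) (ghatE hw) (ghatE hw').
Proof.
by apply/funext => s; apply: gend_inj => x; exact: hat_ewedge_ghatE.
Qed.

Lemma is_endform_exp (w : @endform R M A E 2) n :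
  is_endform w -> is_endform (@endform_exp R M A E w n).
Proof.
move=> hw; elim: n => [|n IH]; last exact: (is_endform_ewedge hw IH).
apply: is_endformP; first by split => [x v []|x v []].
move=> a s; have := gsecP s; congr smooth_section.
by apply: functional_extensionality_dep => x; rewrite id_lfunE.
Qed.

Section CochainPowers.
Variables (G : Type) (U : zmodType) (m : U -> U -> U) (e : U).

Definition cunit (s : seq G) : U := if s is [::] then e else 0.

Fixpoint cpow (r : seq G -> U) n : seq G -> U :=
  if n is n'.+1 then shuf m r (cpow r n') else cunit.

Hypotheses (mB : biadditive m) (me : left_id e m) (em : right_id e m).
Hypothesis mA : associative m.

Lemma shuf_cunitr w : shuf m w cunit = w.
Proof.
apply/funext => s; elim: s w => [|a s IH] w /=; first exact: em.
by rewrite -[ctr a cunit]/(fun=> 0 : U) (shuf0r mB) addr0 IH.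
Qed.

Lemma shuf_cunit w : shuf m cunit w = w.
Proof.
apply/funext => s; elim: s w => [|a s IH] w /=; first exact: me.
have -> : ctr a cunit = fun=> 0 by [].
have -> : eps cunit = cunit.
  by apply/funext => -[//|b t]; rewrite /eps /cunit (morphD0 (@sgD _ _)).
by rewrite (shuf0l mB) add0r IH.
Qed.

Lemma cpowD r n k : shuf m (cpow r n) (cpow r k) = cpow r (n + k)%N.
Proof.
elim: n => [|n IH]; first exact: shuf_cunit.
rewrite addSn /= -IH; apply/funext => s.
by apply: shufA => // *; rewrite mA.
Qed.

Lemma cpow_parity r n : parity false r -> parity false (cpow r n).
Proof.
move=> pr; elim: n => [|n IH]; first by case.
exact: (parity_shuf mB pr IH).
Qed.

(** Differentiating the n + 1 factors in turn gives terms that agree under the trace by cyclicity;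
    [r] is even, so no signs appear. *)
Lemma tr_cpow_derivation (T : zmodType) (tr : U -> T) (de : U -> U) r n :
  {morph tr : x y / x + y} -> (forall u v, tr (m u v) = tr (m v u)) ->
  {morph de : x y / x + y} -> (forall u v, de (m u v) = m (de u) v + m u (de v)) ->
  de e = 0 -> parity false r ->
  forall s, tr (de (cpow r n.+1 s)) = tr (shuf m (de \o r) (cpow r n) s) *+ n.+1.
Proof.
move=> trD trC deD deM de1 pr.
have dpow k t : de (cpow r k.+1 t) =
    shuf m (de \o r) (cpow r k) t + shuf m r (de \o cpow r k) t.
  exact: shuf_derivation.
have pd : parity false (de \o r) by move=> s sp /=; rewrite pr// (morphD0 deD).
have pdc k : parity false (de \o cpow r k).
  by move=> s sp; rewrite /= cpow_parity// (morphD0 deD).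
have sA u v w t : shuf m (shuf m u v) w t = shuf m u (shuf m v w) t.
  by apply: shufA => // *; rewrite mA.
have cyc u v t : parity false u -> parity false v ->
    tr (shuf m u v t) = tr (shuf m v u t).
  by move=> pu pv; rewrite (shuf_cyclic (m' := m) (tr' := tr) (p := false) (q := false)).
(* The exponent [k] counts the undifferentiated factors gathered on the left while the power on the
   right is peeled off. *)
have H j k s : tr (shuf m (cpow r k) (de \o cpow r j) s) =
    tr (shuf m (de \o r) (cpow r (j.-1 + k)%N) s) *+ j.
  elim: j k s => [|j IH] k s.
    have -> : de \o cpow r 0 = fun=> 0.
      by apply/funext => -[|a t] /=; rewrite ?de1// (morphD0 deD).
    by rewrite (shuf0r mB) (morphD0 trD) mulr0n.
  have -> : de \o cpow r j.+1 =
      shuf m (de \o r) (cpow r j) \+ shuf m r (de \o cpow r j).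
    by apply/funext => t; exact: dpow.
  rewrite (shufDr mB) trD [in RHS]mulrS; congr (_ + _).
    rewrite cyc; [|exact: cpow_parity|exact: (parity_shuf mB pd (cpow_parity _ pr))].
    by rewrite sA cpowD.
  rewrite -sA -{2}(shuf_cunitr r) -[shuf m r cunit]/(cpow r 1) cpowD addn1 IH.
  case: j {IH} => [|j]; first by rewrite !mulr0n.
  by have -> : (j.+1.-1 + k.+1 = j.+2.-1 + k)%N by lia.
by move=> s; have := H n.+1 0%N s; rewrite addn0 -[cpow r 0]/cunit shuf_cunit.
Qed.

End CochainPowers.

Lemma cpow_map (G : Type) (U V : zmodType) (m : U -> U -> U) (m' : V -> V -> V) e e'
    (h : U -> V) (r : seq G -> U) n :
  {morph h : x y / x + y} -> (forall u u', h (m u u') = m' (h u) (h u')) ->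
  h e = e' -> h \o cpow m e r n = cpow m' e' (h \o r) n.
Proof.
move=> hD hm he; elim: n => [|n IH].
  by apply/funext => -[|a s] //=; exact: morphD0.
by apply/funext => s /=; rewrite (shuf_map (m' := m') (f := h) (g := h))// IH.
Qed.

Local Notation gpow := (cpow (@gend_comp _ _ E) (gend_id E)).

Lemma ghatE_exp (w : @endform R M A E 2) n (hw : is_endform w)
    (h : is_endform (@endform_exp R M A E w n)) : ghatE h = gpow (ghatE hw) n.
Proof.
elim: n h => [|n IH] h.
  apply/funext => s; apply: gend_inj => x /=; rewrite /hat size_map.
  by case: s.
by rewrite (ghatE_ewedge hw (is_endform_exp n hw) h) IH.
Qed.

Lemma lfun_tr0 (V : vectType R) : lfun_tr (0 : 'End(V)) = 0.
Proof.
by have := lfun_tr_linear (-1) (0 : 'End(V)) 0; rewrite scaler0 addr0 mulN1r addNr.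
Qed.

Lemma is_sform_endform_tr k (w : @endform R M A E k) : is_endform w ->
  is_sform (endform_tr w).
Proof.
move=> hw; apply: is_sformP.
  apply/alternatingP => x; have [wl wa] := is_endform_altmap hw x.
  split=> [v i c u u'|v i j ij vij]; rewrite /endform_tr.
    by rewrite wl lfun_tr_linear.
  by rewrite (wa v i j)// lfun_tr0.
move=> a; have := sfunP (gtr (ghatE hw [seq a i | i <- enum 'I_k])).
by congr smooth_on; apply/funext => x; rewrite /endform_tr -(ghatE_ord hw a).
Qed.

Lemma ghat_endform_tr k (w : @endform R M A E k) (hw : is_endform w)
    (h : is_tform (homogeneous (endform_tr w))) : ghat h = @gtr _ _ E \o ghatE hw.
Proof.
apply/funext => s; apply: sfun_inj => x; rewrite /= that_homogeneous /hat.
by case: eqP => // _; rewrite lfun_tr0.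
Qed.

Section CurvatureForms.
Variables (D : section A -> section E -> section E) (cD : is_connection D).

Lemma ghatE_curvature (w : @endform R M A E 2) (hw : is_endform w) :
  is_curvature_form D w -> ghatE hw = curv_cochain cD.
Proof.
move=> [_ wD]; apply/funext => s; have [s2|s2] := eqVneq (size s) 2; last first.
  rewrite curv_cochain_degree//; apply: gend_inj => x.
  by rewrite /= eq_hat_map (negPf s2).
case: s s2 => [//|a [//|b [|//]]] _; apply: gend_ext => t.
apply: gsec_inj => x.
rewrite -[LHS]/(hat (w x) [seq (c : gsec A) x | c <- [:: a; b]] (t x)) eq_hat_map.
pose ab (i : 'I_2) : section A := gsec_fun (nth 0 [:: a; b] i).
have sab i : smooth_section (ab i) by exact: gsecP.
rewrite -[LHS]/(w x (fun i => ab i x) (t x)) (wD _ _ sab (gsecP t)).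
by rewrite -[RHS]/(gapp (gcurv cD a b) t x) gcurvE.
Qed.

Lemma gcurv_local (a b a' b' : gsec A) x : a x = a' x -> b x = b' x ->
  gcurv cD a b x = gcurv cD a' b' x.
Proof.
have L c (u u' : gsec A) : u x = u' x -> gcurv cD u c x = gcurv cD u' c x.
  apply: (@tensor_local _ _ _ x _ (fun u => gcurv cD u c x)) => f s t.
  by rewrite gcurv_linear.
move=> aa bb; rewrite (L _ _ _ aa) gcurv_anti [in RHS]gcurv_anti.
by rewrite -[LHS]/(- gcurv cD b a' x) (L _ _ _ bb).
Qed.

(** Supplies a curvature form for the given connection: [gext] makes it linear on fibres, and
    [gcurv_local] frees it from the choice of extensions. *)
Definition curv_form : @endform R M A E 2 :=
  fun x v => gcurv cD (gext x (v ord0)) (gext x (v ord_max)) x.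

Lemma curv_form_endform : is_endform curv_form.
Proof.
have lin1 x c u u' v : gcurv cD (gext x (c *: u + u')) v x =
    c *: gcurv cD (gext x u) v x + gcurv cD (gext x u') v x.
  by rewrite gext_linear gcurv_linear.
have antix u v x : gcurv cD u v x = - gcurv cD v u x by rewrite gcurv_anti.
apply: is_endformP; last first.
  move=> a s; have := gendP (gcurv cD (a ord0) (a ord_max)) s.
  congr smooth_section; apply: functional_extensionality_dep => x.
  rewrite /curv_form (@gcurv_local _ _ (a ord0) (a ord_max)) ?gextE//.
apply/alternatingP => x; split=> [v i c u u'|v i j ij vij]; rewrite /curv_form.
  have [->|ne] := eqVneq i ord0; first by rewrite /upd /= lin1.
  have -> : i = ord_max by apply: val_inj; case: i ne => -[|[|]].
  by rewrite /upd /= 3![gcurv _ (gext x (v _)) _ _]antix lin1 opprD scalerN.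
have I2 (n : 'I_2) : n = ord0 \/ n = ord_max.
  by case: n => -[|[|//]] n2; [left|right]; exact: val_inj.
have -> : v ord_max = v ord0.
  by case: (I2 i) (I2 j) ij vij => -> [] -> //; rewrite eqxx.
set z := gcurv _ _ _ _; have z2 : z = - z by rewrite {1}/z antix.
have : 2%:R *: z = 0 by rewrite scaler_nat mulr2n {1}z2 addNr.
by move/eqP; rewrite scaler_eq0 pnatr_eq0 /= => /eqP.
Qed.

Lemma curv_formP : is_curvature_form D curv_form.
Proof.
split; first exact: curv_form_endform.
move=> a s sa ss x; pose b i := GSec (sa i).
have -> : curv_form (fun i => a i x) = gcurv cD (b ord0) (b ord_max) x.
  by apply: gcurv_local; rewrite gextE.
by rewrite -[LHS]/(gapp (gcurv cD (b ord0) (b ord_max)) (GSec ss) x) gcurvE.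
Qed.

Lemma ced_curv_pow n s :
  ced (@gbr _ _ A) (gact cD) (gpow (curv_cochain cD) n) s = 0.
Proof.
have B := gend_comp_biadditive E.
elim: n s => [|n IH] s.
  have h0 (t : seq (gsec A)) : size t != 0%N -> cunit (gend_id E) t = 0 by case: t.
  have [/eqP s1|s1] := boolP (size s == 1%N); last first.
    exact: (ced_degree _ (gactD cD) h0).
  case: s s1 => [//|a [|//]] _; rewrite /= /lie /= !subr0; exact: gact_id.
rewrite /= (@ced_shuf _ _ _ _ _ _ (gact cD) (gact cD))//; try exact: gactD.
- have -> : ced (@gbr _ _ A) (gact cD) (curv_cochain cD) = fun=> 0.
    by apply/funext => t; exact: bianchi.
  have -> : ced (@gbr _ _ A) (gact cD) (gpow (curv_cochain cD) n) = fun=> 0.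
    by apply/funext => t; exact: IH.
  by rewrite (shuf0l B) (shuf0r B) addr0.
- exact: gact_comp.
Qed.

(** By [gtr_act] the trace carries the covariant differential to d, and powers of the curvature are
    covariantly closed. *)
Lemma closed_tr_exp (w : @endform R M A E 2) n : is_curvature_form D w ->
  closed_form (homogeneous (endform_tr (@endform_exp R M A E w n))).
Proof.
move=> cw; have hw := cw.1; have he := is_endform_exp n hw.
have ht := is_tform_homogeneous (is_sform_endform_tr he).
apply/(closed_formP ht) => s.
rewrite (ghat_endform_tr he) (ghatE_exp hw) (ghatE_curvature _ cw).
rewrite -(@ced_map _ _ _ _ (gact cD) _ (@gtr _ _ E)).
- by rewrite ced_curv_pow; exact: (morphD0 (@gtrD _ _ E)).
- exact: gtrD.
- by move=> a v; exact: gtr_act.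
Qed.

End CurvatureForms.
End EndFormsAsCochains.

(** * Independence of the connection *)

Section Quadrature.
Variable R : realType.

(** Exact integration of p' over [0, 1] from its values at 0, ..., N - 1: the weights solve the
    Vandermonde system whose right-hand side consists of the moments 1/(m+1) of the monomials. *)
Lemma quadrature N : exists c : 'I_N -> R, forall p : {poly R}, (size p <= N.+1)%N ->
  \sum_(j < N) c j * p^`().[j%:R] = p.[1] - p.[0].
Proof.
pose a : 'rV[R]_N := \row_j j%:R.
pose V := Vandermonde N a.
have Vu : V \in unitmx.
  rewrite unitmxE det_Vandermonde unitfE prodf_seq_neq0; apply/allP => i _ /=.
  rewrite prodf_seq_neq0; apply/allP => j _; apply/implyP => ij.
  by rewrite !mxE subr_eq0 eqr_nat neq_ltn ij orbT.
pose b : 'cV[R]_N := \col_m m.+1%:R^-1.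
pose c := invmx V *m b.
have Vc (m : 'I_N) : \sum_j c j 0 * j%:R ^+ m = m.+1%:R^-1 :> R.
  have := congr1 (fun u : 'cV[R]_N => u m 0) (mulKVmx Vu b).
  rewrite -/c !mxE => <-; apply: eq_bigr => j _.
  by rewrite !mxE mulrC.
exists (fun j => c j 0) => p sp.
have sdp : (size p^`() <= N)%N.
  have [->|p_neq0] := eqVneq p 0; first by rewrite deriv0 size_poly0.
  by rewrite -ltnS (leq_trans (lt_size_deriv p_neq0)).
have -> : p.[1] - p.[0] = \sum_(m < N) p`_m.+1.
  rewrite (horner_coef_wide _ sp) big_ord_recl expr0 mulr1 horner_coef0 addrAC subrr add0r.
  by apply: eq_bigr => m _; rewrite expr1n mulr1.
rewrite (eq_bigr (fun j => \sum_(m < N) p`_m.+1 *+ m.+1 * (c j 0 * j%:R ^+ m))); last first.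
  move=> j _; rewrite (horner_coef_wide _ sdp) mulr_sumr; apply: eq_bigr => m _.
  by rewrite coef_deriv mulrCA.
rewrite exchange_big; apply: eq_bigr => m _ /=.
by rewrite -mulr_sumr Vc -[_ *+ _]mulr_natr mulfK// pnatr_eq0.
Qed.

End Quadrature.

(** * Quadratic paths of matrix cochains *)

Section PolynomialPath.
Variables (R : realType) (r : nat) (G : Type).
Local Notation pow S := (cpow (@mulmx S r r r) 1%:M).

Fact mulmx_biadditive (S : nzRingType) m n p : biadditive (@mulmx S m n p).
Proof. by split=> u v w; rewrite ?mulmxDl ?mulmxDr. Qed.

Definition mxdeg d (u : 'M[{poly R}]_r) := forall i j, (size (u i j) <= d.+1)%N.

Lemma mxdegD d u v : mxdeg d u -> mxdeg d v -> mxdeg d (u + v).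
Proof.
move=> du dv i j; rewrite mxE (leq_trans (size_polyD _ _))// geq_max.
by rewrite du dv.
Qed.

Lemma mxdeg_sg d b u : mxdeg d u -> mxdeg d (sg b u).
Proof. by case: b => // du i j; rewrite mxE size_polyN. Qed.

Lemma mxdegM d e u v : mxdeg d u -> mxdeg e v -> mxdeg (d + e)%N (u *m v).
Proof.
move=> du dv i j; rewrite mxE; apply: (leq_trans (size_sum _ _ _)).
apply/bigmax_leqP => k _; apply: (leq_trans (size_polyMleq _ _)).
by rewrite -subn1 leq_subLR add1n -addnS -addSn leq_add.
Qed.

Lemma mxdeg_shuf d e (u v : seq G -> 'M[{poly R}]_r) :
  (forall s, mxdeg d (u s)) -> (forall s, mxdeg e (v s)) ->
  forall s, mxdeg (d + e)%N (shuf (@mulmx _ r r r) u v s).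
Proof.
move=> du dv s; elim: s u v du dv => [|a s IH] u v du dv /=; first exact: mxdegM.
apply: mxdegD; apply: IH => // t; first exact: du.
  exact: mxdeg_sg.
exact: dv.
Qed.

Variables a0 a1 a2 : seq G -> 'M[R]_r.
Hypotheses (p0 : parity false a0) (p1 : parity false a1) (p2 : parity false a2).

Definition mxpath (t : R) s := a0 s + t *: a1 s + t ^+ 2 *: a2 s.

Definition mxpath_deriv (t : R) s := a1 s + (2 * t) *: a2 s.

(* With the parameter as an indeterminate, the derivative in the parameter is a
   derivation of the ring of matrices. *)
Lemma tr_mxpath_pow n s : exists2 p : {poly R}, (size p <= (2 * n.+1).+1)%N &
  forall t, p.[t] = \tr (pow R (mxpath t) n.+1 s) /\
    p^`().[t] = \tr (shuf (@mulmx R r r r) (mxpath_deriv t) (pow R (mxpath t) n) s) *+ n.+1.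
Proof.
pose C (u : 'M[R]_r) : 'M[{poly R}]_r := map_mx polyC u.
pose P s := C (a0 s) + 'X *: C (a1 s) + 'X^2 *: C (a2 s).
pose de : 'M[{poly R}]_r -> 'M[{poly R}]_r := map_mx (@deriv R).
pose hev t : 'M[{poly R}]_r -> 'M[R]_r := map_mx (horner_eval t).
have deD : {morph de : u v / u + v} by move=> u v; apply/matrixP => i j; rewrite !mxE derivD.
have hevD t : {morph hev t : u v / u + v}.
  by move=> u v; apply/matrixP => i j; rewrite !mxE /horner_eval hornerD.
have deM u v : de (u *m v) = de u *m v + u *m de v.
  apply/matrixP => i j; rewrite !mxE linear_sum -big_split; apply: eq_bigr => k _ /=.
  by rewrite derivM !mxE.
have hevM t u v : hev t (u *m v) = hev t u *m hev t v.
  apply/matrixP => i j; rewrite !mxE /horner_eval horner_sum.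
  by apply: eq_bigr => k _; rewrite hornerM !mxE.
have hev1 t : hev t 1%:M = 1%:M.
  apply/matrixP => i j; rewrite !mxE /horner_eval; case: eqP => _;
    by rewrite ?mulr1n ?mulr0n ?hornerC ?horner0.
have de1 : de 1%:M = 0.
  by apply/matrixP => i j; rewrite !mxE; case: eqP => _; rewrite ?mulr1n ?mulr0n ?derivC ?deriv0.
have hevP t : hev t \o P = mxpath t.
  apply/funext => u; apply/matrixP => i j.
  by rewrite /= /mxpath !mxE /horner_eval !hornerE.
have hevdP t : hev t \o (de \o P) = mxpath_deriv t.
  apply/funext => u; apply/matrixP => i j.
  rewrite /= /mxpath_deriv !mxE /horner_eval.
  rewrite !(derivD, derivM, derivC, derivX, derivXn) /= !mulr0 !addr0 add0r mul1r.
  rewrite !(hornerD, hornerM, hornerC, hornerX, hornerMn) mulr2n; ring.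
have pP : parity false P.
  by move=> u su; rewrite /P p0// p1// p2// /C map_mx0 !scaler0 !addr0.
have B := @mulmx_biadditive.
have trhev t u : (\tr u).[t] = \tr (hev t u).
  by rewrite /mxtrace horner_sum; apply: eq_bigr => i _; rewrite mxE.
have trde u : (\tr u)^`() = \tr (de u).
  by rewrite /mxtrace linear_sum; apply: eq_bigr => i _; rewrite mxE.
exists (\tr (pow _ P n.+1 s)).
  (* The path is quadratic in the parameter; this bound fixes the number of quadrature nodes. *)
  have dP m : forall u, mxdeg (2 * m)%N (pow _ P m u).
    elim: m => [|m IH] u.
      case: u => [|a u] i j; rewrite /= mxE ?size_poly0//.
      by case: eqP => _; rewrite ?mulr1n ?mulr0n ?size_poly1 ?size_poly0.
    rewrite mulnS; apply: mxdeg_shuf => // v i j.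
    rewrite !mxE (leq_trans (size_polyD _ _))// geq_max.
    rewrite (leq_trans (size_polyD _ _)) ?geq_max /=; last first.
      rewrite (leq_trans (size_polyC_leq1 _))//=.
      rewrite (leq_trans (size_polyMleq _ _))// size_polyX.
      by case: size (size_polyC_leq1 (a1 v i j)) => [|[]].
    rewrite (leq_trans (size_polyMleq _ _))// size_polyXn.
    by case: size (size_polyC_leq1 (a2 v i j)) => [|[]].
  apply: (leq_trans (size_sum _ _ _)); apply/bigmax_leqP => i _; exact: dP.
move=> t; split.
  by rewrite trhev -(hevP t) -(cpow_map _ _ (hevD t) (hevM t) (hev1 t)).
rewrite trde (@tr_cpow_derivation _ _ (@mulmx _ r r r) 1%:M _ _ _ _ _ (@mxtrace _ r))//.
- rewrite hornerMn trhev (shuf_map (m' := @mulmx R r r r) (f := hev t) (g := hev t))//.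
  by rewrite hevdP -(hevP t) -(cpow_map _ _ (hevD t) (hevM t) (hev1 t)).
- exact: B.
- by move=> u; rewrite mul1mx.
- by move=> u; rewrite mulmx1.
- by move=> u v w; rewrite mulmxA.
- by move=> u v; rewrite raddfD.
- by move=> u v; rewrite mxtrace_mulC.
Qed.

End PolynomialPath.

(** * Transgression between two connections *)

Section ChernWeil.
Variables (R : realType) (M : manifold R) (A : lie_algebroid M) (E : vbundle M).
Variables (D0 D1 : section A -> section E -> section E).
Variables (c0 : is_connection D0) (c1 : is_connection D1).
Local Notation gpow := (cpow (@gend_comp _ _ E) (gend_id E)).
Local Notation ct := (conn_pathP c0 c1).

Definition diff_form : @endform R M A E 1 :=
  fun x v => gdiff c0 c1 (gext x (v ord0)) x.

Lemma gdiff_local (a b : gsec A) x : a x = b x -> gdiff c0 c1 a x = gdiff c0 c1 b x.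
Proof.
apply: (@tensor_local _ _ _ x _ (fun u => gdiff c0 c1 u x)) => f s t.
by rewrite gdiff_linear.
Qed.

Lemma diff_form_endform : is_endform diff_form.
Proof.
apply: is_endformP; last first.
  move=> a s; have := gendP (gdiff c0 c1 (a ord0)) s.
  congr smooth_section; apply: functional_extensionality_dep => x.
  by rewrite /diff_form (@gdiff_local _ (a ord0)) ?gextE.
apply/alternatingP => x; split=> [v i c u u'|v i j]; last by rewrite !ord1 eqxx.
by rewrite /diff_form ord1 /upd eqxx gext_linear gdiff_linear.
Qed.

Lemma ghatE_diff : ghatE diff_form_endform = diff_cochain c0 c1.
Proof.
apply/funext => s; have [s1|s1] := eqVneq (size s) 1%N; last first.
  rewrite diff_cochain_degree//; apply: gend_inj => x.
  by rewrite /= eq_hat_map (negPf s1).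
case: s s1 => [//|a [|//]] _; apply: gend_inj => x.
rewrite -[LHS]/(hat (diff_form (x := x)) [seq (c : gsec A) x | c <- [:: a]]) eq_hat_map.
by apply: gdiff_local; rewrite gextE.
Qed.

(* Both the derivative in t of gcurv_path and, by ced_diff, the covariant
   differential of the difference of the two connections. *)
Definition curv_deriv t (s : seq (gsec A)) : gend E :=
  if s is [:: a; b] then
    curv_linear_part c0 c1 a b + gendZ (sfun_cst M (2 * t)) (diff_square c0 c1 a b)
  else 0.

Lemma ced_diff_cochain t :
  ced (@gbr _ _ A) (gact (ct t)) (diff_cochain c0 c1) = curv_deriv t.
Proof.
apply/funext => s; have [s2|s2] := eqVneq (size s) 2.
  by case: s s2 => [//|a [//|b [|//]]] _; rewrite ced_diff.
rewrite (ced_degree _ (gactD (ct t)) (@diff_cochain_degree _ _ _ _ _ _ c0 c1))//.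
by case: s s2 => [|a [|b [|c s]]].
Qed.

(** The form tr(theta R_t^n), without the factor n + 1 from the derivative of tr(R_t^(n+1)); that
    factor goes into the quadrature weights. *)
Definition transgression t n : tform A :=
  homogeneous (endform_tr (ewedge diff_form
    (@endform_exp R M A E (curv_form (ct t)) n))).

Lemma is_tform_transgression t n : is_tform (transgression t n).
Proof.
apply: is_tform_homogeneous; apply: is_sform_endform_tr; apply: is_endform_ewedge.
  exact: diff_form_endform.
by apply: is_endform_exp; exact: curv_form_endform.
Qed.

(** Leibniz rule for the connection at time [t]: the powers of its curvature are covariantly closed,
    and the covariant differential of theta is [curv_deriv t]. *)
Lemma d_transgression t n (h : is_tform (transgression t n)) s :
  ced (@gbr _ _ A) (@grho _ _ A) (ghat h) s =
  gtr (shuf (@gend_comp _ _ E) (curv_deriv t) (gpow (curv_cochain (ct t)) n) s).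
Proof.
have hR := curv_form_endform (ct t); have he := is_endform_exp n hR.
have B := gend_comp_biadditive E.
rewrite (ghat_endform_tr (is_endform_ewedge diff_form_endform he)).
rewrite (ghatE_ewedge diff_form_endform he) (ghatE_exp hR).
rewrite (ghatE_curvature (ct t) _ (curv_formP (ct t))) ghatE_diff.
rewrite -(@ced_map _ _ _ _ (gact (ct t)) _ (@gtr _ _ E)); first last.
- by move=> a v; exact: gtr_act.
- exact: gtrD.
congr gtr; rewrite (@ced_shuf _ _ _ _ _ _ (gact (ct t)) (gact (ct t)))//; try exact: gactD.
- rewrite ced_diff_cochain [X in _ + shuf _ _ X s](_ : _ = fun=> 0).
    by rewrite (shuf0r B) addr0.
  by apply/funext => u; exact: ced_curv_pow.
- exact: gact_comp.
Qed.

Definition fib_mx x (g : 'End(E x)) : 'M[R]_(\dim {:E x}) :=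
  \matrix_(i, j) coord (vbasis {:E x}) i (g (tnth (vbasis {:E x}) j)).

Lemma fib_mxD x : {morph @fib_mx x : g h / g + h}.
Proof. by move=> g h; apply/matrixP => i j; rewrite !mxE add_lfunE linearD. Qed.

Lemma fib_mxZ x k (g : 'End(E x)) : fib_mx (k *: g) = k *: fib_mx g.
Proof. by apply/matrixP => i j; rewrite !mxE scale_lfunE linearZ. Qed.

Lemma fib_mxM x (g h : 'End(E x)) : fib_mx (g \o h)%VF = fib_mx g *m fib_mx h.
Proof.
apply/matrixP => i j; rewrite !mxE comp_lfunE.
rewrite {1}(coord_vbasis (memvf (h (tnth (vbasis {:E x}) j)))) !linear_sum.
by apply: eq_bigr => k _; rewrite !mxE !linearZ mulrC (tnth_nth 0 (vbasis _) k).
Qed.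

Lemma fib_mx1 x : fib_mx (\1%VF : 'End(E x)) = 1%:M.
Proof.
apply/matrixP => i j; rewrite !mxE id_lfunE (tnth_nth 0).
by rewrite coord_free ?(basis_free (vbasisP _))// eq_sym.
Qed.

Lemma fib_mx_tr x (g : 'End(E x)) : \tr (fib_mx g) = lfun_tr g.
Proof. by apply: eq_bigr => i _; rewrite mxE. Qed.

(** At a fixed point endomorphisms become matrices, and evaluation there is multiplicative, so
    [tr_mxpath_pow] applies. The polynomial varies with [s] and [x], but the bound on its degree
    does not. *)
Lemma curv_path_polynomial n s x : exists2 p : {poly R},
  (size p <= (2 * n.+1).+1)%N & forall t,
    p.[t] = gtr (gpow (curv_cochain (ct t)) n.+1 s) x /\
    p^`().[t] = gtr (shuf (@gend_comp _ _ E) (curv_deriv t)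
                       (gpow (curv_cochain (ct t)) n) s) x *+ n.+1.
Proof.
pose rho (g : gend E) := fib_mx (g x).
have rhoD : {morph rho : g h / g + h} by move=> g h; exact: fib_mxD.
have rhoM g h : rho (gend_comp g h) = rho g *m rho h by exact: fib_mxM.
have rho1 : rho (gend_id E) = 1%:M by exact: fib_mx1.
have rho0 : rho 0 = 0 by exact: morphD0 rhoD.
have rhoZ k g : rho (gendZ (sfun_cst M k) g) = k *: rho g by exact: fib_mxZ.
pose pairs (F : gsec A -> gsec A -> gend E) (u : seq (gsec A)) :=
  if u is [:: a; b] then rho (F a b) else 0.
have pairsP F : parity false (pairs F) by move=> [|a [|b [|c u]]].
have [p sp pE] := tr_mxpath_pow (pairsP (gcurv c0)) (pairsP (curv_linear_part c0 c1))
  (pairsP (diff_square c0 c1)) n s.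
have Kt t : mxpath (pairs (gcurv c0)) (pairs (curv_linear_part c0 c1))
    (pairs (diff_square c0 c1)) t = rho \o curv_cochain (ct t).
  apply/funext => -[|a [|b [|c u]]];
    rewrite /mxpath /= ?scaler0 ?addr0 ?rho0//.
  by rewrite gcurv_path (rhoD (_ + _)) (rhoD (gcurv _ _ _)) !rhoZ.
have dKt t : mxpath_deriv (pairs (curv_linear_part c0 c1))
    (pairs (diff_square c0 c1)) t = rho \o curv_deriv t.
  apply/funext => -[|a [|b [|c u]]];
    rewrite /mxpath_deriv /= ?scaler0 ?addr0 ?rho0//.
  by rewrite (rhoD (curv_linear_part _ _ _ _)) rhoZ.
exists p => // t; have [-> ->] := pE t.
rewrite Kt dKt -!(cpow_map _ _ rhoD rhoM rho1).
have trE g : gtr g x = \tr (rho g) by rewrite fib_mx_tr.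
split; first by rewrite trE.
rewrite -(shuf_map (m := @gend_comp _ _ E) (f := rho) (g := rho) (h := rho))//.
by rewrite trE.
Qed.

Lemma is_tform_sum (J : Type) (r : seq J) (c : J -> R) (F : J -> tform A) :
  (forall j, is_tform (F j)) ->
  is_tform (fun k x v => \sum_(j <- r) c j * F j k x v).
Proof.
move=> hF; elim: r => [|j r IH].
  rewrite (_ : (fun _ _ _ => _) = tzero A); first exact: is_tform0.
  by apply: functional_extensionality_dep => k; apply: functional_extensionality_dep => x;
     apply/funext => v; rewrite big_nil.
rewrite (_ : (fun _ _ _ => _) = tadd (tscale (c j) (F j))
  (fun k x v => \sum_(j <- r) c j * F j k x v)).
  by apply: is_tform_tadd => //; exact: is_tform_tscale.
by apply: functional_extensionality_dep => k; apply: functional_extensionality_dep => x;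
   apply/funext => v; rewrite big_cons.
Qed.

Lemma d_sum (J : Type) (r : seq J) (c : J -> R) (F : J -> tform A)
    (hF : forall j, is_tform (F j)) s x :
  ced (@gbr _ _ A) (@grho _ _ A) (ghat (is_tform_sum r c hF)) s x =
  \sum_(j <- r) c j * ced (@gbr _ _ A) (@grho _ _ A) (ghat (hF j)) s x.
Proof.
have -> : ghat (is_tform_sum r c hF) =
    fun s => \sum_(j <- r) sfun_mul (sfun_cst M (c j)) (ghat (hF j) s).
  by apply/funext => u; apply: sfun_inj => y; rewrite sfun_sumE.
elim: r => [|j r IH].
  rewrite big_nil [X in ced _ _ X](_ : _ = fun=> 0) ?d0//.
  by apply/funext => u; rewrite big_nil.
rewrite big_cons -IH [X in ced _ _ X](_ : _ =
  (fun s => sfun_mul (sfun_cst M (c j)) (ghat (hF j) s)) \+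
  (fun s => \sum_(j <- r) sfun_mul (sfun_cst M (c j)) (ghat (hF j) s))).
  by rewrite dD d_tscale.
by apply/funext => u; rewrite big_cons.
Qed.

Lemma eq_curv_cochain D D' (cD : is_connection D) (cD' : is_connection D') :
  (forall a s, gnab cD a s = gnab cD' a s :> gsec E) ->
  curv_cochain cD = curv_cochain cD' :> (seq (gsec A) -> gend E).
Proof.
move=> DD'; apply/funext => -[|a [|b [|c u]]] //=; apply: gend_ext => s.
by rewrite !gcurvE !DD'.
Qed.

(* The fundamental theorem of calculus along the path, with the integral of the
   polynomial transgression replaced by a quadrature formula. *)
Lemma chern_weil (w0 w1 : @endform R M A E 2) n :
  is_curvature_form D0 w0 -> is_curvature_form D1 w1 ->
  cohomologous (homogeneous (endform_tr (@endform_exp R M A E w1 n)))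
               (homogeneous (endform_tr (@endform_exp R M A E w0 n))).
Proof.
move=> cw0 cw1; have h0 := cw0.1; have h1 := cw1.1.
have e0 := is_endform_exp n h0; have e1 := is_endform_exp n h1.
have t0 := is_tform_homogeneous (is_sform_endform_tr e0).
have t1 := is_tform_homogeneous (is_sform_endform_tr e1).
case: n e0 e1 t0 t1 => [|n] e0 e1 t0 t1; first exact: cohomologous_refl.
apply/(cohomologousP t1 t0).
(* Nodes and weights are fixed before [s] and [x], so one combination of transgressions is a
   primitive everywhere. *)
have [c cP] := quadrature R (2 * n.+1).
have hF (j : 'I_(2 * n.+1)) := is_tform_transgression j%:R n.
exists _, (is_tform_sum (index_enum _) (fun j => c j *+ n.+1) hF) => s.
apply: sfun_inj => x; rewrite d_sum.
have [p sp pE] := curv_path_polynomial n s x.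
rewrite (eq_bigr (fun j => c j * p^`().[j%:R])); last first.
  move=> j _; rewrite d_transgression (pE j%:R).2 mulrnAl mulrnAr//.
rewrite (cP p sp) (pE 0).1 (pE 1).1.
rewrite (ghat_endform_tr e0) (ghatE_exp h0) (ghatE_curvature c0 _ cw0).
rewrite (ghat_endform_tr e1) (ghatE_exp h1) (ghatE_curvature c1 _ cw1).
rewrite (@eq_curv_cochain _ _ (ct 0) c0); last first.
  move=> a u; rewrite gnab_path; apply: gsec_inj => y.
  by rewrite gsecDE gsecZE scale0r addr0.
rewrite (@eq_curv_cochain _ _ (ct 1) c1)// => a u.
by rewrite gnab_path gsecZ1 gdiffE addrC subrK.
Qed.

End ChernWeil.

(** * Forms that vanish on a subalgebroid *)

Section BasicForms.
Variables (R : realType) (M : manifold R) (A : lie_algebroid M).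
Variable P : forall x : M, A x -> Prop.

(** For [P] the image of B and closed scalar forms, Cartan's formula adds invariance under the Lie
    derivatives along B, so this is the usual notion of a basic form. *)
Definition basic_at (V : M -> vectType R) k (w : form A V k) : Prop :=
  forall x v i, P (v i) -> w x v = 0.

Definition basic (w : tform A) : Prop := forall k, basic_at (w k).

Lemma basic_wedge (U V W : M -> vectType R) (m : forall x, U x -> V x -> W x)
    k l (w : form A U k) (w' : form A V l) : (forall x, bilinear_op (@m x)) ->
  basic_at w -> basic_at w' -> basic_at (wedge m w w').
Proof.
move=> mB bw bw' x v i Pi; have B := bilinear_biadditive (mB x).
rewrite /wedge big1 ?scaler0// => s _.
have vi : v i = v (s (s^-1 i)%g) by rewrite permKV.
case: (split_ordP (s^-1 i)%g) vi => j -> vi.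
  by rewrite (bw _ _ j) ?(morphD0 (B.1 _)) ?scaler0// -vi.
by rewrite (bw' _ _ j) ?(morphD0 (B.2 _)) ?scaler0// -vi.
Qed.

Lemma basic_tmul w w' : basic w -> basic w' -> basic (tmul w w').
Proof.
move=> bw bw' k x v i Pi; rewrite /tmul big1// => j _; set e := subnKC _.
apply: (@basic_wedge _ _ _ (fun _ (r s : R^o) => r * s : R^o) _ _ _ _ _
  (bw j) (bw' (k - j)%N) x _ (cast_ord (esym e) i)) => [y|].
  exact: mulr_bilinear.
by rewrite /= cast_ordKV.
Qed.

Lemma basic_comb c w w' : basic w -> basic w' -> basic (tadd (tscale c w) w').
Proof.
move=> bw bw' k x v i Pi.
by rewrite /tadd /tscale (bw k x v i)// (bw' k x v i)// mulr0 addr0.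
Qed.

Lemma homogeneous_ne l (w : sform A l) k x v : l <> k -> homogeneous w (k := k) (x := x) v = 0.
Proof. by move=> lk; rewrite /homogeneous; case: eqP. Qed.

Lemma homogeneous_id l (w : sform A l) x v : homogeneous w (x := x) v = w x v.
Proof.
rewrite /homogeneous; case: eqP => // e; congr (w x); apply/funext => i /=.
by congr v; apply: val_inj.
Qed.

Lemma basic_homogeneous l (w : sform A l) : basic_at w -> basic (homogeneous w).
Proof.
move=> bw k x v i Pi; have [e|ne] := eqVneq l k; last by apply: homogeneous_ne; apply/eqP.
by subst k; rewrite homogeneous_id; apply: bw Pi.
Qed.

Lemma basic_exp (E : vbundle M) (w : @endform R M A E 2) n :
  basic_at w -> basic_at (@endform_exp R M A E w n).
Proof.
move=> bw; elim: n => [|n IH]; first by move=> x v [].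
exact: (basic_wedge (@fib_comp_bilinear _ _ E) bw IH).
Qed.

Lemma basic_endform_tr (E : vbundle M) k (w : @endform R M A E k) :
  basic_at w -> basic_at (endform_tr w).
Proof. by move=> bw x v i Pi; rewrite /endform_tr (bw x v i)// lfun_tr0. Qed.

End BasicForms.

Section BasicSubalgebra.
Variables (R : realType) (M : manifold R) (A : lie_algebroid M).
Variable P : forall x : M, A x -> Prop.

Definition basic_classes : set (set (tform A)) :=
  [set c | exists w, [/\ closed_form w, basic P w & c = coh_class w]].

(** The conditions of [subalgebra] speak of arbitrary closed representatives; each operation is
    transported to the basic ones by its compatibility with cohomology. *)
Lemma basic_classes_subalgebra : subalgebra basic_classes.
Proof.
have tadd1 (w w' : tform A) : tadd w w' = tadd (tscale 1 w) w'.
  apply: functional_extensionality_dep => k; apply: functional_extensionality_dep => x.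
  by apply/funext => v; rewrite /tadd /tscale mul1r.
have tscale0 c (w : tform A) : tscale c w = tadd (tscale c w) (tzero A).
  apply: functional_extensionality_dep => k; apply: functional_extensionality_dep => x.
  by apply/funext => v; rewrite /tadd /tzero addr0.
have closed0 : closed_form (tzero A).
  apply/(closed_formP (is_tform0 A)) => s; rewrite -[RHS](d0 s); congr ced.
  by apply/funext => t; apply: sfun_inj.
split.
- by move=> c [w [cw _ ->]]; exists w.
- exists (tone A); split => //; first exact: closed_tone.
  by move=> [|k] x v i _ //; case: i.
- move=> w w' cw cw' [u [cu bu e]] [u' [cu' bu' e']].
  exists (tadd u u'); rewrite (tadd1 w) (tadd1 u); split; [exact: closed_comb|exact: basic_comb|].
  apply: coh_class_eq; [exact: (closed_comb 1 cw cw').1|exact: (closed_comb 1 cu cu').1|].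
  apply: cohomologous_comb; [exact: cw.1|exact: cu.1|exact: cw'.1|exact: cu'.1| |].
    exact: coh_class_inj cw.1 e.
  exact: coh_class_inj cw'.1 e'.
- move=> c w cw [u [cu bu e]]; exists (tscale c u).
  rewrite (tscale0 _ w) (tscale0 _ u); split; [exact: closed_comb|exact: basic_comb|].
  apply: coh_class_eq; [exact: (closed_comb c cw closed0).1|exact: (closed_comb c cu closed0).1|].
  apply: cohomologous_comb; [exact: cw.1|exact: cu.1|exact: closed0.1|exact: closed0.1| |].
    exact: coh_class_inj cw.1 e.
  by apply: cohomologous_refl; exact: closed0.1.
- move=> w w' cw cw' [u [cu bu e]] [u' [cu' bu' e']].
  exists (tmul u u'); split; [exact: closed_tmul|exact: basic_tmul|].
  apply: coh_class_eq; [exact: (closed_tmul cw cw').1|exact: (closed_tmul cu cu').1|].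
  apply: cohomologous_tmul => //.
    exact: coh_class_inj cw.1 e.
  exact: coh_class_inj cw'.1 e'.
Qed.

End BasicSubalgebra.

(** * Vanishing of basic forms above the codimension *)

Section DegreeBound.
Variables (R : realType) (M : manifold R) (A B : lie_algebroid M).
Variable iota : forall x, 'Hom(B x, A x).

Definition in_sub (x : M) (u : A x) : Prop := exists b, u = iota x b.

Lemma dim_fiber (E : vbundle M) x : \dim {:E x} = rank E.
Proof.
have [e fe ex] := frame_cover E x; have be := frame_basis fe ex.
by have := basis_free be; rewrite /free (span_basis be) size_tuple => /eqP.
Qed.

(** A complement [C] of the image of B in a fibre has dimension q. Components along B contribute 0,
    so the arguments may be taken from a basis of [C], and more than q of them contain a
    repetition. *)
Lemma basic_degree_bound q (w : tform A) k : lie_subalgebroid iota ->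
  rank A = (rank B + q)%N -> is_tform w -> basic in_sub w -> (q < k)%N ->
  forall x v, w k x v = 0.
Proof.
move=> sub rA hw bw qk x v.
pose U := limg (iota x); pose C := (U^C)%VS; pose n := \dim C.
have dimU : \dim U = rank B.
  rewrite /U limg_dim_eq ?dim_fiber//.
  by have /lker0P/eqP -> := @sub_inj _ _ _ _ _ sub x; rewrite capv0.
have nq : n = q by rewrite /n dimv_compl dim_fiber dimU rA addKn.
have wA := is_tform_altmap hw k x.
apply: (slot_induction (e := fun j : 'I_n => tnth (vbasis C) j) (S := fun=> True)
  (Q := fun v => w k x v = 0)) => // [I|v' i u _ H].
  have : ~~ injectiveb I.
    apply/injectiveP => /leq_card; rewrite !card_ord leqNgt nq qk//.
  by move=> /injectivePn[i [j ij Iij]]; apply: (wA.2 _ i j) => //=; rewrite Iij.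
have : u \in (U + C)%VS by rewrite addv_complf memvf.
move=> /memv_addP[y /memv_imgP[b _ ->] [z zC ->]].
rewrite (altmapD wA) (bw k x _ i) ?add0r; last by rewrite /upd eqxx; exists b.
rewrite (coord_vbasis zC) (altmap_sum wA) big1// => j _.
by have := H j; rewrite (tnth_nth 0) => ->; rewrite scaler0.
Qed.

End DegreeBound.

(** * The connection adapted to B *)

Section AtiyahConnection.
Variables (R : realType) (M : manifold R) (B A : lie_algebroid M).
Variable iota : forall x, 'Hom(B x, A x).
Variable E : vbundle M.
Hypothesis sub : lie_subalgebroid iota.

Fact smap_smooth (b : gsec B) : smooth_section (smap iota b).
Proof.
move=> e fe i; apply: smooth_on_local => x ex.
have [d fd dx] := frame_cover B x.
have oU : open (frame_dom d `&` frame_dom e) by apply: openI; exact: frame_open.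
exists (frame_dom d `&` frame_dom e) => //.
apply: (@smooth_on_ext _ _ _ (fun y => \sum_j coord (frame_vec d y) j (b y) *
  coord (frame_vec e y) i (iota y (tnth (frame_vec d y) j)))) => //.
  move=> y; rewrite inE => -[dy ey].
  rewrite /smap [in RHS](coord_basis (frame_basis fd dy) (memvf (b y))) !linear_sum.
  by apply: eq_bigr => j _; rewrite !linearZ (tnth_nth 0).
apply: smooth_on_sum => // j _; apply: smooth_onM => //.
  by apply: smooth_on_sub (gsecP b fd j) => y [].
exact: (sub_smooth sub).
Qed.

Definition gsub (b : gsec B) : gsec A := GSec (smap_smooth b).

(** A form of degree 0 takes an empty family of arguments, written [fun=> 0]. *)
Lemma hform0_smooth (w : @hform R M B A E 0) : is_hform iota w ->
  forall (a : gsec A) (s : gsec E),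
    smooth_section (fun x => w x (fun=> 0) (a x) (s x)).
Proof.
move=> [_ _ sw] a s; apply: smooth_section_local => x.
have [d fd dx] := frame_cover B x; have [e fe ex] := frame_cover A x.
have [f ff fx] := frame_cover E x.
have oU : open (frame_dom d `&` frame_dom e `&` frame_dom f).
  by apply: openI; [apply: openI|]; exact: frame_open.
exists (frame_dom d `&` frame_dom e `&` frame_dom f), f; split; [by []|by []|by []| |].
  by move=> y [].
move=> j; apply: (@smooth_on_ext _ _ _ (fun y => \sum_h \sum_i
  coord (frame_vec e y) h (a y) * (coord (frame_vec f y) i (s y) *
  coord (frame_vec f y) j (w y (fun=> 0) (tnth (frame_vec e y) h) (tnth (frame_vec f y) i))))) => //.
  move=> y; rewrite inE => -[[dy ey] fy].
  rewrite [in RHS](coord_basis (frame_basis fe ey) (memvf (a y))) linear_sum.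
  rewrite sum_lfunE linear_sum; apply: eq_bigr => h _.
  rewrite linearZ scale_lfunE linearZ [in RHS](coord_basis (frame_basis ff fy) (memvf (s y))).
  rewrite !linear_sum -mulr_sumr; congr (_ * _); apply: eq_bigr => i _.
  by rewrite !linearZ !(tnth_nth 0).
apply: smooth_on_sum => // h _; apply: smooth_on_sum => // i _.
apply: smooth_onM => //; first by apply: smooth_on_sub (gsecP a fe h) => y [[]].
apply: smooth_onM => //; first by apply: smooth_on_sub (gsecP s ff i) => y [].
have I0 : 'I_0 -> 'I_(rank B) by case.
have := sw d e f fd fe ff I0 h i j.
congr smooth_on; apply/funext => y; congr (coord _ _ (w y _ _ _)).
by apply/funext => -[].
Qed.

Variables (D : section B -> section E -> section E).

(* D1 = Dt + eta, where eta is a primitive of the opposite of the Atiyah cocycle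
   of Dt. *)
Lemma vanishing_atiyah_connection : is_connection D ->
  vanishing_atiyah_class iota D ->
  exists D1 : section A -> section E -> section E, exists c1 : is_connection D1,
    forall (b : gsec B) (a : gsec A), gcurv c1 (gsub b) a = 0.
Proof.
move=> cD [Dt [w [cDt ext [hw atw] hcl]]].
have hz k : is_hform iota (@hzero R M B A E k).
  split.
  - by split=> [x v i c u u'|//]; rewrite /hzero scaler0 addr0.
  - by move=> x v b; rewrite /hzero zero_lfunE.
  - move=> d e f fd fe ff I h i j.
    rewrite (_ : (fun x => _) = fun=> 0); first exact: smooth_on_cst.
    by apply/funext => x; rewrite /hzero !zero_lfunE linear0.
have dz k : is_hdifferential iota D (@hzero R M B A E k) (@hzero R M B A E k.+1).
  move=> b a s sb sa ss x; rewrite /hzero !zero_lfunE big1// => i _.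
  rewrite /nabla_Hom !zero_lfunE big1// !subr0.
  have nab0 : gnab cD (GSec (sb i)) 0 = 0 by exact: morphD0 (gnabDr cD (GSec (sb i))).
  have := congr1 (fun t : gsec E => t x) nab0.
  rewrite -[LHS]/(D (b i) (fun y => 0) x) => D0.
  rewrite (_ : (fun y => _) = (fun y => 0 : E y)) ?D0 ?scaler0//.
  by apply: functional_extensionality_dep => y; rewrite !zero_lfunE.
(* The class of the cocycle [w] equals that of 0, and 0 belongs to the latter; hence 0 - w is exact,
   whence the sign. *)
have [eta heta deta] : exists2 eta : @hform R M B A E 0, is_hform iota eta &
    is_hdifferential iota D eta (fun x v => - w x v).
  have : hclass iota D w (@hzero R M B A E 1).
    rewrite -hcl; split; first by split; [exact: hz|exact: dz].
    exists (@hzero R M B A E 0); first exact: hz.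
    move=> b a s sb sa ss x; rewrite -(dz 0%N b a s sb sa ss) /hzero.
    by rewrite subr0.
  move=> [_ [eta heta deta]]; exists eta => //.
  move=> b a s sb sa ss x; rewrite -(deta b a s sb sa ss) /hzero.
  by rewrite sub0r.
have [_ etaB _] := heta.
have sT := hform0_smooth heta.
pose T a s := GSec (sT a s).
have TD a s s' : T a (s + s') = T a s + T a s'.
  by apply: gsec_inj => x; rewrite /= linearD.
pose D1 (a : section A) (s : section E) : section E :=
  fun x => Dt a s x + eta x (fun=> 0) (a x) (s x).
have c1 : is_connection D1.
  split.
  - move=> a s sa ss; exact: (gsecP (gnab cDt (GSec sa) (GSec ss) + T (GSec sa) (GSec ss))).
  - move=> f a b s sf sa sb ss x; rewrite /D1 (conn_linear_l cDt sf sa sb ss).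
    rewrite /sadd /sscale linearD linearZ add_lfunE scale_lfunE.
    by rewrite scalerDr addrACA.
  - move=> a s s' sa ss ss' x; rewrite /D1 (conn_add_r cDt sa ss ss').
    by rewrite /sadd linearD addrACA.
  - move=> f a s sf sa ss x; rewrite /D1 (conn_leibniz cDt sf sa ss).
    by rewrite /sscale linearZ scalerDr addrAC.
have nab1 a s : gnab c1 a s = gnab cDt a s + T a s by exact: gsec_inj.
have Tsub b s : T (gsub b) s = 0.
  by apply: gsec_inj => x; rewrite /= etaB zero_lfunE.
have nabB b s : gnab cDt (gsub b) s = gnab cD b s.
  by apply: gsec_inj => x; exact: ext (gsecP b) (gsecP s) x.
exists D1, c1 => b a; apply: gend_ext => s; rewrite gcurvE gapp0.
apply: gsec_inj => x.
have e1 : gcurv cDt (gsub b) a x (s x) = w x (fun=> b x) (a x) (s x).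
  rewrite -[LHS]/(gapp (gcurv cDt (gsub b) a) s x) gcurvE.
  exact/esym/(atw _ _ _ (gsecP b) (gsecP a) (gsecP s)).
have e2 := deta (fun=> gsec_fun b) a s (fun=> gsecP b) (gsecP a) (gsecP s) x.
rewrite big_ord1 expr0 scale1r big_pred0 ?subr0 in e2; last by move=> j; rewrite (ord1 j).
have {}e2 : - w x (fun=> b x) (a x) (s x) = gnab cD b (T a s) x -
    T (gbr (gsub b) a) s x - T a (gnab cD b s) x.
  have v0 y (v : 'I_0 -> B y) : eta y v = eta y (fun=> 0).
    by congr (eta y _); apply/funext => -[].
  have -> : - w x (fun=> b x) (a x) (s x) = (- w x (fun=> b x)) (a x) (s x).
    by rewrite !opp_lfunE.
  rewrite e2 /nabla_Hom !(v0 x); congr (_ - _ - _).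
  rewrite (_ : (fun y => _) = gsec_fun (T a s))//.
  by apply: functional_extensionality_dep => y; rewrite v0.
move: e1; rewrite -[LHS]/(gapp (gcurv cDt (gsub b) a) s x) gcurvE => e1.
have T0 : T a 0 = 0 by exact: morphD0 (TD a).
have nab0 : gnab cDt a 0 = 0 by exact: morphD0 (gnabDr cDt a).
(* The correction [T] vanishes on B, so [D1] still extends [D], and the curvature changes exactly by
   the right-hand side of [e2], the opposite of the cocycle in [e1]. *)
rewrite !nab1 !gnabDr !TD !Tsub nab0 T0 !nabB addr0; rewrite !nabB in e1.
apply: vec_ext => i; have := congr1 (coord (vbasis {:E x}) i) e1.
have := congr1 (coord (vbasis {:E x}) i) e2.
rewrite !(gsecDE, gsecNE, gsec0E, vcoordD, vcoordN, vcoord0).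
lra.
Qed.

End AtiyahConnection.

(** The curvature at a point depends only on the values of its arguments there, so a vector in the
    image of B may be extended by a section of B; antisymmetry covers the second slot. *)
Lemma curv_form_basic (R : realType) (M : manifold R) (B A : lie_algebroid M)
    (iota : forall x, 'Hom(B x, A x)) (E : vbundle M) (sub : lie_subalgebroid iota)
    (D1 : section A -> section E -> section E) (c1 : is_connection D1) :
  (forall (b : gsec B) (a : gsec A), gcurv c1 (gsub sub b) a = 0) ->
  basic_at (@in_sub R M A B iota) (curv_form c1).
Proof.
move=> cB x v i [b vib].
have cb0 (u : A x) a : u = iota x b -> gcurv c1 (gext x u) a x = 0.
  move=> ub; rewrite (@gcurv_local _ _ _ _ _ c1 _ a (gsub sub (gext x b)) a) ?cB//.
  by rewrite gextE ub /= /smap gextE.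
rewrite /curv_form; have [i0|i1] : i = ord0 \/ i = ord_max.
  by case: i {vib} => -[|[|//]] n2; [left|right]; exact: val_inj.
  by apply: cb0; rewrite -i0.
rewrite gcurv_anti -[LHS]/(- gcurv c1 _ _ x) cb0 ?oppr0//.
by rewrite -i1.
Qed.

(** As [w0] vanishes in degree l, a primitive of [homogeneous w] minus [w0] has a component of
    degree l - 1 that is a primitive of [w] alone. *)
Lemma coh_class_homogeneous_eq0 (R : realType) (M : manifold R) (A : lie_algebroid M)
    l (w : sform A l) (w0 : tform A) : (0 < l)%N ->
  closed_form (homogeneous w) -> closed_form w0 -> (forall x v, w0 l x v = 0) ->
  coh_class (homogeneous w) = coh_class w0 ->
  coh_class (homogeneous w) = coh_zero A.
Proof.
case: l w => // l w _ cw cw0 w0l e; apply: coh_class_eq; [exact: cw.1|exact: is_tform0|].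
have [eta heta [deta0 deta]] := coh_class_inj cw.1 e.
have [_ [_ d00]] : closed_form (tzero A).
  apply/(closed_formP (is_tform0 A)) => s; rewrite -[RHS](d0 s); congr ced.
  by apply/funext => t; apply: sfun_inj.
have homE (u : sform A l) : homogeneous u (k := l) = u.
  by apply: functional_extensionality_dep => x; apply/funext => v; exact: homogeneous_id.
have homN k n (u : sform A k) : k <> n -> homogeneous u (k := n) = tzero A n.
  move=> kn; apply: functional_extensionality_dep => x; apply/funext => v.
  exact: homogeneous_ne.
(* Here [l] is the degree of [w] minus one. *)
exists (homogeneous (eta l)); first by apply: is_tform_homogeneous.
split=> [x v|k]; first by rewrite /tadd /tscale homogeneous_ne// /tzero mulr0 addr0.
have [kl|/eqP kl] := eqVneq l k.
  subst k; rewrite homE; have := deta l; congr is_differential.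
  apply: functional_extensionality_dep => x; apply/funext => v.
  by rewrite /tadd /tscale w0l.
rewrite homN//; have := d00 k; congr is_differential.
apply: functional_extensionality_dep => x; apply/funext => v.
by rewrite /tadd /tscale homogeneous_ne ?mulr0 ?addr0//; move=> -[].
Qed.

Theorem theorem3p4 (R : realType) (M : manifold R) (E : vbundle M)
    (A : lie_algebroid M) (q : nat) :
  (exists (B : lie_algebroid M) (iota : forall x, 'Hom(B x, A x))
      (D : section B -> section E -> section E),
    [/\ lie_subalgebroid iota, rank A = (rank B + q)%N,
        representation D & vanishing_atiyah_class iota D]) ->
  forall l : nat, (q < l)%N -> Pont A E l = [set coh_zero A].
Proof.
move=> [B [iota [D [sub rA [cD _] van]]]] l ql.
have [D1 [c1 cB]] := vanishing_atiyah_connection sub cD van.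
have bR := curv_form_basic cB.
(* A generator computed with any connection [D2] is also represented by means of [D1], whose
   curvature form is basic. *)
have sigma_basic : [set c | exists2 i, (0 < i)%N & is_sigma E i c] `<=`
    basic_classes (@in_sub R M A B iota).
  move=> c [i _ [D2 [w [c2 cw ->]]]].
  exists (homogeneous (endform_tr (@endform_exp R M A E (curv_form c1) i))).
  have cR := curv_formP c1; split; first exact: (closed_tr_exp c1 _ cR).
    by apply: basic_homogeneous; apply: basic_endform_tr; exact: basic_exp.
  apply: coh_class_eq; [exact: (closed_tr_exp c2 i cw).1|exact: (closed_tr_exp c1 i cR).1|].
  exact: (chern_weil c1 c2 i cR cw).
have l0 : (0 < l)%N by exact: leq_ltn_trans ql.
apply/seteqP; split=> c.
  (* Minimality of [Pont_total] gives a basic representative [w0], in general of mixed degree. *)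
  move=> [/(_ _ (conj (basic_classes_subalgebra _) sigma_basic)) [w0 [cw0 bw0 cE]]].
  move=> [w cw wE]; rewrite /= -wE; apply: (coh_class_homogeneous_eq0 l0 cw cw0).
    exact: (basic_degree_bound sub rA cw0.1 bw0 ql).
  by rewrite wE.
(* Conversely, the zero class is 0 times the unit, so it lies in every subalgebra, and the zero form
   represents it in degree [l]. *)
move=> ->; split.
  move=> S [sS _].
  have -> : coh_zero A = coh_class (tscale 0 (tone A)).
    congr coh_class; apply: functional_extensionality_dep => k.
    apply: functional_extensionality_dep => x; apply/funext => v.
    by rewrite /tscale mul0r.
  by apply: (subalg_scale sS) (closed_tone A) (subalg_one sS).
have h0 : homogeneous (fun (x : M) (v : 'I_l -> A x) => 0 : R^o) = tzero A.
  apply: functional_extensionality_dep => k; apply: functional_extensionality_dep => x.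
  by apply/funext => v; rewrite /homogeneous; case: eqP.
exists (fun (x : M) (v : 'I_l -> A x) => 0); rewrite /= h0//.
apply/(closed_formP (is_tform0 A)) => s; rewrite -[RHS](d0 s); congr ced.
by apply/funext => t; apply: sfun_inj.
Qed.
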